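(* Let $d\ge 3$, let $Q$ be a positive definite quadratic form on $\mathbb{R}^d$, and let $p^*=\frac{2d}{d-2}$. For every $\epsilon>0$ there is a constant $C$, depending only on $d,Q,\chi,\epsilon$, such that for all $\lambda>1$ and all $\delta\in(0,1)$ with $\delta\ge\lambda^{-\frac{1}{2d-1}}$, $$ \| P_{\lambda,\delta} \|_{L^{2}(\mathbb{T}^d) \to L^{p^*}(\mathbb{T}^d)} \le C\lambda^{\epsilon}\left[ (\lambda \delta)^{\frac{d-1}{2} \left( \frac{1}{2} - \frac{1}{p^*} \right)} + \lambda^{\sigma(p^* )/2} \delta^{1/2}\right]. $$
   Context: $\mathbb{T}^d=\mathbb{R}^d/\mathbb{Z}^d$. $\chi:\mathbb{R}\to[0,\infty)$ is a fixed bounded non-negative cutoff function supported in $[-1,1]$ and equal to $1$ on $[-\frac12,\frac12]$. For $\lambda\ge1$ and $0<\delta<1$, $P_{\lambda,\delta}$ is the Fourier multiplier on $\mathbb{T}^d$ with symbol $\chi\big(\frac{\sqrt{Q(k)}-\lambda}{\delta}\big)$, i.e. $P_{\lambda,\delta}f(x)=\sum_{k\in\mathbb{Z}^d}\chi\big(\frac{\sqrt{Q(k)}-\lambda}{\delta}\big)\widehat f_k e^{2\pi i k\cdot x}$, where $\widehat f_k=\int_{\mathbb{T}^d}f(x)e^{-2\pi i k\cdot x}\,dx$. Also $\sigma(p)=d-1-\frac{2d}{p}$. *)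

(* Defs.v *)
From HB Require Import structures.
From mathcomp Require Import all_boot all_order all_algebra.
From mathcomp Require Import all_classical all_reals all_analysis.
From mathcomp Require Import complex.

Set Implicit Arguments.
Unset Strict Implicit.
Unset Printing Implicit Defensive.

Import Order.TTheory GRing.Theory Num.Theory.
Import numFieldNormedType.Exports.
Import ComplexField.Normc.

Local Open Scope classical_set_scope.
Local Open Scope ring_scope.
Local Open Scope complex_scope.

Section quadratic_form.
Variables (R : realType) (d : nat).
Implicit Type Q : 'rV[R]_d -> R.

Definition quadratic_form Q :=
  exists A : 'M[R]_d, forall x, Q x = (x *m A *m x^T) 0 0.

Definition positive_definite Q := forall x, x != 0 -> 0 < Q x.

End quadratic_form.

(* Points of R^d are [d.-tuple R], the type for which the library has the
   product sigma-algebra, and the torus T^d = R^d / Z^d is handled through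
   Z^d-periodic functions on R^d, integrated over the unit cube. *)
Section torus_measure.
Variable R : realType.

(* [uniform_prob] lives on [measurableTypeR R], the same sigma-algebra as that
   of [R] under another display. *)
Definition torus_cons n (x : measurableTypeR R * n.-tuple R) :
  n.+1.-tuple R := [tuple of x.1 :: x.2].

Lemma measurable_torus_cons n : measurable_fun setT (@torus_cons n).
Proof.
exact: (@measurable_cons _ _ (measurableTypeR R * n.-tuple R)%type R fst).
Qed.

HB.instance Definition _ n :=
  isMeasurableFun.Build _ _ _ _ (@torus_cons n) (@measurable_torus_cons n).

(* Lebesgue measure on the unit cube [0, 1]^d. *)
Fixpoint torus_measure d : probability (d.-tuple R) R :=
  if d is n.+1 then
    distribution (uniform_prob (@ltr01 R) \x torus_measure n)%E (@torus_cons n)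
  else \d_([tuple] : 0.-tuple R).

End torus_measure.

Section torus_functions.
Variables (R : realType) (d : nat).
Implicit Types (f : d.-tuple R -> R[i]) (k : 'rV[int]_d) (x : d.-tuple R).

Definition translate x k := [tuple tnth x i + (k 0 i)%:~R | i < d].

Definition torus_fun f :=
  [/\ forall x k, f (translate x k) = f x,
      measurable_fun setT (fun x => complex.Re (f x)) &
      measurable_fun setT (fun x => complex.Im (f x))].

Definition torus_int f : R[i] :=
  (\int[torus_measure R d]_x complex.Re (f x)) +i*
  (\int[torus_measure R d]_x complex.Im (f x)).

Definition torus_Lnorm (p : R) f : \bar R :=
  'N[torus_measure R d]_p%:E [EFin \o (@normc R \o f)]%E.

Definition torus_char k x : R[i] :=
  let t := 2 * pi * \sum_(i < d) (k 0 i)%:~R * tnth x i in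
  (cos t +i* sin t).

Definition fourier_coef f k : R[i] :=
  torus_int (fun x => f x * torus_char (- k) x).

Definition spectral_symbol (chi : R -> R) (Q : 'rV[R]_d -> R)
    (lambda delta : R) k : R :=
  chi ((Num.sqrt (Q (map_mx intr k)) - lambda) / delta).

(* [\sum_(k \in _)] only makes sense for finitely many nonzero terms. For
   positive definite Q and chi vanishing outside [-1, 1] the symbol is nonzero
   at finitely many k only (finite_spectral_window below). *)
Definition spectral_projector (chi : R -> R) (Q : 'rV[R]_d -> R)
    (lambda delta : R) f x : R[i] :=
  \sum_(k \in [set: 'rV[int]_d])
    (spectral_symbol chi Q lambda delta k)%:C *
      fourier_coef f k * torus_char k x.

Definition torus_opnorm (p q : R)
    (T : (d.-tuple R -> R[i]) -> d.-tuple R -> R[i]) : \bar R :=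
  ereal_sup [set torus_Lnorm q (T f) | f in
    [set f | torus_fun f /\ (torus_Lnorm p f <= 1)%E]].

End torus_functions.

Section exponents.
Variables (R : realType) (d : nat).

Definition sigma (p : R) : R := d%:R - 1 - 2 * d%:R / p.

Definition pstar : R := 2 * d%:R / (d%:R - 2).

End exponents.

Definition cutoff (R : realType) (chi : R -> R) :=
  [/\ forall t, 0 <= chi t,
      exists M, forall t, chi t <= M,
      forall t, 1 < `|t| -> chi t = 0 &
      forall t, `|t| <= 2^-1 -> chi t = 1].

Lemma posdef_lower_bound (R : realType) (d : nat) (Q : 'rV[R]_d -> R) :
  quadratic_form Q -> positive_definite Q ->
  exists2 c, 0 < c & forall x, c * `|x| ^+ 2 <= Q x.
Proof.
move=> [A QE] Qpos.
have Q0 : Q 0 = 0 by rewrite QE !mul0mx mxE.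
have QZ a x : Q (a *: x) = a ^+ 2 * Q x.
  by rewrite !QE linearZ/= -!(scalemxAl, scalemxAr) !mxE mulrA expr2.
have Qcont : continuous Q.
  rewrite (_ : Q = fun x => \sum_(j < d) (\sum_(i < d) x 0 i * A i j) * x 0 j).
    have Acont j : continuous (fun x : 'rV[R]_d => \sum_(i < d) x 0 i * A i j).
      apply: continuous_big => [|i _ x]; first exact: add_continuous.
      apply: cvgM; [exact: nbhs_filter x| |].
        exact: coord_continuous.
      by apply: cvg_cst; exact: nbhs_filter x.
    apply: continuous_big => [|j _ x]; first exact: add_continuous.
    apply: cvgM; [exact: nbhs_filter x|exact: (Acont j x)|].
    exact: coord_continuous.
  apply/funext => x; rewrite QE mxE; apply: eq_bigr => j _.
  by rewrite !mxE.
pose S : set 'rV[R]_d := [set x | `|x| = 1].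
have scale_sphere x : x != 0 -> S (`|x|^-1 *: x).
  by move=> x0; rewrite /S/= normrZ normrV ?unitfE ?normr_eq0// normr_id
    mulVf// normr_eq0.
have [S0|/set0P S0] := eqVneq S set0.
  exists 1 => // x; have [->|x0] := eqVneq x 0.
    by rewrite normr0 expr0n/= mulr0 Q0.
  by have := scale_sphere _ x0; rewrite S0.
have cS : compact S.
  apply: bounded_closed_compact.
    by exists 1; split => // M M1 x; rewrite /S/= => ->; exact: ltW.
  rewrite (_ : S = Num.norm @^-1` [set 1])//.
  apply: preimage_closed; last exact: closed_eq.
  by move=> x _; exact: norm_continuous.
have [c Sc cmin] := EVT_min_rV S0 cS (continuous_subspaceT Qcont).
have c0 : c != 0 by apply: contraTneq (oner_neq0 R) => c0;
  move: Sc; rewrite inE /S/= c0 normr0 => ->; rewrite eqxx.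
exists (Q c); first exact: Qpos.
move=> x; have [->|x0] := eqVneq x 0.
  by rewrite normr0 expr0n/= mulr0 Q0.
have := cmin (`|x|^-1 *: x); rewrite inE => /(_ (scale_sphere _ x0)).
by rewrite QZ exprVn mulrC ler_pdivlMr// exprn_gt0// normr_gt0.
Qed.

Lemma finite_spectral_window (R : realType) (d : nat) (Q : 'rV[R]_d -> R)
    (chi : R -> R) (lambda delta : R) :
  quadratic_form Q -> positive_definite Q -> cutoff chi -> 0 < delta ->
  finite_set [set k : 'rV[int]_d | spectral_symbol chi Q lambda delta k != 0].
Proof.
move=> Qf Qp [_ _ chi0 _] delta0.
have [c c0 cQ] := posdef_lower_bound Qf Qp.
pose B := Num.sqrt ((`|lambda| + delta) ^+ 2 / c).
pose N := (Num.truncn B).+1.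
have BN : B < N%:R by exact: truncnS_gt.
pose h (g : {ffun 'I_d -> 'I_N.*2.+1}) : 'rV[int]_d :=
  \row_i ((g i)%:Z - N%:Z).
apply: (@sub_finite_set _ _ (h @` setT)); last exact/finite_image/finite_finset.
move=> k /=; apply: contra_neqP => nk; apply: chi0.
rewrite normrM normfV (gtr0_norm delta0) ltr_pdivlMr// mul1r.
rewrite ltNge; apply/negP => kle; apply: nk.
have sle : Num.sqrt (Q (map_mx intr k)) <= `|lambda| + delta.
  rewrite -lerBlDl; apply: le_trans (le_trans (ler_norm _) kle).
  by rewrite lerB// ler_norm.
have Qle : Q (map_mx intr k) <= (`|lambda| + delta) ^+ 2.
  rewrite -[leLHS]sqr_sqrtr; first by rewrite lerXn2r// nnegrE ?sqrtr_ge0//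
    addr_ge0// ltW.
  by apply: le_trans (cQ _); rewrite mulr_ge0 ?sqr_ge0// ltW.
have kB i : `|k 0 i| <= N%:Z.
  have kn : `|map_mx intr k : 'rV[R]_d| <= B.
    rewrite -[leLHS]ger0_norm// -sqrtr_sqr ler_wsqrtr//.
    by rewrite ler_pdivlMr// mulrC (le_trans (cQ _)).
  have ki : `|(k 0 i)%:~R : R| <= `|map_mx intr k : 'rV[R]_d|.
    rewrite [leRHS]mx_normrE; apply: (le_trans _ (le_bigmax _ _ (0, i))).
    by rewrite mxE.
  rewrite -(ler_int R) intr_norm; apply: le_trans ki _.
  exact: le_trans kn (ltW BN).
exists [ffun i => inord `|(k 0 i + N%:Z)%R|%N] => //.
apply/rowP => i; rewrite mxE ffunE.
have /[!ler_norml]/andP[k1 k2] := kB i.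
rewrite inordK; first by rewrite gez0_abs ?addrK// -lerBlDr sub0r.
rewrite ltnS -lez_nat gez0_abs; last by rewrite -lerBlDr sub0r.
by rewrite -addnn PoszD lerD2r.
Qed.

(* Main.v *)
From HB Require Import structures.
From mathcomp Require Import all_boot all_order all_algebra.
From mathcomp Require Import all_classical all_reals all_analysis.
From mathcomp Require Import measurable_realfun complex ring lra zify.

Set Implicit Arguments.
Unset Strict Implicit.
Unset Printing Implicit Defensive.

Import Order.TTheory GRing.Theory Num.Theory.
Import numFieldNormedType.Exports.
Import ComplexField.Normc.

Require Import Defs.

(** Since [sigma (pstar) = 1], the second term of the bound is
    [(lambda * delta)^(1/2)], and the norm is shown to be at most
    [C * lambda^eps * (lambda * delta)^(1/2)].

    Let [h] be the image of a function of norm one, a trigonometric polynomial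
    with frequencies [k] in the window [|sqrt (Q k) - lambda| <= delta]. By
    duality ([level_set_le]) the measure of a level set of [h] is controlled by
    a nonnegative multiplier that is bounded below on the window, provided that
    it splits into a part with small symbol and a part with small kernel. The
    multiplier used here is a Fejer kernel in time ([fejer_identity]): an
    average, damped by a Gaussian, of the Schroedinger propagators
    [exp (- 2 i pi t (Q k - lambda^2))] over discrete times [t] up to
    [1 / (lambda * delta)]. Small times have small total symbol
    ([low_times_le]); large times have a small kernel ([kernel_estimate]). The
    choice of the threshold between them, at each height of the level set,
    gives the weak-type inequality [weak_type_bound]. A layer-cake
    decomposition over the logarithmically many heights that occur
    ([layer_cake_le], [log_levels]) turns it into the bound for the norm, and
    produces the loss [lambda^eps].

    For the kernel, [Q] is put in triangular form ([triangular_coordinates]),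
    and Poisson summation in one variable after the other ([kernel_bound])
    replaces each propagator by Gaussians centred at the dual lattice. What
    remains is, for every dual frequency, an exponential sum over the times in
    a dyadic block, with phase [lambda^2 t + q / (4 t)] up to a factor. Its
    second derivative has a sign, so van der Corput's method applies
    ([van_der_corput], [block_oscillating]) as soon as the times exceed
    [1 / lambda]; for shorter times the Gaussian decay in the dual frequency is
    enough ([block_trivial]). Summation over the blocks gives a kernel of size
    [(lambda delta) tau^(1 - d/2) + (lambda / delta)^((d-1)/2)], where [tau] is
    the threshold, and the hypothesis [delta >= lambda^(- 1 / (2 d - 1))] is
    what makes the second term at most [(lambda delta)^(d/2)], the value of the
    first one at the largest admissible threshold ([delta_range],
    [kernel_size_le]). *)

Local Open Scope classical_set_scope.
Local Open Scope ring_scope.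
Local Open Scope complex_scope.

(** * Complex modulus and complex exponentials *)

Section complex_modulus.
Variable R : realType.
Implicit Types (z w : R[i]) (a b t : R).

Lemma normc_sqrtE z : normc z = Num.sqrt (complex.Re z ^+ 2 + complex.Im z ^+ 2).
Proof. by case: z. Qed.

Lemma normc_ge0 z : 0 <= normc z.
Proof. by rewrite normc_sqrtE sqrtr_ge0. Qed.

Lemma sqr_normcE z : normc z ^+ 2 = complex.Re z ^+ 2 + complex.Im z ^+ 2.
Proof. by rewrite normc_sqrtE sqr_sqrtr// addr_ge0// sqr_ge0. Qed.

Lemma normc_eq0 z : (normc z == 0) = (z == 0).
Proof.
apply/eqP/eqP => [/eq0_normc//|->]; exact: normc0.
Qed.

Lemma normc_gt0 z : (0 < normc z) = (z != 0).
Proof. by rewrite lt_def normc_eq0 normc_ge0 andbT. Qed.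

Lemma ger_Re z : `|complex.Re z| <= normc z.
Proof.
by rewrite normc_sqrtE -sqrtr_sqr ler_wsqrtr// lerDl sqr_ge0.
Qed.

Lemma ger_Im z : `|complex.Im z| <= normc z.
Proof.
by rewrite normc_sqrtE -sqrtr_sqr ler_wsqrtr// lerDr sqr_ge0.
Qed.

Lemma normc_ReIm z : normc z <= `|complex.Re z| + `|complex.Im z|.
Proof.
rewrite -(@ler_pXn2r _ 2)// ?nnegrE ?normc_ge0 ?addr_ge0//.
by rewrite sqr_normcE sqrrD !real_normK ?num_real// lerD2r lerDl mulrn_wge0// mulr_ge0.
Qed.

Lemma normcR a : normc (a%:C) = `|a|.
Proof. by rewrite normc_sqrtE /= expr0n addr0 sqrtr_sqr. Qed.

Lemma normcX z n : normc (z ^+ n) = normc z ^+ n.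
Proof.
by elim: n => [|n IH]; rewrite ?expr0 ?normc1// !exprS normcM IH.
Qed.

Lemma normc_sum I (r : seq I) (P : pred I) (F : I -> R[i]) :
  normc (\sum_(i <- r | P i) F i) <= \sum_(i <- r | P i) normc (F i).
Proof.
elim/big_rec2 : _ => [|i y1 y2 _ h]; first by rewrite normc0.
by apply: le_trans (le_normcD _ _) _; rewrite lerD2l.
Qed.

Lemma normc_distC z w : normc (z - w) = normc (w - z).
Proof. by rewrite -normcN opprB. Qed.

Lemma normc_conj z : normc z^*%C = normc z.
Proof. by case: z => a b; rewrite !normc_sqrtE /= sqrrN. Qed.

Lemma mulcJ z : z * z^*%C = (normc z ^+ 2)%:C.
Proof.
rewrite sqr_normcE; case: z => a b /=; apply/eqP; rewrite eq_complex /=.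
by apply/andP; split; apply/eqP; ring.
Qed.

Lemma cReM z w : complex.Re (z * w) =
  complex.Re z * complex.Re w - complex.Im z * complex.Im w.
Proof. by case: z w => [a b] [c e]. Qed.

Lemma cImM z w : complex.Im (z * w) =
  complex.Re z * complex.Im w + complex.Im z * complex.Re w.
Proof. by case: z w => [a b] [c e]. Qed.

Lemma cReD z w : complex.Re (z + w) = complex.Re z + complex.Re w.
Proof. by case: z w => [a b] [c e]. Qed.

Lemma cImD z w : complex.Im (z + w) = complex.Im z + complex.Im w.
Proof. by case: z w => [a b] [c e]. Qed.

Lemma cReN z : complex.Re (- z) = - complex.Re z. Proof. by case: z. Qed.
Lemma cImN z : complex.Im (- z) = - complex.Im z. Proof. by case: z. Qed.

Lemma cRe_sum I (r : seq I) (P : pred I) (F : I -> R[i]) :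
  complex.Re (\sum_(i <- r | P i) F i) = \sum_(i <- r | P i) complex.Re (F i).
Proof. by elim/big_rec2 : _ => // i y1 y2 _ <-; rewrite cReD. Qed.

Lemma cIm_sum I (r : seq I) (P : pred I) (F : I -> R[i]) :
  complex.Im (\sum_(i <- r | P i) F i) = \sum_(i <- r | P i) complex.Im (F i).
Proof. by elim/big_rec2 : _ => // i y1 y2 _ <-; rewrite cImD. Qed.

Lemma complexP z w : complex.Re z = complex.Re w ->
  complex.Im z = complex.Im w -> z = w.
Proof. by case: z w => [a b] [c e] /= -> ->. Qed.

Lemma normc_leD z w a b : normc z <= a -> normc w <= b -> normc (z + w) <= a + b.
Proof. by move=> za wb; apply: le_trans (le_normcD _ _) _; apply: lerD. Qed.

Lemma ler_normcB z w : normc z - normc w <= normc (z - w).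
Proof. by rewrite lerBlDr; apply: le_trans (le_normcD _ _); rewrite subrK. Qed.

End complex_modulus.

Section complex_exponential.
Variable R : realType.
Implicit Types (z w : R[i]) (a b t : R).

Definition cis t : R[i] := cos t +i* sin t.

Definition cexp z : R[i] := (expR (complex.Re z))%:C * cis (complex.Im z).

Lemma cisD s t : cis (s + t) = cis s * cis t.
Proof. by apply: complexP; rewrite /= ?cosD ?sinD// addrC mulrC [X in _ + X]mulrC. Qed.

Lemma cis0 : cis 0 = 1.
Proof. by rewrite /cis cos0 sin0. Qed.

Lemma normc_cis t : normc (cis t) = 1.
Proof. by rewrite normc_sqrtE /= cos2Dsin2 sqrtr1. Qed.

Lemma cisJ t : (cis t)^*%C = cis (- t).
Proof. by rewrite /cis cosN sinN. Qed.

Lemma cexpD z w : cexp (z + w) = cexp z * cexp w.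
Proof.
by rewrite /cexp cReD cImD expRD cisD rmorphM /=; ring.
Qed.

Lemma cexp0 : cexp 0 = 1.
Proof. by rewrite /cexp /= expR0 cis0 mulr1. Qed.

Lemma cexp_imag t : cexp (0 +i* t) = cis t.
Proof. by rewrite /cexp /= expR0 mul1r. Qed.

Lemma normc_cexp z : normc (cexp z) = expR (complex.Re z).
Proof. by rewrite normcM normcR normc_cis mulr1 ger0_norm// expR_ge0. Qed.

Lemma cis2pin (n : nat) : cis (2 * pi * n%:R) = 1.
Proof.
elim: n => [|n IH]; first by rewrite mulr0 cis0.
have -> : 2 * pi * n.+1%:R = 2 * pi * n%:R + pi *+ 2 :> R.
  by rewrite -natr1; ring.
by rewrite cisD IH mul1r /cis cos2pi sin2pi.
Qed.

Lemma cis2piz (m : int) : cis (2 * pi * m%:~R) = 1.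
Proof.
case: m => n; first exact: cis2pin.
by rewrite NegzE mulrNz mulrN -cisJ (cis2pin n.+1) conjc1.
Qed.

Lemma sin_le_norm t : `|sin t| <= `|t|.
Proof.
suff H (s : R) : 0 <= s -> `|sin s| <= s.
  case: (leP 0 t) => [t0|/ltW t0]; first by rewrite (ger0_norm t0) H.
  by have := H (- t); rewrite oppr_ge0 sinN normrN (ler0_norm t0); apply.
rewrite le_eqVlt => /predU1P[<-|s0]; first by rewrite sin0 normr0.
have sd x : x \in `]0, s[%R -> is_derive x 1 (@sin R) (cos x).
  by move=> _; exact: is_derive_sin.
have [c _] := MVT s0 sd (continuous_subspaceT (@continuous_sin R)).
rewrite sin0 !subr0 => ->; rewrite normrM (gtr0_norm s0).
by rewrite ler_piMl ?(ltW s0)// cos_max.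
Qed.

Lemma normc_cisB s t : normc (cis s - cis t) = 2 * `|sin ((s - t) / 2)|.
Proof.
apply/eqP; rewrite -(@eqrXn2 _ 2)// ?normc_ge0 ?mulr_ge0//.
rewrite sqr_normcE exprMn real_normK ?num_real// /=.
set u := (s - t) / 2.
have -> : s = t + (u + u) by rewrite /u; field.
rewrite cosD sinD cosD sinD; apply/eqP.
have h1 := cos2Dsin2 t; have h2 := cos2Dsin2 u.

move: h1 h2; set a := cos t; set b := sin t; set c := cos u; set e := sin u => h1 h2.
have -> : (a * (c * c - e * e) - b * (e * c + c * e) - a) ^+ 2 +
 (b * (c * c - e * e) + a * (e * c + c * e) - b) ^+ 2 =
  (a ^+ 2 + b ^+ 2) * ((c * c - e * e - 1) ^+ 2 + (2 * e * c) ^+ 2) by ring.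
have -> : (2 * e * c) ^+ 2 = 4 * e ^+ 2 * c ^+ 2 by ring.
have c2 : c ^+ 2 = 1 - e ^+ 2 by lra.
by rewrite h1 mul1r -!expr2 c2; ring.
Qed.

Lemma cis_lip s t : normc (cis s - cis t) <= `|s - t|.
Proof.
rewrite normc_cisB; apply: le_trans (ler_pM _ _ (lexx 2) (sin_le_norm _)) _ => //.
by rewrite normrM (@ger0_norm _ (2^-1)) ?invr_ge0// mulrCA divff ?mulr1.
Qed.

Lemma expR_lip a b c : a <= c -> b <= c -> `|expR a - expR b| <= expR c * `|a - b|.
Proof.
wlog ab : a b / b <= a.
  move=> H ac bc; have [/H|/ltW/H] := leP b a; first exact.
  by rewrite distrC (distrC a); apply.
move=> ac bc; rewrite ger0_norm ?subr_ge0 ?ler_expR// ger0_norm ?subr_ge0//.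
have -> : expR a - expR b = expR a * (1 - expR (b - a)).
  by rewrite mulrBr mulr1 -expRD [a + _]addrC subrK.
apply: ler_pM; rewrite ?expR_ge0 ?ler_expR ?subr_ge0 ?expR_le1 ?subr_le0//.
by have := expR_ge1Dx (b - a); lra.
Qed.

Lemma cexp_lip z w a : complex.Re z <= a -> complex.Re w <= a ->
  normc (cexp z - cexp w) <= 2 * expR a * normc (z - w).
Proof.
move=> za wa; rewrite /cexp.
set ez := expR _; set ew := expR (complex.Re w).
have -> : ez%:C * cis (complex.Im z) - ew%:C * cis (complex.Im w) =
  (ez - ew)%:C * cis (complex.Im z) + ew%:C * (cis (complex.Im z) - cis (complex.Im w)).
  by rewrite rmorphB /=; ring.
have -> : 2 * expR a * normc (z - w) = expR a * normc (z - w) + expR a * normc (z - w) by ring.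
apply: normc_leD; rewrite normcM normcR.
- rewrite normc_cis mulr1; apply: le_trans (expR_lip za wa) _.
  rewrite ler_wpM2l ?expR_ge0//; apply: le_trans (ger_Re _).
  by rewrite cReD cReN.
- apply: ler_pM; rewrite ?normc_ge0// ?ger0_norm ?expR_ge0 ?ler_expR//.
  apply: le_trans (cis_lip _ _) _; apply: le_trans (ger_Im _).
  by rewrite cImD cImN.
Qed.

End complex_exponential.

(** * Integration of complex functions *)

Section complex_integral.
Context d (T : measurableType d) (R : realType) (P : probability T R).
Implicit Types (f g : T -> R[i]) (c : R[i]).

Definition cmeasurable f :=
  measurable_fun setT (fun x => complex.Re (f x)) /\
  measurable_fun setT (fun x => complex.Im (f x)).

Definition cintegrable f :=
  P.-integrable setT (fun x => (complex.Re (f x))%:E) /\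
  P.-integrable setT (fun x => (complex.Im (f x))%:E).

Definition cint f : R[i] :=
  (\int[P]_x complex.Re (f x)) +i* (\int[P]_x complex.Im (f x)).

Lemma cintegrable_measurable f : cintegrable f -> cmeasurable f.
Proof.
by move=> [/measurable_int/measurable_EFinP ? /measurable_int/measurable_EFinP ?].
Qed.

Lemma cmeasurable_cst c : cmeasurable (fun=> c).
Proof. by split; exact: measurable_cst. Qed.

Lemma cmeasurableM f g : cmeasurable f -> cmeasurable g ->
  cmeasurable (fun x => f x * g x).
Proof.
move=> [f1 f2] [g1 g2]; split.
- under eq_fun do rewrite cReM.
  by apply: measurable_funB; exact: measurable_funM.
- under eq_fun do rewrite cImM.
  by apply: measurable_funD; exact: measurable_funM.
Qed.

Lemma cmeasurableJ f : cmeasurable f -> cmeasurable (fun x => (f x)^*%C).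
Proof.
move=> [f1 f2]; split.
- by apply: eq_measurable_fun f1 => x _; case: (f x).
- apply: eq_measurable_fun (measurable_funN f2) => x _ /=; by case: (f x).
Qed.

Lemma cmeasurable_sum I (s : seq I) (F : I -> T -> R[i]) :
  (forall i, cmeasurable (F i)) -> cmeasurable (fun x => \sum_(i <- s) F i x).
Proof.
move=> mF; split.
- under eq_fun do rewrite cRe_sum; apply: measurable_sum => i.
  by case: (mF i).
- under eq_fun do rewrite cIm_sum; apply: measurable_sum => i.
  by case: (mF i).
Qed.

Lemma measurable_normc f : cmeasurable f -> measurable_fun setT (fun x => normc (f x)).
Proof.
move=> [f1 f2]; under eq_fun do rewrite normc_sqrtE.
apply: (measurableT_comp (f := @Num.sqrt R)).
  by apply: continuous_measurable_fun; exact: sqrt_continuous.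
by apply: measurable_funD; exact: measurable_funX.
Qed.

Lemma cintegrableP f : cmeasurable f ->
  P.-integrable setT (fun x => (normc (f x))%:E) -> cintegrable f.
Proof.
move=> [m1 m2] fi; split.
- apply: le_integrable fi => //; first exact/measurable_EFinP.
  by move=> x _; rewrite lee_fin (ger0_norm (normc_ge0 _)) ger_Re.
- apply: le_integrable fi => //; first exact/measurable_EFinP.
  by move=> x _; rewrite lee_fin (ger0_norm (normc_ge0 _)) ger_Im.
Qed.

Lemma bounded_integrable (f : T -> R) (M : R) : measurable_fun setT f ->
  (forall x, `|f x| <= M) -> P.-integrable setT (fun x => (f x)%:E).
Proof.
move=> mf fM; apply: (@measurable_bounded_integrable _ _ _ P f) => //.
  by rewrite -ge0_fin_numE// fin_num_measure.
exists M; split; first by rewrite num_real.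
by move=> y My x _ /=; exact: le_trans (fM x) (ltW My).
Qed.

Lemma bounded_cintegrable f (M : R) : cmeasurable f -> (forall x, normc (f x) <= M) ->
  cintegrable f.
Proof.
move=> mf fM; apply: cintegrableP => //; apply: (bounded_integrable (M := M)).
  exact: measurable_normc.
by move=> x; rewrite ger0_norm ?normc_ge0.
Qed.

Lemma cintegrable_normc f : cintegrable f ->
  P.-integrable setT (fun x => (normc (f x))%:E).
Proof.
move=> fi; have [f1 f2] := fi.
have := integrableD measurableT (integrable_abse f1) (integrable_abse f2).
apply: le_integrable => //.
  exact/measurable_EFinP/measurable_normc/cintegrable_measurable.
move=> x _ /=; rewrite lee_fin (ger0_norm (normc_ge0 _)) ger0_norm ?addr_ge0//.
exact: normc_ReIm.
Qed.

Lemma cintegrableMb f g (M : R) : cintegrable f -> cmeasurable g ->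
  (forall x, normc (g x) <= M) -> cintegrable (fun x => f x * g x).
Proof.
move=> fi mg gM; apply: cintegrableP.
  exact: cmeasurableM (cintegrable_measurable fi) mg.
have := integrableZl measurableT M (cintegrable_normc fi).
apply: le_integrable => //.
  apply/measurable_EFinP/measurable_normc/cmeasurableM => //.
  exact: cintegrable_measurable.
move=> x _ /=; rewrite lee_fin normcM !ger0_norm ?mulr_ge0 ?normc_ge0//.
  by rewrite mulrC ler_wpM2r// normc_ge0.
exact: le_trans (normc_ge0 _) (gM x).
Qed.

Lemma cintegrableD f g : cintegrable f -> cintegrable g ->
  cintegrable (fun x => f x + g x).
Proof.
move=> [f1 f2] [g1 g2]; split.
- by under eq_fun do rewrite cReD EFinD; exact: integrableD.
- by under eq_fun do rewrite cImD EFinD; exact: integrableD.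
Qed.

Lemma cintegrable_cst c : cintegrable (fun=> c).
Proof. exact: (bounded_cintegrable (cmeasurable_cst c) (fun=> lexx _)). Qed.

Lemma cintegrableZ c f : cintegrable f -> cintegrable (fun x => c * f x).
Proof.
move=> fi; under eq_fun do rewrite mulrC.
exact: (cintegrableMb fi (cmeasurable_cst c) (fun=> lexx _)).
Qed.

Lemma cintegrable_sum I (s : seq I) (F : I -> T -> R[i]) :
  (forall i, cintegrable (F i)) -> cintegrable (fun x => \sum_(i <- s) F i x).
Proof.
move=> iF; elim: s => [|i s IH].
  by under eq_fun do rewrite big_nil; exact: cintegrable_cst.
by under eq_fun do rewrite big_cons; exact: cintegrableD.
Qed.

Lemma integrableZ (r : R) (f : T -> R) : P.-integrable setT (fun x => (f x)%:E) ->
  P.-integrable setT (EFin \o (fun x => r * f x)).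
Proof. exact: integrableZl. Qed.

Lemma cintD f g : cintegrable f -> cintegrable g ->
  cint (fun x => f x + g x) = cint f + cint g.
Proof.
move=> [f1 f2] [g1 g2]; apply: complexP => /=.
- by rewrite -RintegralD//; apply: eq_Rintegral => x _; rewrite cReD.
- by rewrite -RintegralD//; apply: eq_Rintegral => x _; rewrite cImD.
Qed.

Lemma cintZ c f : cintegrable f -> cint (fun x => c * f x) = c * cint f.
Proof.
move=> [f1 f2]; apply: complexP => /=.
- rewrite cReM/= -!RintegralZl// -RintegralB//.
  + by apply: eq_Rintegral => x _; rewrite cReM.
  + exact: integrableZ.
  + exact: integrableZ.
- rewrite cImM/= -!RintegralZl// -RintegralD//.
  + by apply: eq_Rintegral => x _; rewrite cImM.
  + exact: integrableZ.
  + exact: integrableZ.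
Qed.

Lemma cint_cst c : cint (fun=> c) = c.
Proof.
have P1 : fine (P setT) = 1 by rewrite probability_setT.
by apply: complexP => /=; rewrite Rintegral_cst// P1 mulr1.
Qed.

Lemma eq_cint f g : f =1 g -> cint f = cint g.
Proof. by move=> fg; congr cint; apply/funext. Qed.

Lemma cintB f g : cintegrable f -> cintegrable g ->
  cint (fun x => f x - g x) = cint f - cint g.
Proof.
move=> fi gi; rewrite -[- cint g]mulN1r -cintZ// -cintD//.
  by apply: eq_cint => x; rewrite mulN1r.
exact: cintegrableZ.
Qed.

Lemma cint_sum I (s : seq I) (F : I -> T -> R[i]) :
  (forall i, cintegrable (F i)) ->
  cint (fun x => \sum_(i <- s) F i x) = \sum_(i <- s) cint (F i).
Proof.
move=> iF; elim: s => [|i s IH].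
  rewrite big_nil -[RHS]cint_cst; apply: eq_cint => x; by rewrite big_nil.
rewrite big_cons -IH -cintD//; last exact: cintegrable_sum.
by apply: eq_cint => x; rewrite big_cons.
Qed.

Lemma cintJ f : cintegrable f -> cint (fun x => (f x)^*%C) = (cint f)^*%C.
Proof.
move=> [_ fi]; apply: complexP => /=.
  by apply: eq_Rintegral => x _; case: (f x).
rewrite -mulN1r -RintegralZl//; apply: eq_Rintegral => x _.
by rewrite mulN1r; case: (f x).
Qed.

(* The integral is rotated onto the positive real axis. *)
Lemma normc_cint f : cintegrable f -> normc (cint f) <= \int[P]_x normc (f x).
Proof.
move=> fi; have [->|I0] := eqVneq (cint f) 0.
  by rewrite normc0; apply: Rintegral_ge0 => x _; exact: normc_ge0.
pose u := (normc (cint f))^-1%:C * (cint f)^*%C.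
have nu : normc u = 1.
  by rewrite normcM normcR normc_conj ger0_norm ?invr_ge0 ?normc_ge0// mulVf// normc_eq0.
have -> : normc (cint f) = complex.Re (cint (fun x => u * f x)).
  rewrite cintZ// /u -mulrA [X in _ * X]mulrC mulcJ -rmorphM.
  by move: I0; rewrite -normc_eq0 => I0; rewrite expr2 mulKf.
apply: le_Rintegral => //.
- by case: (cintegrableZ u fi).
- exact: cintegrable_normc.
move=> x _; apply: le_trans (ler_norm _) _; apply: le_trans (ger_Re _) _.
by rewrite normcM nu mul1r.
Qed.

End complex_integral.

Arguments bounded_integrable {d T R P f M}.
Arguments bounded_cintegrable {d T R P f M}.

(** * Duality and level sets of orthonormal sums *)

Lemma sum_cauchy_schwarz (R : realType) I (s : seq I) (x y : I -> R) :
  (\sum_(i <- s) x i * y i) ^+ 2 <=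
  (\sum_(i <- s) x i ^+ 2) * (\sum_(i <- s) y i ^+ 2).
Proof.
suff : 0 <= \sum_(i <- s) \sum_(j <- s) (x i * y j - x j * y i) ^+ 2.
  have -> : \sum_(i <- s) \sum_(j <- s) (x i * y j - x j * y i) ^+ 2 =
      2 * ((\sum_(i <- s) x i ^+ 2) * (\sum_(i <- s) y i ^+ 2) -
      (\sum_(i <- s) x i * y i) ^+ 2).
    transitivity (\sum_(i <- s) (x i ^+ 2 * (\sum_(j <- s) y j ^+ 2) +
       y i ^+ 2 * (\sum_(j <- s) x j ^+ 2) -
       2 * (x i * y i) * \sum_(j <- s) x j * y j)).
      apply: eq_bigr => i _; rewrite !mulr_sumr -big_split -sumrB /=.
      by apply: eq_bigr => j _; ring.
    rewrite sumrB big_split /= -!mulr_suml -mulr_sumr; ring.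
  by rewrite pmulr_rge0// subr_ge0.
by apply: sumr_ge0 => i _; apply: sumr_ge0 => j _; exact: sqr_ge0.
Qed.

Lemma ler_sum_subset (R : realType) (I : eqType) (s s' : seq I) (F : I -> R) :
  uniq s -> uniq s' -> {subset s <= s'} -> {in s', forall i, 0 <= F i} ->
  \sum_(i <- s) F i <= \sum_(i <- s') F i.
Proof.
move=> us us' ss' F0.
have pe : perm_eq [seq i <- s' | i \in s] s.
  apply: uniq_perm => //; first exact: filter_uniq.
  by move=> i; rewrite mem_filter; case: (boolP (i \in s)) => //= /ss'.
rewrite [leRHS](bigID (mem s))/= -[X in _ <= X + _]big_filter (perm_big _ pe)/=.
rewrite lerDl big_seq_cond; apply: sumr_ge0 => i /andP[+ _]; exact: F0.
Qed.

Section bessel_inequality.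
Context d (T : measurableType d) (R : realType) (P : probability T R).
Variables (I : eqType) (e : I -> T -> R[i]).
Hypothesis me : forall i, cmeasurable (e i).
Hypothesis e1 : forall i x, normc (e i x) <= 1.

Definition orthonormal_on (s : seq I) :=
  {in s &, forall i j, cint P (fun x => e i x * (e j x)^*%C) = (i == j)%:R}.

Let ie i : cintegrable P (e i).
Proof. exact: bounded_cintegrable (e1 i). Qed.

Let ieJ f i : cintegrable P f -> cintegrable P (fun x => f x * (e i x)^*%C).
Proof.
move=> fi; apply: (cintegrableMb (M := 1)) => //; first exact: cmeasurableJ.
by move=> x; rewrite normc_conj.
Qed.

Lemma sum_delta (s : seq I) (F : I -> R[i]) j : uniq s -> j \in s ->
  \sum_(i <- s) F i * (i == j)%:R = F j.
Proof.
move=> us js; rewrite (big_rem j)//= eqxx mulr1 big1_seq ?addr0// => i /andP[_].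
by rewrite mem_rem_uniq// inE => /andP[/negbTE ->]; rewrite mulr0.
Qed.

Lemma cint_trig_norm (s : seq I) (b : I -> R[i]) : uniq s -> orthonormal_on s ->
  cint P (fun x => (\sum_(i <- s) b i * e i x) * (\sum_(i <- s) b i * e i x)^*%C) =
  (\sum_(i <- s) normc (b i) ^+ 2)%:C.
Proof.
move=> us os.
transitivity (cint P (fun x => \sum_(j <- s) (b j)^*%C *
    \sum_(i <- s) b i * (e i x * (e j x)^*%C))).
  apply: eq_cint => x; rewrite raddf_sum /= mulr_sumr; apply: eq_bigr => j _.
  rewrite rmorphM /= mulr_suml mulr_sumr; apply: eq_bigr => i _; ring.
rewrite cint_sum; last first.
  move=> j; apply: cintegrableZ; apply: cintegrable_sum => i.
  by apply: cintegrableZ; exact: ieJ.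
rewrite rmorph_sum /= [LHS]big_seq [RHS]big_seq; apply: eq_bigr => j js.
rewrite cintZ; last first.
  by apply: cintegrable_sum => i; apply: cintegrableZ; exact: ieJ.
rewrite cint_sum; last by move=> i; apply: cintegrableZ; exact: ieJ.
rewrite -mulcJ [RHS]mulrC; congr (_ * _).
rewrite -[RHS](sum_delta _ us js) [LHS]big_seq [RHS]big_seq.
by apply: eq_bigr => i iS; rewrite cintZ ?os//; exact: ieJ.
Qed.

Lemma bessel (s : seq I) (f : T -> R[i]) : uniq s -> orthonormal_on s ->
  cintegrable P f -> P.-integrable setT (fun x => (normc (f x) ^+ 2)%:E) ->
  \sum_(i <- s) normc (cint P (fun x => f x * (e i x)^*%C)) ^+ 2 <=
  \int[P]_x (normc (f x) ^+ 2).
Proof.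
move=> us os fi f2.
pose b i := cint P (fun x => f x * (e i x)^*%C).
pose p x := \sum_(i <- s) b i * e i x.
set S := \sum_(i <- s) _.
have mp : cmeasurable p.
  by apply: cmeasurable_sum => i; apply: cmeasurableM => //; exact: cmeasurable_cst.
have pM x : normc (p x) <= \sum_(i <- s) normc (b i).
  apply: le_trans (normc_sum _ _ _) _; apply: ler_sum => i _.
  by rewrite normcM ler_piMr// normc_ge0.
have p2 : P.-integrable setT (fun x => (normc (p x) ^+ 2)%:E).
  apply: (bounded_integrable (M := (\sum_(i <- s) normc (b i)) ^+ 2)).
    by apply: measurable_funX; exact: measurable_normc.
  move=> x; rewrite ger0_norm ?sqr_ge0// lerXn2r ?nnegrE ?normc_ge0 ?pM//.
  by apply: sumr_ge0 => i _; exact: normc_ge0.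
have Sp : \int[P]_x (normc (p x) ^+ 2) = S.
  have <- : complex.Re (cint P (fun x => p x * (p x)^*%C)) = S.
    by rewrite cint_trig_norm.
  by apply: eq_Rintegral => x _; rewrite mulcJ.
have Sf : cint P (fun x => f x * (p x)^*%C) = S%:C.
  transitivity (cint P (fun x => \sum_(i <- s) (b i)^*%C * (f x * (e i x)^*%C))).
    apply: eq_cint => x; rewrite raddf_sum /= mulr_sumr; apply: eq_bigr => i _.
    by rewrite rmorphM /=; ring.
  rewrite cint_sum; last by move=> i; apply: cintegrableZ; exact: ieJ.
  rewrite /S rmorph_sum; apply: eq_bigr => i _.
  by rewrite cintZ; [rewrite -/(b i) mulrC mulcJ|exact: ieJ].
have fp : cintegrable P (fun x => f x * (p x)^*%C).
  apply: (cintegrableMb (M := \sum_(i <- s) normc (b i))) => //.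
    exact: cmeasurableJ.
  by move=> x; rewrite normc_conj.
have [f1 _] := fp.
have sumi : P.-integrable setT (fun x => (normc (f x) ^+ 2 + normc (p x) ^+ 2)%:E).
  by under eq_fun do rewrite EFinD; exact: integrableD.
have : 2 * S <= \int[P]_x (normc (f x) ^+ 2 + normc (p x) ^+ 2).
  have -> : S = complex.Re (cint P (fun x => f x * (p x)^*%C)) by rewrite Sf.
  rewrite /= -RintegralZl//; apply: le_Rintegral => //.
    exact: integrableZ.
  move=> x _; have h : complex.Re (f x * (p x)^*%C) <= normc (f x) * normc (p x).
    by apply: le_trans (ler_norm _) _; apply: le_trans (ger_Re _) _; rewrite normcM normc_conj.
  have := sqr_ge0 (normc (f x) - normc (p x)); lra.
by rewrite RintegralD// Sp; lra.
Qed.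

(** Duality turns a large level set of [h] into a lower bound for a quadratic
    form in the Fourier coefficients of [1_E h^*%C]. The multiplier splits into
    [u], whose convolution kernel is small in sup norm, and [w], which is small
    as a multiplier. *)
Lemma level_set_le (s s' : seq I) (a u : I -> R[i]) (w : I -> R) (alpha M c A B : R) :
  uniq s -> uniq s' -> {subset s <= s'} -> orthonormal_on s' ->
  0 < alpha -> 0 < c -> 0 <= A -> 0 <= B ->
  \sum_(i <- s) normc (a i) ^+ 2 <= M ->
  {in s, forall i, c <= complex.Re (u i) + w i} ->
  {in s', forall i, 0 <= complex.Re (u i) + w i} ->
  {in s', forall i, w i <= B} ->
  (forall x y, normc (\sum_(i <- s') u i * (e i y * (e i x)^*%C)) <= A) ->
  2 * M * A <= c * alpha ^+ 2 ->
  alpha ^+ 2 * fine (P [set x | alpha < normc (\sum_(i <- s) a i * e i x)]) <=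
  2 * M * B / c.
Proof.
move=> us us' ss' os' al0 c0 A0 B0 aM cs pos wB kA MA.
pose h x := \sum_(i <- s) a i * e i x.
rewrite -/(h _); set E := [set x | _].
have mh : cmeasurable h.
  by apply: cmeasurable_sum => i; apply: cmeasurableM => //; exact: cmeasurable_cst.
have mE : measurable E.
  have := measurable_normc mh.
  by move=> /(_ measurableT `]alpha, +oo[%classic (measurable_itv _)); rewrite setTI preimage_itvoy.
pose H := \sum_(i <- s) normc (a i).
have hH x : normc (h x) <= H.
  apply: le_trans (normc_sum _ _ _) _; apply: ler_sum => i _.
  by rewrite normcM ler_piMr// normc_ge0.
have H0 : 0 <= H by apply: sumr_ge0 => i _; exact: normc_ge0.
pose phi x := (\1_E x : R)%:C * (h x)^*%C.
have indE01 x : 0 <= (\1_E x : R) <= 1 by rewrite indicE; case: (x \in E); rewrite ?lexx ?ler01.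
have nphi x : normc (phi x) = \1_E x * normc (h x).
  by rewrite normcM normcR normc_conj ger0_norm//; case/andP: (indE01 x).
have mphi : cmeasurable phi.
  apply: cmeasurableM; last exact: cmeasurableJ.
  by split => /=; [exact: measurable_indic|exact: measurable_cst].
have phiH x : normc (phi x) <= H.
  by rewrite nphi; apply: le_trans (hH x); have /andP[? ?] := indE01 x; rewrite ler_piMl ?normc_ge0.
have iphi : cintegrable P phi by exact: bounded_cintegrable phiH.
pose X := \int[P]_x (normc (phi x) ^+ 2).
pose Y := \int[P]_x (normc (phi x)).
have iX : P.-integrable setT (fun x => (normc (phi x) ^+ 2)%:E).
  apply: (bounded_integrable (M := H ^+ 2)).
    by apply: measurable_funX; exact: measurable_normc.
  by move=> x; rewrite ger0_norm ?sqr_ge0// lerXn2r ?nnegrE ?normc_ge0.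
have iY := cintegrable_normc iphi.
have Y0 : 0 <= Y by apply: Rintegral_ge0 => x _; exact: normc_ge0.
have X0 : 0 <= X by apply: Rintegral_ge0 => x _; exact: sqr_ge0.
have YX : alpha * Y <= X.
  rewrite /Y -RintegralZl//; apply: le_Rintegral => //; first exact: integrableZ.
  move=> x _; rewrite nphi indicE; case: (boolP (x \in E)) => [|_].
    by rewrite inE /E /= mul1r => ax; rewrite expr2 ler_wpM2r ?normc_ge0// ltW.
  by rewrite mul0r mulr0 expr0n.
have EX : alpha ^+ 2 * fine (P E) <= X.
  have -> : fine (P E) = \int[P]_x (\1_E x).
    by rewrite /Rintegral integral_indic// setIT.
  have iE : P.-integrable setT (fun x => (\1_E x : R)%:E) by exact: integrable_indic.
  rewrite -RintegralZl//; apply: le_Rintegral => //; first exact: integrableZ.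
  move=> x _; rewrite nphi indicE; case: (boolP (x \in E)) => [|_].
    rewrite inE /E /= mul1r mulr1 => ax.
    by rewrite lerXn2r ?nnegrE ?normc_ge0 ?ltW.
  by rewrite mul0r mulr0 expr0n.
apply: le_trans EX _.
pose b i := cint P (fun x => e i x * phi x).
have ieM f i : cintegrable P f -> cintegrable P (fun x => e i x * f x).
  move=> fi; under eq_fun do rewrite mulrC.
  exact: cintegrableMb fi (me i) (e1 i).
have ieMJ i : cintegrable P (fun x => (e i x * phi x)^*%C).
  apply: (bounded_cintegrable (M := H)).
    by apply: cmeasurableJ; exact: cmeasurableM.
  move=> x; rewrite normc_conj normcM.
  by apply: le_trans (phiH x); rewrite ler_piMl ?normc_ge0.
have hphi : cint P (fun x => h x * phi x) = X%:C.
  have E0 x : h x * phi x = (normc (phi x) ^+ 2)%:C.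
    rewrite nphi /phi mulrCA mulcJ -rmorphM /= exprMn; congr (_ * _)%:C.
    by rewrite indicE; case: (x \in E); rewrite ?expr1n ?expr0n.
  apply: complexP => /=; first by apply: eq_Rintegral => x _; rewrite E0.
  by rewrite -[RHS](@Rintegral_set0 _ _ _ P (fun=> 0)) /Rintegral integral_set0;
     congr fine; under eq_integral do rewrite E0 /=; rewrite integral0.
have CS : X ^+ 2 <= M * \sum_(i <- s) normc (b i) ^+ 2.
  have -> : X = normc (\sum_(i <- s) a i * b i).
    have <- : cint P (fun x => h x * phi x) = \sum_(i <- s) a i * b i.
      transitivity (cint P (fun x => \sum_(i <- s) a i * (e i x * phi x))).
        apply: eq_cint => x; rewrite mulr_suml; apply: eq_bigr => i _.
        by rewrite mulrA.
      rewrite cint_sum; last by move=> i; apply: cintegrableZ; exact: ieM.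
      by apply: eq_bigr => i _; rewrite cintZ//; exact: ieM.
    by rewrite hphi normcR ger0_norm.
  apply: (@le_trans _ _ ((\sum_(i <- s) normc (a i) * normc (b i)) ^+ 2)).
    rewrite lerXn2r ?nnegrE ?normc_ge0//.
      by apply: sumr_ge0 => i _; rewrite mulr_ge0 ?normc_ge0.
    by apply: le_trans (normc_sum _ _ _) _; under eq_bigr do rewrite normcM.
  apply: le_trans (sum_cauchy_schwarz _ _ _) _.
  by rewrite ler_wpM2r// sumr_ge0// => i _; exact: sqr_ge0.
have iphiJ : cintegrable P (fun x => (phi x)^*%C).
  apply: (bounded_cintegrable (M := H)); first exact: cmeasurableJ.
  by move=> x; rewrite normc_conj.
have Bes : \sum_(i <- s') normc (b i) ^+ 2 <= X.
  have iXJ : P.-integrable setT (fun x => (normc (phi x)^*%C ^+ 2)%:E).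
    by under eq_fun do rewrite normc_conj.
  have -> : X = \int[P]_x (normc (phi x)^*%C ^+ 2).
    by apply: eq_Rintegral => x _; rewrite normc_conj.
  apply: le_trans (bessel us' os' iphiJ iXJ); rewrite le_eqVlt; apply/orP; left; apply/eqP.
  apply: eq_bigr => i _; congr (_ ^+ 2).
  rewrite -[LHS]normc_conj /b -cintJ; last exact: ieM.
  by congr normc; apply: eq_cint => x; rewrite rmorphM mulrC.
have quad : c * \sum_(i <- s) normc (b i) ^+ 2 <= A * Y ^+ 2 + B * X.
  apply: (@le_trans _ _ (\sum_(i <- s) (complex.Re (u i) + w i) * normc (b i) ^+ 2)).
    rewrite mulr_sumr big_seq [leRHS]big_seq; apply: ler_sum => i iS.
    by rewrite ler_wpM2r ?sqr_ge0 ?cs.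
  apply: (@le_trans _ _ (\sum_(i <- s') (complex.Re (u i) + w i) * normc (b i) ^+ 2)).
    apply: ler_sum_subset => // i iS.
    by rewrite mulr_ge0 ?sqr_ge0 ?pos.
  under eq_bigr do rewrite mulrDl.
  rewrite big_split /=; apply: lerD.
    have -> : \sum_(i <- s') complex.Re (u i) * normc (b i) ^+ 2 =
        complex.Re (\sum_(i <- s') u i * (b i)^*%C * b i).
      rewrite cRe_sum; apply: eq_bigr => i _.
      by rewrite -mulrA [_^*%C * _]mulrC mulcJ cReM /= mulr0 subr0.
    apply: le_trans (ler_norm _) _; apply: le_trans (ger_Re _) _.
    pose g y := \sum_(i <- s') u i * (b i)^*%C * e i y.
    have mg : cmeasurable g.
      by apply: cmeasurable_sum => i; apply: cmeasurableM => //; exact: cmeasurable_cst.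
    have gA y : normc (g y) <= A * Y.
      have -> : g y = cint P (fun x => (\sum_(i <- s') u i * (e i y * (e i x)^*%C)) * (phi x)^*%C).
        transitivity (cint P (fun x => \sum_(i <- s') (u i * e i y) * (e i x * phi x)^*%C)).
          rewrite cint_sum; last by move=> i; apply: cintegrableZ; exact: ieMJ.
          apply: eq_bigr => i _; rewrite cintZ ?cintJ; [ring|exact: ieM|exact: ieMJ].
        apply: eq_cint => x; rewrite mulr_suml; apply: eq_bigr => i _.
        by rewrite rmorphM /=; ring.
      have ikp : cintegrable P (fun x =>
          (\sum_(i <- s') u i * (e i y * (e i x)^*%C)) * (phi x)^*%C).
        under eq_fun do rewrite mulrC.
        apply: (cintegrableMb (M := A)) => //.
        apply: cmeasurable_sum => i; apply: cmeasurableM; first exact: cmeasurable_cst.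
        by apply: cmeasurableM; [exact: cmeasurable_cst|exact: cmeasurableJ].
      apply: le_trans (normc_cint ikp) _; rewrite -RintegralZl//.
      apply: le_Rintegral => //; first exact: cintegrable_normc.
        exact: integrableZ.
      by move=> x _; rewrite normcM normc_conj ler_wpM2r ?normc_ge0.
    have igp : cintegrable P (fun y => g y * phi y).
      under eq_fun do rewrite mulrC.
      exact: (cintegrableMb (M := A * Y)).
    have -> : \sum_(i <- s') u i * (b i)^*%C * b i = cint P (fun y => g y * phi y).
      transitivity (cint P (fun y => \sum_(i <- s') (u i * (b i)^*%C) * (e i y * phi y))).
        rewrite cint_sum; last by move=> i; apply: cintegrableZ; exact: ieM.
        by apply: eq_bigr => i _; rewrite cintZ//; exact: ieM.
      apply: eq_cint => y; rewrite mulr_suml; apply: eq_bigr => i _.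
      by rewrite !mulrA.
    apply: le_trans (normc_cint igp) _; rewrite expr2 mulrA.
    rewrite -[leRHS]RintegralZl//; apply: le_Rintegral => //.
    - exact: cintegrable_normc.
    - exact: integrableZ.
    - by move=> x _; rewrite normcM ler_wpM2r ?normc_ge0.
  rewrite (le_trans _ (ler_wpM2l B0 Bes))// mulr_sumr big_seq [leRHS]big_seq.
  by apply: ler_sum => i iS; rewrite ler_wpM2r ?sqr_ge0 ?wB.
have M0 : 0 <= M by apply: le_trans aM; apply: sumr_ge0 => i _; exact: sqr_ge0.
have [->|Xn0] := eqVneq X 0.
  by rewrite !mulr_ge0 ?invr_ge0 ?(ltW c0).
have Xp : 0 < X by rewrite lt_def Xn0.
rewrite ler_pdivlMr// -(ler_pM2r Xp).
have h1 : c * X ^+ 2 <= M * (A * Y ^+ 2 + B * X).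
  apply: le_trans (ler_wpM2l (ltW c0) CS) _.
  by rewrite mulrCA ler_wpM2l.
have h2 : alpha ^+ 2 * Y ^+ 2 <= X ^+ 2.
  by rewrite -exprMn lerXn2r ?nnegrE ?mulr_ge0 ?(ltW al0).
have h3 : 2 * M * A * Y ^+ 2 <= c * X ^+ 2.
  apply: le_trans (ler_wpM2r (sqr_ge0 _) MA) _.
  by rewrite -mulrA ler_wpM2l ?(ltW c0).
lra.
Qed.

End bessel_inequality.

(** * Characters of the torus *)

Section uniform_integral.
Variable R : realType.
Local Notation U := (uniform_prob (@ltr01 R)).

Lemma integral_uniform01 (f : R -> R) : measurable_fun setT f ->
  (\int[U]_x (f x)%:E = \int[lebesgue_measure]_(x in `[0%R, 1%R]) (f x)%:E)%E.
Proof.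
move=> mf; rewrite integralE [RHS]integralE.
have H (g : R -> \bar R) : measurable_fun setT g -> (forall x, 0 <= g x)%E ->
    (\int[U]_x g x = \int[lebesgue_measure]_(x in `[0%R, 1%R]) g x)%E.
  by move=> mg g0; rewrite integral_uniform// subr0 invr1 mul1e.
by congr (_ - _)%E; apply: H => //;
  [apply: measurable_funepos|apply: measurable_funeneg]; exact/measurable_EFinP.
Qed.

Lemma uniform_integrable (f : R -> R) : continuous f ->
  U.-integrable setT (fun x => (f x)%:E).
Proof.
move=> cf; have mf := continuous_measurable_fun cf.
apply/integrableP; split; first exact/measurable_EFinP.
have /= := @continuous_compact_integrable R f `[0%R, 1%R]%classic
  (@segment_compact R 0 1) (continuous_subspaceT cf).
move/integrableP => [_]; apply: le_lt_trans.
rewrite le_eqVlt; apply/orP; left; apply/eqP.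
rewrite (integral_uniform01 (f := fun x => `|f x|))//.
exact: measurableT_comp.
Qed.

Lemma uniform_FTC (f F : R -> R) : continuous f ->
  (forall x : R, is_derive x 1 F (f x)) -> \int[U]_x f x = F 1 - F 0.
Proof.
move=> cf dF; rewrite /Rintegral integral_uniform01; last exact: continuous_measurable_fun.
have cF : continuous F.
  by move=> x; apply: differentiable_continuous; apply/derivable1_diffP; case: (dF x).
rewrite (@continuous_FTC2 _ f F)//.
- exact: continuous_subspaceT.
- split; [by move=> x _; case: (dF x)| |].
  + exact/cvg_at_right_filter/cF.
  + exact/cvg_at_left_filter/cF.
- by move=> x _; rewrite derive1E; exact: derive_val.
Qed.

Lemma cmeasurable_cis2pi (n : int) :
  cmeasurable (fun y : measurableTypeR R => cis (2 * pi * n%:~R * y)).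
Proof.
by split; apply: continuous_measurable_fun => y /=; apply: continuous_comp;
  [exact: mulrl_continuous|exact: continuous_cos|exact: mulrl_continuous|exact: continuous_sin].
Qed.

Lemma cint_cis2pi (n : int) :
  cint U (fun y => cis (2 * pi * n%:~R * y)) = (n == 0)%:R.
Proof.
case: eqVneq => [->|n0].
  rewrite -[RHS](cint_cst U); apply: eq_cint => y.
  by rewrite mulr0 mul0r cis0.
set w := 2 * pi * n%:~R.
have w0 : w != 0 by rewrite !mulf_neq0 ?pnatr_eq0// ?intr_eq0// gt_eqF// pi_gt0.
have cisw : cis w = 1 by exact: cis2piz.
have cw : continuous (fun y : R => w * y) by exact: mulrl_continuous.
apply: complexP => /=.
- have dF (y : R) : is_derive y 1 (fun y => w^-1 * sin (w * y)) (cos (w * y)).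
    by apply: is_derive_eq; rewrite /GRing.scale/= mulr1 [_ * w]mulrC mulKf.
  rewrite (uniform_FTC _ dF).
    by move: cisw => [_ sw]; rewrite mulr1 mulr0 sw sin0 subrr.
  by move=> y; apply: continuous_comp; [exact: cw|exact: continuous_cos].
- have dF (y : R) : is_derive y 1 (fun y => - (w^-1 * cos (w * y))) (sin (w * y)).
    by apply: is_derive_eq; rewrite /GRing.scale/= mulr1 mulNr mulrN opprK [_ * w]mulrC mulKf.
  rewrite (uniform_FTC _ dF).
    by move: cisw => [cw' _]; rewrite mulr1 mulr0 cw' cos0 subrr.
  by move=> y; apply: continuous_comp; [exact: cw|exact: continuous_sin].
Qed.

End uniform_integral.

Section product_integral.
Context d1 d2 (T1 : measurableType d1) (T2 : measurableType d2) (R : realType).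
Variables (P1 : probability T1 R) (P2 : probability T2 R).

Lemma Rintegral_prod (f : T1 -> R) (g : T2 -> R) (M N : R) :
  measurable_fun setT f -> measurable_fun setT g ->
  (forall x, `|f x| <= M) -> (forall y, `|g y| <= N) ->
  (P1 \x P2)%E.-integrable setT (fun z => (f z.1 * g z.2)%:E) /\
  \int[(P1 \x P2)%E]_z (f z.1 * g z.2) = (\int[P1]_x f x) * (\int[P2]_y g y).
Proof.
move=> mf mg fM gN.
have mfg : measurable_fun setT (fun z : T1 * T2 => f z.1 * g z.2).
  by apply: measurable_funM; exact: measurableT_comp.
have ifg : (P1 \x P2)%E.-integrable setT (fun z => (f z.1 * g z.2)%:E).
  apply: (bounded_integrable (M := M * N)) => // z.
  by rewrite normrM ler_pM.
have if1 : P1.-integrable setT (fun x => (f x)%:E) by exact: bounded_integrable fM.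
have ig : P2.-integrable setT (fun x => (g x)%:E) by exact: bounded_integrable gN.
split => //; rewrite {1}/Rintegral -integral12_prod_meas1//.
rewrite -RintegralZr//; congr fine; apply: eq_integral => x _.
rewrite EFinM /Rintegral fineK ?integrable_fin_num//.
by rewrite /fubini_F /= -integralZl//; apply: eq_integral => y _; rewrite EFinM.
Qed.

Lemma cint_prod (f : T1 -> R[i]) (g : T2 -> R[i]) (M N : R) :
  cmeasurable f -> cmeasurable g ->
  (forall x, normc (f x) <= M) -> (forall y, normc (g y) <= N) ->
  cint (P1 \x P2)%E (fun z => f z.1 * g z.2) = cint P1 f * cint P2 g.
Proof.
move=> [f1 f2] [g1 g2] fM gN.
have rf x := le_trans (ger_Re (f x)) (fM x).
have jf x := le_trans (ger_Im (f x)) (fM x).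
have rg x := le_trans (ger_Re (g x)) (gN x).
have jg x := le_trans (ger_Im (g x)) (gN x).
have [i1 e1] := Rintegral_prod f1 g1 rf rg.
have [i2 e2] := Rintegral_prod f2 g2 jf jg.
have [i3 e3] := Rintegral_prod f1 g2 rf jg.
have [i4 e4] := Rintegral_prod f2 g1 jf rg.
apply: complexP; rewrite ?cReM ?cImM /=.
- by rewrite -e1 -e2 -RintegralB//; apply: eq_Rintegral => z _; rewrite cReM.
- by rewrite -e3 -e4 -RintegralD//; apply: eq_Rintegral => z _; rewrite cImM.
Qed.

End product_integral.

Arguments cint_prod {d1 d2 T1 T2 R P1 P2 f g M N}.

Section torus_characters.
Variable R : realType.

Lemma torus_char_cis d (k : 'rV[int]_d) (x : d.-tuple R) :
  torus_char k x = cis (2 * pi * \sum_(i < d) (k 0 i)%:~R * tnth x i).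
Proof. by []. Qed.

Lemma normc_torus_char d (k : 'rV[int]_d) (x : d.-tuple R) : normc (torus_char k x) = 1.
Proof. exact: normc_cis. Qed.

Lemma torus_charBJ d (j k : 'rV[int]_d) (x : d.-tuple R) :
  torus_char j x * (torus_char k x)^*%C = torus_char (j - k) x.
Proof.
rewrite !torus_char_cis cisJ -cisD; congr cis.
rewrite -mulrN -mulrDr -sumrN -big_split /=; congr (_ * _); apply: eq_bigr => i _.
by rewrite !mxE intrD mulrDl intrN mulNr.
Qed.

Lemma cmeasurable_torus_char d (k : 'rV[int]_d) : cmeasurable (@torus_char R d k).
Proof.
have m : measurable_fun setT (fun x : d.-tuple R =>
    2 * pi * \sum_(i < d) (k 0 i)%:~R * tnth x i).
  apply: measurable_funM => //; apply: measurable_sum => i.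
  by apply: measurable_funM => //; exact: measurable_tnth.
split; apply: (measurableT_comp _ m); apply: continuous_measurable_fun.
- exact: continuous_cos.
- exact: continuous_sin.
Qed.

Lemma cint_torus_char d (k : 'rV[int]_d) :
  cint (torus_measure R d) (torus_char k) = (k == 0)%:R.
Proof.
elim: d k => [|d IH] k.
  have -> : k = 0 by apply/rowP; case.
  rewrite eqxx -[RHS](cint_cst (torus_measure R 0)); apply: eq_cint => x.
  by rewrite torus_char_cis big_ord0 mulr0 cis0.
pose k' : 'rV[int]_d := \row_i k 0 (lift ord0 i).
have kE x (xs : d.-tuple R) : torus_char k (torus_cons (x, xs)) =
    cis (2 * pi * (k 0 0)%:~R * x) * torus_char k' xs.
  rewrite !torus_char_cis -cisD; congr cis.
  rewrite big_ord_recl mulrDr mulrA tnth0; congr (_ + _ * _).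
  by apply: eq_bigr => i _; rewrite mxE tnthS.
have -> : cint (torus_measure R d.+1) (torus_char k) =
   cint (uniform_prob (@ltr01 R) \x torus_measure R d)%E
     (fun z => cis (2 * pi * (k 0 0)%:~R * z.1) * torus_char k' z.2).
  have mk := cmeasurable_torus_char k.
  have mkz : cmeasurable (fun z : measurableTypeR R * d.-tuple R =>
     torus_char k (torus_cons z)).
    have [m1 m2] := mk.
    by split; [apply: (measurableT_comp m1)|apply: (measurableT_comp m2)];
      exact: measurable_torus_cons.
  have ik : cintegrable (uniform_prob (@ltr01 R) \x torus_measure R d)%E
      (fun z => torus_char k (torus_cons z)).
    by apply: (bounded_cintegrable (M := 1)) => // z; rewrite normc_torus_char.
  have [m1 m2] := mk; have [i1 i2] := ik.
  apply: complexP => /=.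
  - rewrite /Rintegral integral_distribution//; last exact/measurable_EFinP.
    by congr fine; apply: eq_integral => -[x xs] _;
       exact: (congr1 (fun z => (complex.Re z)%:E) (kE x xs)).
  - rewrite /Rintegral integral_distribution//; last exact/measurable_EFinP.
    by congr fine; apply: eq_integral => -[x xs] _;
       exact: (congr1 (fun z => (complex.Im z)%:E) (kE x xs)).
transitivity (cint (uniform_prob (@ltr01 R)) (fun x => cis (2 * pi * (k 0 0)%:~R * x)) *
  cint (torus_measure R d) (torus_char k')).
  apply: (@cint_prod _ _ (measurableTypeR R) _ R (uniform_prob (@ltr01 R))
    (torus_measure R d) (fun x => cis (2 * pi * (k 0 0)%:~R * x)) (torus_char k') 1 1).
  - exact: cmeasurable_cis2pi.
  - exact: cmeasurable_torus_char.
  - by move=> x; rewrite normc_cis.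
  - by move=> x; rewrite normc_torus_char.
rewrite cint_cis2pi IH -natrM mulnb; congr (nat_of_bool _)%:R.
  apply/andP/eqP => [[/eqP k0 /eqP k'0]|k0].
    apply/rowP => i; rewrite mxE; case: (unliftP ord0 i) => [j ->|->]; last exact: k0.
    by have := congr1 (fun f : 'rV_d => f 0 j) k'0; rewrite !mxE.
  by split; [rewrite k0 mxE|apply/eqP/rowP => i; rewrite !mxE k0 mxE].
Qed.

Lemma orthonormal_torus_char d (s : seq 'rV[int]_d) :
  orthonormal_on (torus_measure R d) (@torus_char R d) s.
Proof.
move=> j k _ _; rewrite -subr_eq0 -cint_torus_char.
by apply: eq_cint => x; rewrite torus_charBJ.
Qed.

End torus_characters.

(** * Taylor estimates and limits of complex sequences *)

Section elementary_bounds.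
Variable R : realType.
Implicit Types (t x y a b : R).

Lemma cos_ge1Bsqr t : 1 - t ^+ 2 / 2 <= cos t.
Proof.
pose u := t / 2; have -> : t = u + u by rewrite /u; field.
rewrite cosD -!expr2 cos2sin2.
have : sin u ^+ 2 <= u ^+ 2.
  rewrite -[X in X <= _]real_normK ?num_real// -[X in _ <= X]real_normK ?num_real//.
  by rewrite lerXn2r ?nnegrE// sin_le_norm.
have -> : (u + u) ^+ 2 / 2 = 2 * u ^+ 2 by field.
lra.
Qed.

Lemma sin_taylor t : `|sin t - t| <= t ^+ 2.
Proof.
have H (s : R) : 0 <= s -> s <= 2 -> `|sin s - s| <= s ^+ 2.
  move=> s0 s2; have [-> | sn0] := eqVneq s 0; first by rewrite sin0 subr0 normr0 expr0n.
  have sp : 0 < s by rewrite lt_def sn0.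
  have dF (x : R) : x \in `]0, s[%R -> is_derive x 1 (fun x : R => sin x - x) (cos x - 1).
    by move=> _; apply: is_derive_eq.
  have cF : continuous (fun x : R => sin x - x).
    by move=> x; apply: cvgB; [exact: continuous_sin|exact: cvg_id].
  have [c] := MVT sp dF (continuous_subspaceT cF).
  rewrite in_itv/= => /andP[c0 cs]; rewrite sin0 !subr0 => ->.
  rewrite normrM (gtr0_norm sp) expr2 ler_wpM2r// ler0_norm ?subr_le0 ?cos_le1//.
  have := cos_ge1Bsqr c; have : c ^+ 2 <= s * s; last by nra.
  by rewrite expr2 ler_pM// ltW.
have H' (s : R) : 0 <= s -> `|sin s - s| <= s ^+ 2.
  move=> s0; case: (leP s 2) => [|/ltW s2]; first exact: H.
  apply: le_trans (ler_normB _ _) _; rewrite (ger0_norm s0).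
  have := sin_max s; nra.
have [t0|/ltW t0] := leP 0 t; first exact: H'.
have -> : sin t - t = - (sin (- t) - (- t)) by rewrite sinN; ring.
by rewrite normrN -sqrrN; apply: H'; lra.
Qed.

Lemma cis_taylor t : normc (cis t - 1 - (0 +i* t)) <= 2 * t ^+ 2.
Proof.
apply: le_trans (normc_ReIm _) _.
rewrite !cReD !cImD !cReN !cImN /= oppr0 !addr0 mulr_natl mulr2n lerD//.
  have h1 := cos_le1 t; have h2 := cos_ge1Bsqr t.
  rewrite ler0_norm ?subr_le0//; have := sqr_ge0 t; lra.
exact: sin_taylor.
Qed.

Lemma expR_taylor x : `|expR x - 1 - x| <= x ^+ 2 * expR `|x|.
Proof.
have h0 := expR_ge1Dx x.
have h1 : `|expR x - expR 0| <= expR `|x| * `|x - 0|.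
  by apply: expR_lip; rewrite ?ler_norm.
rewrite expR0 subr0 in h1.
have E : expR x * (1 - x) <= 1.
  have := expR_ge1Dx (- x); rewrite expRN => h2.
  by rewrite mulrC -ler_pdivlMr ?expR_gt0// mul1r.
rewrite ger0_norm; last lra.
have h3 : expR x - 1 - x <= x * (expR x - 1) by nra.
apply: le_trans h3 _; apply: le_trans (ler_norm _) _; rewrite normrM.
apply: le_trans (ler_wpM2l (normr_ge0 _) h1) _.
by rewrite mulrCA -expr2 real_normK ?num_real// mulrC.
Qed.

Lemma cexp_taylor (w : R[i]) :
  normc (cexp w - 1 - w) <= 5 * normc w ^+ 2 * expR (normc w).
Proof.
case: w => x y; set w := _ +i* y.
have xw : `|x| <= normc w by exact: (ger_Re w).
have yw : `|y| <= normc w by exact: (ger_Im w).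
have e1 := expR_ge1Dx (normc w).
have n0 := normc_ge0 w.
have -> : cexp w - 1 - w = (expR x)%:C * (cis y - 1 - (0 +i* y)) +
    ((expR x - 1 - x)%:C + ((expR x - 1)%:C * (0 +i* y))).
  by apply: complexP; rewrite /cexp /=; ring.
have -> : 5 * normc w ^+ 2 * expR (normc w) =
  expR (normc w) * (2 * normc w ^+ 2) + (normc w ^+ 2 * expR (normc w) +
   2 * normc w ^+ 2 * expR (normc w)) by ring.
have sqw z : `|z| <= normc w -> z ^+ 2 <= normc w ^+ 2.
  by move=> h; rewrite -real_normK ?num_real// lerXn2r ?nnegrE.
have ex : expR x <= expR (normc w) by rewrite ler_expR (le_trans (ler_norm _)).
apply: normc_leD; last apply: normc_leD.
- rewrite normcM normcR ger0_norm ?expR_ge0// ler_pM ?expR_ge0 ?normc_ge0//.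
  by apply: le_trans (cis_taylor y) _; rewrite ler_wpM2l// sqw.
- rewrite normcR; apply: le_trans (expR_taylor x) _.
  by rewrite ler_pM ?sqr_ge0 ?expR_ge0 ?sqw ?ler_expR.
- rewrite normcM normcR.
  have h1 : `|expR x - expR 0| <= expR `|x| * `|x - 0|.
    by apply: expR_lip; rewrite ?ler_norm.
  rewrite expR0 subr0 in h1.
  have ny : normc (0 +i* y) <= normc w by rewrite normc_sqrtE /= expr0n add0r sqrtr_sqr.
  apply: (@le_trans _ _ (expR (normc w) * normc w * normc w)).
    apply: ler_pM; rewrite ?normc_ge0//; apply: le_trans h1 _.
    by rewrite ler_pM ?expR_ge0 ?ler_expR.
  have := expR_ge0 (normc w); nra.
Qed.

(** The chord of the unit circle is comparable with the arc on half a turn. *)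
Definition chord : R := cos 1 / 2.

Lemma chord_gt0 : 0 < chord.
Proof. by rewrite divr_gt0// cos1_gt0. Qed.

Lemma sin_ge_chord x : 0 <= x -> x <= pi / 2 -> chord * x <= sin x.
Proof.
have pi2 := @pihalf_lt2 R; have pi1 := @pihalf_ge1 R.
have small (y : R) : 0 <= y -> y <= 1 -> cos 1 * y <= sin y.
  move=> y0 y1; have [-> | yn0] := eqVneq y 0; first by rewrite sin0 mulr0.
  have yp : 0 < y by rewrite lt_def yn0.
  have dF (z : R) : z \in `]0, y[%R -> is_derive z 1 (@sin R) (cos z).
    by move=> _; exact: is_derive_sin.
  have [c] := MVT yp dF (continuous_subspaceT (@continuous_sin R)).
  rewrite in_itv/= => /andP[c0 cy]; rewrite sin0 !subr0 => ->.
  rewrite ler_wpM2r// ltW// ltr_cos ?in_itv/= ?ler01/=.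
  - exact: lt_le_trans cy y1.
  - rewrite (ltW c0)/=; lra.
  - lra.
move=> x0 xpi; have c1 := @cos1_gt0 R; rewrite /chord.
have [x1|/ltW x1] := leP x 1; first by have := small x x0 x1; nra.
have s1 := small 1 ler01 (lexx _); rewrite mulr1 in s1.
apply: (@le_trans _ _ (cos 1)); first by nra.
apply: le_trans s1 _.
move: x1; rewrite le_eqVlt => /predU1P[->//|x1].
by rewrite ltW// ltr_sin ?in_itv/=//; lra.
Qed.

Lemma cis_ge_chord t : `|t| <= pi -> chord * `|t| <= normc (cis t - 1).
Proof.
move=> tpi; rewrite -(@cis0 R) normc_cisB subr0.
have -> : `|sin (t / 2)| = `|sin (`|t| / 2)|.
  have [t0|/ltW t0] := leP 0 t; first by rewrite (ger0_norm t0).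
  by rewrite (ler0_norm t0) mulNr sinN normrN.
have := @sin_ge_chord (`|t| / 2).
have p0 : 0 <= `|t| by [].
move=> /(_ ltac:(lra) ltac:(lra)) h.
have := ler_norm (sin (`|t| / 2)); have := chord_gt0; nra.
Qed.

Lemma expR_ge_pow (n : nat) x : 0 <= x -> (1 + x / n.+1%:R) ^+ n.+1 <= expR x.
Proof.
move=> x0; have -> : expR x = expR (x / n.+1%:R) ^+ n.+1.
  by rewrite -expRM_natl mulrC divfK.
by rewrite lerXn2r ?nnegrE ?expR_ge0 ?addr_ge0 ?divr_ge0// expR_ge1Dx.
Qed.

Lemma expRN_le x : 0 <= x -> expR (- x) <= (1 + x)^-1.
Proof.
by move=> x0; rewrite expRN lef_pV2 ?posrE ?expR_gt0 ?expR_ge1Dx//; lra.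
Qed.

End elementary_bounds.

Section complex_limits.
Variable R : realType.
Implicit Types (u v : nat -> R[i]) (l m c : R[i]).

Definition ccvg u l := forall e : R, 0 < e ->
  exists N0, forall N, (N0 <= N)%N -> normc (u N - l) <= e.

Lemma inv_small (C e : R) : 0 < e -> exists N0, forall N, (N0 <= N)%N -> C / N.+1%:R <= e.
Proof.
move=> e0; exists (Num.truncn (`|C| / e)) => N NN.
have h : `|C| / e < N.+1%:R.
  by apply: lt_le_trans (truncnS_gt _) _; rewrite ler_nat ltnS.
rewrite ler_pdivrMr ?ltr0n// mulrC -ler_pdivrMr//.
by apply: le_trans (ltW h); rewrite ler_wpM2r ?invr_ge0 ?(ltW e0)// ler_norm.
Qed.

Lemma ccvg_bound u l (C : R) : (forall N, normc (u N - l) <= C / N.+1%:R) -> ccvg u l.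
Proof.
move=> H e e0; have [N0 HN] := inv_small C e0.
by exists N0 => N /HN; exact: le_trans.
Qed.

Lemma normc_small0 z : (forall e : R, 0 < e -> normc z <= e) -> z = 0 :> R[i].
Proof.
move=> H; apply/eqP; rewrite -normc_eq0; apply/negPn/negP => nz.
have p : 0 < normc z by rewrite lt_def nz normc_ge0.
have := H (normc z / 2) ltac:(lra); lra.
Qed.

Lemma ccvg_unique u l m : ccvg u l -> ccvg u m -> l = m.
Proof.
move=> ul um; apply/eqP; rewrite -subr_eq0; apply/eqP/normc_small0 => e e0.
have [N1 H1] := ul (e / 2) ltac:(lra); have [N2 H2] := um (e / 2) ltac:(lra).
pose N := maxn N1 N2.
have -> : l - m = - (u N - l) + (u N - m) by ring.
have -> : e = e / 2 + e / 2 by field.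
by apply: normc_leD; rewrite ?normcN; [apply: H1|apply: H2]; rewrite ?leq_maxl ?leq_maxr.
Qed.

Lemma ccvgD u v l m : ccvg u l -> ccvg v m -> ccvg (fun N => u N + v N) (l + m).
Proof.
move=> ul vm e e0.
have [N1 H1] := ul (e / 2) ltac:(lra); have [N2 H2] := vm (e / 2) ltac:(lra).
exists (maxn N1 N2) => N; rewrite geq_max => /andP[n1 n2].
have -> : u N + v N - (l + m) = (u N - l) + (v N - m) by ring.
have -> : e = e / 2 + e / 2 by field.
by apply: normc_leD; [exact: H1|exact: H2].
Qed.

Lemma ccvgZ c u l : ccvg u l -> ccvg (fun N => c * u N) (c * l).
Proof.
move=> ul e e0; have p : 0 < 1 + normc c by have := normc_ge0 c; lra.
have [N0 H] := ul (e / (1 + normc c)) ltac:(exact: divr_gt0).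
exists N0 => N /H; rewrite -mulrBr normcM ler_pdivlMr// mulrC.
by apply: le_trans; rewrite mulrDl mul1r lerDr normc_ge0.
Qed.

Lemma ccvg_le u l (M : R) : ccvg u l -> (forall N, normc (u N) <= M) -> normc l <= M.
Proof.
move=> ul uM; rewrite leNgt; apply/negP => Ml.
have [N0 H] := ul ((normc l - M) / 2) ltac:(lra).
have := H N0 (leqnn _); have := uM N0; have := ler_normcB l (u N0).
rewrite normc_distC; lra.
Qed.

Lemma ccvg_sum I (s : seq I) (u : I -> nat -> R[i]) (l : I -> R[i]) :
  (forall i, ccvg (u i) (l i)) -> ccvg (fun N => \sum_(i <- s) u i N) (\sum_(i <- s) l i).
Proof.
move=> H; elim: s => [|i s IH].
  move=> e e0; exists 0%N => N _; rewrite !big_nil subrr normc0; exact: ltW.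
have := ccvgD (H i) IH; congr ccvg; last by rewrite big_cons.
by apply/funext => N; rewrite big_cons.
Qed.

(** Completeness, in the quantitative form in which it is used below. *)
Lemma real_telescope_limit (u : nat -> R) (C : R) :
  (forall N, `|u N.+1 - u N| <= C / (N.+1%:R * N.+2%:R)) ->
  exists r : R, forall N, `|u N - r| <= C / N.+1%:R.
Proof.
move=> H.
have E N : C / (N.+1%:R * N.+2%:R) = C / N.+1%:R - C / N.+2%:R :> R.
  have a0 : (N.+1%:R : R) != 0 by rewrite pnatr_eq0.
  have a1 : (N.+2%:R : R) != 0 by rewrite pnatr_eq0.
  move: a1; rewrite -[N.+2%:R]natr1; move: (N.+1%:R) a0 => a a0 a1.
  by field; rewrite a0 a1.
pose w N := u N - C / N.+1%:R; pose v N := u N + C / N.+1%:R.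
have wS N : w N <= w N.+1.
  have := H N; rewrite E ler_norml /w.
  by move: (C / N.+1%:R) (C / N.+2%:R) => p q /andP[? ?]; lra.
have vS N : v N.+1 <= v N.
  have := H N; rewrite E ler_norml /v.
  by move: (C / N.+1%:R) (C / N.+2%:R) => p q /andP[? ?]; lra.
have wm N M : (N <= M)%N -> w N <= w M.
  by move/subnK <-; elim: (M - N)%N => // k IH; apply: le_trans IH _; rewrite addSn.
have vm N M : (N <= M)%N -> v M <= v N.
  by move/subnK <-; elim: (M - N)%N => // k IH; apply: le_trans IH; rewrite addSn.
have C0 : 0 <= C.
  have := le_trans (normr_ge0 _) (H 0%N).
  by rewrite pmulr_lge0// invr_gt0 mulr_gt0// ltr0n.
have wv N M : w N <= v M.
  apply: le_trans (wm _ (maxn N M) (leq_maxl _ _)) _.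
  apply: le_trans (vm M (maxn N M) (leq_maxr _ _)).
  rewrite /w /v; have : 0 <= C / (maxn N M).+1%:R by rewrite divr_ge0.
  by move: (C / _) => p; lra.
exists (sup (range w)) => N.
have h1 : w N <= sup (range w).
  by apply: ub_le_sup; [exists (v 0%N) => _ [M _ <-]; exact: wv|exists N].
have h2 : sup (range w) <= v N.
  by apply: ge_sup; [exists (w 0%N); exists 0%N|move=> _ [M _ <-]; exact: wv].
by rewrite ler_norml; move: h1 h2; rewrite /w /v; move: (C / _) => p h1 h2; apply/andP; split; lra.
Qed.

Lemma telescope_limit u (C : R) :
  (forall N, normc (u N.+1 - u N) <= C / (N.+1%:R * N.+2%:R)) ->
  exists l, forall N, normc (u N - l) <= 2 * C / N.+1%:R.
Proof.
move=> H.
have [l1 H1] := @real_telescope_limit (fun N => complex.Re (u N)) C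
  (fun N => le_trans (eq_ind _ (fun x => `|x| <= _) (ger_Re _) _ (etrans (cReD _ _) (congr1 _ (cReN _)))) (H N)).
have [l2 H2] := @real_telescope_limit (fun N => complex.Im (u N)) C
  (fun N => le_trans (eq_ind _ (fun x => `|x| <= _) (ger_Im _) _ (etrans (cImD _ _) (congr1 _ (cImN _)))) (H N)).
exists (l1 +i* l2) => N; apply: le_trans (normc_ReIm _) _.
by rewrite cReD cImD cReN cImN -mulrA mulr_natl mulr2n lerD.
Qed.

Lemma quadratic_step_lip (Phi : R -> R[i]) (A B C L : R) : A <= B ->
  (forall s h, A <= s -> 0 <= h -> h <= 1 -> s + h <= B ->
    normc (Phi (s + h) - Phi s) <= L * h + C * h ^+ 2) ->
  normc (Phi B - Phi A) <= L * (B - A).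
Proof.
move=> AB H; apply/ler_addgt0Pr => e e0.
have [N1 H1] := inv_small (B - A) ltr01.
have [N2 H2] := inv_small (C * (B - A) ^+ 2) e0.
pose N := maxn N1 N2; pose h := (B - A) / N.+1%:R.
have h1 : h <= 1 by apply: H1; exact: leq_maxl.
have h0 : 0 <= h by rewrite divr_ge0// subr_ge0.
have step (k : nat) : (k <= N.+1)%N ->
    normc (Phi (A + k%:R * h) - Phi A) <= k%:R * (L * h + C * h ^+ 2).
  elim: k => [|k IH] kN; first by rewrite !mul0r addr0 subrr normc0.
  have -> : Phi (A + k.+1%:R * h) - Phi A = (Phi (A + k%:R * h + h) - Phi (A + k%:R * h)) +
     (Phi (A + k%:R * h) - Phi A) by rewrite -natr1 mulrDl mul1r addrA; ring.
  have -> : k.+1%:R * (L * h + C * h ^+ 2) =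
    (L * h + C * h ^+ 2) + k%:R * (L * h + C * h ^+ 2) by rewrite -natr1; ring.
  apply: normc_leD; last exact/IH/ltnW.
  apply: H => //; first by rewrite lerDl mulr_ge0.
  have -> : A + k%:R * h + h = A + k.+1%:R * h by rewrite -natr1; ring.
  have -> : B = A + N.+1%:R * h by rewrite /h mulrC divfK// addrC subrK.
  by rewrite lerD2l ler_wpM2r// ler_nat.
have := step N.+1 (leqnn _).
have -> : A + N.+1%:R * h = B by rewrite /h mulrC divfK// addrC subrK.
move=> /le_trans; apply; have h2 := H2 N (leq_maxr _ _).
have -> : N.+1%:R * (L * h + C * h ^+ 2) = L * (B - A) + C * (B - A) ^+ 2 / N.+1%:R.
  have a0 : (N.+1%:R : R) != 0 by rewrite pnatr_eq0.
  by rewrite /h; move: (N.+1%:R) a0 => a a0; field.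
by rewrite lerD2l.
Qed.

Lemma quadratic_step_const (Phi : R -> R[i]) (A B C : R) : A <= B ->
  (forall s h, A <= s -> 0 <= h -> h <= 1 -> s + h <= B ->
    normc (Phi (s + h) - Phi s) <= C * h ^+ 2) -> Phi B = Phi A.
Proof.
move=> AB H; apply/eqP; rewrite -subr_eq0 -normc_eq0 eq_le normc_ge0 andbT.
rewrite -[leRHS](mul0r (B - A)); apply: (quadratic_step_lip (C := C) AB) => s h *.
by rewrite mul0r add0r H.
Qed.

End complex_limits.

Section symmetric_range.

Fixpoint zr (N : nat) : seq int :=
  if N is n.+1 then [:: n.+1%:Z, - n.+1%:Z & zr n] else [:: 0].

Lemma mem_zr N (k : int) : (k \in zr N) = (`|k|%N <= N)%N.
Proof.
elim: N k => [|N IH] k /=; first by rewrite inE leqn0 absz_eq0.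
rewrite !inE IH; lia.
Qed.

Lemma uniq_zr N : uniq (zr N).
Proof.
elim: N => //= N IH; rewrite IH andbT inE !mem_zr; lia.
Qed.

Lemma telescope_zr (V : zmodType) (a : int -> V) N :
  \sum_(k <- zr N) (a (k + 1) - a k) = a N.+1%:Z - a (- N%:Z).
Proof.
elim: N => [|N IH] /=; first by rewrite big_seq1 add0r oppr0.
rewrite !big_cons IH; have -> : - N.+1%:Z + 1 = - N%:Z by lia.
have -> : N.+1%:Z + 1 = N.+2%:Z by lia.
by rewrite [a (- N%:Z) - _ + _]addrC !subrKA.
Qed.

End symmetric_range.

(** * Lattice sums and one-variable integrals *)

Section lattice_sums.
Variable R : realType.

Lemma sum_lorentz_nat (V : R) (M : nat) : 0 < V ->
  \sum_(0 <= j < M) (1 + (j%:R / V) ^+ 2)^-1 <= 1 + 2 * V.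
Proof.
move=> V0.
suff H : \sum_(0 <= j < M.+1) (1 + (j%:R / V) ^+ 2)^-1 <=
    1 + 2 * V - 2 * V ^+ 2 / (V + M%:R).
  apply: (@le_trans _ _ (\sum_(0 <= j < M.+1) (1 + (j%:R / V) ^+ 2)^-1)).
    by rewrite big_nat_recr//= lerDl invr_ge0 addr_ge0// sqr_ge0.
  apply: le_trans H _; rewrite gerBl; apply: divr_ge0.
    by rewrite mulr_ge0 ?sqr_ge0.
  by rewrite addr_ge0// ltW.
elim: M => [|M IH].
  rewrite big_nat1 mul0r expr0n addr0 invr1 addr0.
  have -> : 2 * V ^+ 2 / V = 2 * V by field; rewrite gt_eqF.
  by rewrite addrK.
rewrite big_nat_recr//=; apply: le_trans (lerD IH (lexx _)) _.
set m : R := M%:R; have m0 : 0 <= m by rewrite /m.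
have -> : M.+1%:R = m + 1 by rewrite natr1.
have -> : (1 + ((m + 1) / V) ^+ 2)^-1 = V ^+ 2 / (V ^+ 2 + (m + 1) ^+ 2).
  field; rewrite gt_eqF//= ?gt_eqF//; nra.
have p1 : 0 < V + m by lra.
have p2 : 0 < V + (m + 1) by lra.
have p3 : 0 < V ^+ 2 + (m + 1) ^+ 2 by nra.
have E : 2 * V ^+ 2 / (V + m) - 2 * V ^+ 2 / (V + (m + 1)) =
   2 * V ^+ 2 / ((V + m) * (V + (m + 1))).
  by field; rewrite !gt_eqF//; lra.
suff : V ^+ 2 / (V ^+ 2 + (m + 1) ^+ 2) <= 2 * V ^+ 2 / ((V + m) * (V + (m + 1))) by rewrite -E; lra.
rewrite ler_pdivrMr// mulrAC ler_pdivlMr ?mulr_gt0//.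
have V2 : 0 < V ^+ 2 by rewrite exprn_gt0.
have PS : (V + m) * (V + (m + 1)) <= 2 * (V ^+ 2 + (m + 1) ^+ 2).
  by have := sqr_ge0 (V - (m + 1)); nra.
have := ler_wpM2l (ltW V2) PS; lra.
Qed.

(** A bump of width [V] meets about [1 + V] integers, wherever it sits. *)
Lemma sum_lorentz (V x : R) (N : nat) : 0 < V ->
  \sum_(k <- zr N) (1 + ((x - k%:~R) / V) ^+ 2)^-1 <= 4 * (1 + V).
Proof.
move=> V0; pose m := Num.floor x.
have mx : m%:~R <= x by exact: ge_floor.
have xm : x < m%:~R + 1 by rewrite -intrD1 floorD1_gt.
pose g (j : nat) : R := (1 + (j%:R / V) ^+ 2)^-1.
have g0 j : 0 <= g j by rewrite invr_ge0 addr_ge0// sqr_ge0.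
have comp (j : nat) (y : R) : j%:R <= `|y| -> (1 + (y / V) ^+ 2)^-1 <= g j.
  move=> jy; rewrite lef_pV2 ?posrE ?ltr_pwDl ?sqr_ge0// lerD2l.
  rewrite -[leRHS]real_normK ?num_real// lerXn2r ?nnegrE ?divr_ge0 ?(ltW V0)//.
  by rewrite normrM normfV (gtr0_norm V0) ler_wpM2r// invr_ge0 ltW.
have half (P : pred int) (f : int -> nat) : {in P &, injective f} ->
    (forall k, P k -> (f k)%:R <= `|x - k%:~R|) ->
    \sum_(k <- zr N | P k) (1 + ((x - k%:~R) / V) ^+ 2)^-1 <= 1 + 2 * V.
  move=> inj fx.
  apply: (@le_trans _ _ (\sum_(k <- zr N | P k) g (f k))).
    by apply: ler_sum => k Pk; apply: comp; exact: fx.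
  rewrite -big_filter -(big_map f xpredT g).
  pose s := [seq f k | k <- zr N & P k].
  apply: (@le_trans _ _ (\sum_(0 <= j < (\max_(j <- s) j).+1) g j)); last exact: sum_lorentz_nat.
  apply: ler_sum_subset => //.
  - rewrite map_inj_in_uniq ?filter_uniq ?uniq_zr//.
    by move=> k l; rewrite !mem_filter => /andP[Pk _] /andP[Pl _]; exact: inj.
  - exact: iota_uniq.
  - by move=> j js; rewrite mem_index_iota /= ltnS; exact: leq_bigmax_seq.
rewrite (bigID (fun k => k <= m))/=.
have -> : 4 * (1 + V) = (2 + 2 * V) + (2 + 2 * V) by ring.
have h1 := half (fun k => k <= m) (fun k => `|m - k|%N).
have h2 := half (fun k => ~~ (k <= m)) (fun k : int => `|(k - m - 1)%R|%N).
apply: lerD.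
  apply: le_trans (h1 _ _) _; last lra.
    by move=> k l; rewrite !unfold_in; lia.
  move=> k km; rewrite natr_absz ger0_norm; last lia.
  by rewrite intrB ger0_norm; [lra|move: km; rewrite -(ler_int R); lra].
apply: le_trans (h2 _ _) _; last lra.
  by move=> k l; rewrite !unfold_in; lia.
move=> k; rewrite -ltNge => mk.
have mk' : (m + 1)%:~R <= k%:~R :> R by rewrite ler_int; lia.
rewrite natr_absz ger0_norm; last lia.
rewrite intrD1 in mk'.
by rewrite !intrB ler0_norm; lra.
Qed.

Lemma sum_lorentz1 (N : nat) : \sum_(k <- zr N) (1 + (k%:~R : R) ^+ 2)^-1 <= 8.
Proof.
have := @sum_lorentz 1 0 N ltr01.
under eq_bigr do rewrite sub0r divr1 sqrrN.
lra.
Qed.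

Definition zser (u : int -> R[i]) : R[i] :=
  xget 0 [set l | ccvg (fun N => \sum_(k <- zr N) u k) l].

Lemma zser_tail (u : int -> R[i]) (C : R) :
  (forall k, normc (u k) <= C / (1 + (k%:~R) ^+ 2)) ->
  forall N, normc (\sum_(k <- zr N) u k - zser u) <= 8 * C / N.+1%:R.
Proof.
move=> uC.
have C0 : 0 <= C.
  by have := le_trans (normc_ge0 _) (uC 0); rewrite expr0n addr0 divr1.
have [l Hl] : exists l, forall N, normc (\sum_(k <- zr N) u k - l) <= 2 * (4 * C) / N.+1%:R.
  apply: telescope_limit => N /=; rewrite !big_cons addrA addrK.
  have -> : 4 * C / (N.+1%:R * N.+2%:R) = 2 * C / (N.+1%:R * N.+2%:R) + 2 * C / (N.+1%:R * N.+2%:R) by ring.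
  have B : C / (1 + (N.+1%:R : R) ^+ 2) <= 2 * C / (N.+1%:R * N.+2%:R).
    rewrite -[N.+2%:R]natr1; have : 1 <= N.+1%:R :> R by rewrite ler1n.
    move: (N.+1%:R : R) => n n1.
    rewrite ler_pdivlMr; last by nra.
    rewrite mulrAC ler_pdivrMr; last by nra.
    have nn : n * (n + 1) <= 2 * (1 + n ^+ 2) by nra.
    have := ler_wpM2l C0 nn; lra.
  apply: normc_leD; apply: le_trans (uC _) _.
    by rewrite -pmulrn.
  by rewrite mulrNz sqrrN -pmulrn.
suff -> : zser u = l by move=> N; have := Hl N; rewrite mulrA -[2 * 4]natrM.
have cl := ccvg_bound Hl.
by apply: (ccvg_unique _ cl); exact: (xgetI 0 cl).
Qed.

Lemma sum_zr_le (F : int -> R) (C : R) (N : nat) :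
  (forall k, F k <= C / (1 + (k%:~R) ^+ 2)) -> 0 <= C ->
  \sum_(k <- zr N) F k <= 8 * C.
Proof.
move=> FC C0; apply: (@le_trans _ _ (C * \sum_(k <- zr N) (1 + (k%:~R : R) ^+ 2)^-1)).
  by rewrite mulr_sumr; apply: ler_sum => k _; exact: FC.
by rewrite mulrC ler_wpM2r// sum_lorentz1.
Qed.

End lattice_sums.

Section complex_functions_of_a_real_variable.
Variable R : realType.
Local Notation U := (uniform_prob (@ltr01 R)).
Implicit Types (f g : R -> R[i]).

Definition ccontinuous f :=
  continuous (fun y => complex.Re (f y)) /\ continuous (fun y => complex.Im (f y)).

Definition cderive f f' := forall y : R,
  is_derive y 1 (fun y => complex.Re (f y)) (complex.Re (f' y)) /\
  is_derive y 1 (fun y => complex.Im (f y)) (complex.Im (f' y)).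

Lemma ccont_cst (c : R[i]) : ccontinuous (fun=> c).
Proof. by split => y; exact: cvg_cst. Qed.

Lemma ccontD f g : ccontinuous f -> ccontinuous g -> ccontinuous (fun y => f y + g y).
Proof.
move=> [f1 f2] [g1 g2]; split.
- by under eq_fun do rewrite cReD; move=> y; apply: cvgD; [exact: f1|exact: g1].
- by under eq_fun do rewrite cImD; move=> y; apply: cvgD; [exact: f2|exact: g2].
Qed.

Lemma ccontM f g : ccontinuous f -> ccontinuous g -> ccontinuous (fun y => f y * g y).
Proof.
move=> [f1 f2] [g1 g2]; split.
- under eq_fun do rewrite cReM; move=> y.
  by apply: cvgB; apply: cvgM; [exact: f1|exact: g1|exact: f2|exact: g2].
- under eq_fun do rewrite cImM; move=> y.
  by apply: cvgD; apply: cvgM; [exact: f1|exact: g2|exact: f2|exact: g1].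
Qed.

Lemma ccont_sum I (s : seq I) (F : I -> R -> R[i]) :
  (forall i, ccontinuous (F i)) -> ccontinuous (fun y => \sum_(i <- s) F i y).
Proof.
move=> cF; elim: s => [|i s IH].
  by under eq_fun do rewrite big_nil; exact: ccont_cst.
by under eq_fun do rewrite big_cons; exact: ccontD.
Qed.

Lemma ccont_real (f : R -> R) : continuous f -> ccontinuous (fun y => (f y)%:C).
Proof. by move=> cf; split => //= y; exact: cvg_cst. Qed.

Lemma ccont_cis (f : R -> R) : continuous f -> ccontinuous (fun y => cis (f y)).
Proof.
by move=> cf; split => y /=; apply: continuous_comp; [exact: cf|exact: continuous_cos|exact: cf|exact: continuous_sin].
Qed.

Lemma ccont_measurable f : ccontinuous f -> cmeasurable (f : measurableTypeR R -> R[i]).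
Proof. by move=> [f1 f2]; split; exact: continuous_measurable_fun. Qed.

Lemma ccont_integrable f : ccontinuous f -> cintegrable U f.
Proof. by move=> [f1 f2]; split; exact: uniform_integrable. Qed.

Lemma cint_uniform_le f (M : R) : ccontinuous f ->
  (forall y, 0 <= y -> y <= 1 -> normc (f y) <= M) -> normc (cint U f) <= M.
Proof.
move=> cf fM; have fi := ccont_integrable cf.
apply: le_trans (normc_cint fi) _.
have mf := measurable_normc (ccont_measurable cf).
have E : (\int[U]_x (normc (f x))%:E = \int[lebesgue_measure]_(x in `[0%R, 1%R]) (normc (f x))%:E)%E.
  exact: integral_uniform01.
rewrite -lee_fin /Rintegral fineK; last first.
  by apply: integrable_fin_num => //; exact: cintegrable_normc.
rewrite E.
have -> : M%:E = (\int[lebesgue_measure]_(x in `[0%R, 1%R]) (cst M%:E) (x : R))%E.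
  by rewrite integral_cst//= lebesgue_measure_itv/= lte_fin ltr01 sube0 mule1.
apply: ge0_le_integral => //=.
- by move=> x _; rewrite lee_fin normc_ge0.
- by apply/measurable_EFinP; apply: measurable_funS mf.
- by move=> x; rewrite in_itv/= lee_fin => /andP[? ?]; exact: fM.
Qed.

Lemma cint_FTC f f' : ccontinuous f' -> cderive f f' -> cint U f' = f 1 - f 0.
Proof.
move=> [c1 c2] df; apply: complexP => /=.
- by rewrite (uniform_FTC c1 (fun y => (df y).1)) cReD cReN.
- by rewrite (uniform_FTC c2 (fun y => (df y).2)) cImD cImN.
Qed.

Lemma cderive_lip f f' (A B M : R) : cderive f f' ->
  (forall y, A <= y -> y <= B -> normc (f' y) <= M) ->
  forall x y, A <= x -> x <= B -> A <= y -> y <= B ->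
  normc (f x - f y) <= 2 * M * `|x - y|.
Proof.
move=> df fM.
have H (g g' : R -> R) (x y : R) : (forall y : R, is_derive y 1 g (g' y)) ->
    (forall y, A <= y -> y <= B -> `|g' y| <= M) ->
    A <= x -> x <= B -> A <= y -> y <= B -> x <= y -> `|g x - g y| <= M * `|x - y|.
  move=> dg gM Ax xB Ay yB; rewrite le_eqVlt => /predU1P[->|xy].
    by rewrite !subrr normr0 mulr0.
  have cg : continuous g.
    by move=> t; apply: differentiable_continuous; apply/derivable1_diffP; case: (dg t).
  have [c] := MVT xy (fun t _ => dg t) (continuous_subspaceT cg).
  rewrite in_itv/= => /andP[xc cy]; rewrite distrC => ->.
  rewrite normrM [`|x - y|]distrC ler_wpM2r// gM//; lra.
have H' (g g' : R -> R) (x y : R) : (forall y : R, is_derive y 1 g (g' y)) ->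
    (forall y, A <= y -> y <= B -> `|g' y| <= M) ->
    A <= x -> x <= B -> A <= y -> y <= B -> `|g x - g y| <= M * `|x - y|.
  move=> dg gM Ax xB Ay yB; have [xy|/ltW yx] := leP x y; first exact: (H g g').
  by rewrite distrC [`|x - y|]distrC; exact: (H g g').
move=> x y Ax xB Ay yB; apply: le_trans (normc_ReIm _) _.
rewrite cReD cImD cReN cImN -mulrA mulr_natl mulr2n; apply: lerD.
- apply: (H' (fun y => complex.Re (f y)) (fun y => complex.Re (f' y))) => //.
    by move=> t; case: (df t).
  by move=> t At tB; apply: le_trans (ger_Re _) _; exact: fM.
- apply: (H' (fun y => complex.Im (f y)) (fun y => complex.Im (f' y))) => //.
    by move=> t; case: (df t).
  by move=> t At tB; apply: le_trans (ger_Im _) _; exact: fM.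
Qed.

Lemma ccont_lip f : (forall Y : R, exists L : R, forall x y : R, `|x| <= Y -> `|y| <= Y ->
  normc (f x - f y) <= L * `|x - y|) -> ccontinuous f.
Proof.
move=> H.
have G (g : R -> R) : (forall x y, `|g x - g y| <= normc (f x - f y)) -> continuous g.
  move=> gf x; have [L HL] := H (`|x| + 1).
  apply/cvgrPdist_le => e e0; near=> y.
  have xy : `|x - y| <= e / (1 + `|L|) by near: y; apply: cvgr_dist_le; [exact: cvg_id|rewrite divr_gt0// ltr_pwDl].
  have xy1 : `|x - y| <= 1 by near: y; apply: cvgr_dist_le; [exact: cvg_id|].
  apply: le_trans (gf _ _) _; apply: le_trans (HL _ _ _ _) _.
  - by rewrite lerDl.
  - have -> : y = x - (x - y) by ring.
    by apply: le_trans (ler_normB _ _) _; rewrite lerD2l.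
  - move: xy; rewrite ler_pdivlMr ?ltr_pwDl// => xy.
    apply: le_trans xy; rewrite mulrDr mulr1 mulrC.
    have := ler_norm L; have := normr_ge0 (x - y); nra.
split; apply: G => x y; [rewrite -cReN -cReD; exact: ger_Re|rewrite -cImN -cImD; exact: ger_Im].
Unshelve. all: by end_near. Qed.

End complex_functions_of_a_real_variable.

(** * Gaussians and their periodization *)

Section gaussian.
Variable R : realType.
Local Notation U := (uniform_prob (@ltr01 R)).

Definition gauss (a b xi y : R) : R[i] :=
  cexp ((- (pi * a * y ^+ 2)) +i* (2 * pi * xi * y - pi * b * y ^+ 2)).

Lemma gauss_cis (a b xi y : R) : gauss a b xi y =
  (expR (- (pi * a * y ^+ 2)))%:C * cis (2 * pi * xi * y - pi * b * y ^+ 2).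
Proof. by []. Qed.

Lemma normc_gauss (a b xi y : R) : normc (gauss a b xi y) = expR (- (pi * a * y ^+ 2)).
Proof. exact: normc_cexp. Qed.

Definition gauss_const (a : R) := (1 + 3 / (pi * a)) ^+ 3.

Section decay.
Variable a : R.
Hypothesis a0 : 0 < a.

Let pia : 0 < pi * a. Proof. by rewrite mulr_gt0// pi_gt0. Qed.

Lemma gauss_const_ge0 : 0 <= gauss_const a.
Proof. by rewrite exprn_ge0// addr_ge0// divr_ge0// ltW. Qed.

Lemma gauss_decay3 (b xi u : R) :
  normc (gauss a b xi u) * (1 + u ^+ 2) ^+ 3 <= gauss_const a.
Proof.
rewrite normc_gauss expRN mulrC ler_pdivrMr ?expR_gt0//.
have x0 : 0 <= pi * a * u ^+ 2 by rewrite mulr_ge0 ?sqr_ge0// ltW.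
apply: le_trans (ler_wpM2l gauss_const_ge0 (expR_ge_pow 2 x0)).
rewrite /gauss_const -exprMn lerXn2r ?nnegrE//.
- by rewrite addr_ge0// sqr_ge0.
- by rewrite mulr_ge0 ?addr_ge0 ?divr_ge0// ltW.
have -> : (1 + 3 / (pi * a)) * (1 + pi * a * u ^+ 2 / 3) =
   1 + u ^+ 2 + (3 / (pi * a) + pi * a * u ^+ 2 / 3).
  by have := @pi_gt0 R; move: (@pi R) => p p0; field; rewrite !gt_eqF.
by rewrite lerDl addr_ge0 ?divr_ge0// ltW.
Qed.

Lemma gauss_decay (b xi u w : R) : 0 <= w -> w <= (1 + u ^+ 2) ^+ 2 ->
  normc (gauss a b xi u) * w <= gauss_const a / (1 + u ^+ 2).
Proof.
move=> w0 wu; have p : 0 < 1 + u ^+ 2 by have := sqr_ge0 u; lra.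
rewrite ler_pdivlMr// -mulrA; apply: le_trans (gauss_decay3 b xi u).
by rewrite ler_wpM2l ?normc_ge0// [leRHS]exprSr ler_wpM2r// ltW.
Qed.

Lemma shift_lorentz (Y y : R) (k : int) : `|y| <= Y ->
  (1 + (y + k%:~R) ^+ 2)^-1 <= (2 + 2 * Y ^+ 2) / (1 + (k%:~R) ^+ 2).
Proof.
move=> yY; set v : R := k%:~R.
have y2 : y ^+ 2 <= Y ^+ 2.
  by rewrite -real_normK ?num_real// lerXn2r ?nnegrE ?(le_trans _ yY).
have p1 : 0 < 1 + (y + v) ^+ 2 by have := sqr_ge0 (y + v); lra.
have p2 : 0 < 1 + v ^+ 2 by have := sqr_ge0 v; lra.
rewrite -[leLHS]mul1r ler_pdivrMr// mulrAC ler_pdivlMr// mul1r.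
have := sqr_ge0 (y + y + v); have := sqr_ge0 (y + v); have := sqr_ge0 Y; nra.
Qed.

Definition shift_const (Y : R) := gauss_const a * (2 + 2 * Y ^+ 2).

Lemma shift_const_ge0 Y : 0 <= shift_const Y.
Proof. by rewrite mulr_ge0 ?gauss_const_ge0// addr_ge0// mulr_ge0 ?sqr_ge0. Qed.

Lemma gauss_shift_w (Y y b xi w : R) (k : int) : `|y| <= Y ->
  0 <= w -> w <= (1 + (y + k%:~R) ^+ 2) ^+ 2 ->
  normc (gauss a b xi (y + k%:~R)) * w <= shift_const Y / (1 + (k%:~R) ^+ 2).
Proof.
move=> yY w0 wu; apply: le_trans (gauss_decay b xi w0 wu) _.
by rewrite /shift_const -mulrA ler_wpM2l ?gauss_const_ge0// shift_lorentz.
Qed.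

Lemma gauss_shift (Y y b xi : R) (k : int) : `|y| <= Y ->
  normc (gauss a b xi (y + k%:~R)) <= shift_const Y / (1 + (k%:~R) ^+ 2).
Proof.
move=> yY; rewrite -[leLHS]mulr1; apply: gauss_shift_w => //.
by rewrite exprn_ege1// lerDl sqr_ge0.
Qed.

Definition theta (b xi y : R) : R[i] := zser (fun k => gauss a b xi (y + k%:~R)).

Lemma theta_tail (Y y b xi : R) (N : nat) : `|y| <= Y ->
  normc (\sum_(k <- zr N) gauss a b xi (y + k%:~R) - theta b xi y) <=
  8 * shift_const Y / N.+1%:R.
Proof. by move=> yY; apply: zser_tail => k; exact: gauss_shift. Qed.

Lemma theta_cvg (b xi y : R) :
  ccvg (fun N => \sum_(k <- zr N) gauss a b xi (y + k%:~R)) (theta b xi y).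
Proof. by apply: ccvg_bound => N; exact: theta_tail (lexx _). Qed.

Lemma gauss_ends (b xi y : R) (w : R -> R) (N : nat) :
  (forall u, `|w u| <= (1 + u ^+ 2) ^+ 2) ->
  normc (gauss a b xi (y + N.+1%:Z%:~R) * (w (y + N.+1%:Z%:~R))%:C -
         gauss a b xi (y + (- N%:Z)%:~R) * (w (y + (- N%:Z)%:~R))%:C) <=
  3 * shift_const `|y| / N.+1%:R.
Proof.
move=> wu; set S := shift_const _.
have S0 : 0 <= S := shift_const_ge0 _.
have n1 : 1 <= N.+1%:R :> R by rewrite ler1n.
have -> : 3 * S / N.+1%:R = S / N.+1%:R + 2 * S / N.+1%:R by ring.
have H k : normc (gauss a b xi (y + k%:~R) * (w (y + k%:~R))%:C) <= S / (1 + k%:~R ^+ 2).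
  by rewrite normcM normcR; apply: gauss_shift_w.
apply: normc_leD.
  apply: le_trans (H _) _; rewrite ler_wpM2l// lef_pV2 ?posrE; last 2 first.
  - by have := sqr_ge0 (N.+1%:Z%:~R : R); lra.
  - lra.
  by rewrite -pmulrn; nra.
rewrite normcN; apply: le_trans (H _) _.
have -> : 2 * S / N.+1%:R = S * (2 / N.+1%:R) by ring.
rewrite ler_wpM2l//.
rewrite mulrNz sqrrN -pmulrn -[N.+1%:R]natr1; have n0 : 0 <= N%:R :> R by [].
move: (N%:R : R) n0 => n n0; rewrite -[leLHS]mul1r ler_pdivrMr; last by nra.
by rewrite mulrAC ler_pdivlMr; nra.
Qed.

Lemma gauss_ends1 (b xi y : R) (N : nat) :
  normc (gauss a b xi (y + N.+1%:Z%:~R) - gauss a b xi (y + (- N%:Z)%:~R)) <=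
  3 * shift_const `|y| / N.+1%:R.
Proof.
have := @gauss_ends b xi y (fun=> 1) N; rewrite !mulr1; apply => u.
by rewrite normr1 exprn_ege1// lerDl sqr_ge0.
Qed.

Lemma theta_periodic (b xi y : R) : theta b xi (y + 1) = theta b xi y.
Proof.
have h := theta_cvg b xi y; have h' := theta_cvg b xi (y + 1).
apply: (ccvg_unique h').
have := ccvgD h (ccvg_bound (u := fun N => gauss a b xi (y + N.+1%:Z%:~R) -
   gauss a b xi (y + (- N%:Z)%:~R)) (l := 0) (C := 3 * shift_const `|y|) _).
rewrite addr0 => /(_ (fun N => eq_ind_r (fun z => normc z <= _) (gauss_ends1 _ _ _ _) (subr0 _))).
congr ccvg; apply/funext => N.
rewrite -(telescope_zr (fun k => gauss a b xi (y + k%:~R))) -big_split /=.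
by apply: eq_bigr => k _; rewrite addrC subrK intrD [k%:~R + 1]addrC addrA.
Qed.

Lemma theta_periodicz (b xi y : R) (m : int) : theta b xi (y + m%:~R) = theta b xi y.
Proof.
have H n (x : R) : theta b xi (x + n%:R) = theta b xi x.
  elim: n => [|n IH]; first by rewrite addr0.
  by rewrite -natr1 addrA theta_periodic.
case: m => n; first exact: H.
by rewrite NegzE mulrNz -pmulrn -(H n.+1 (y - n.+1%:R)) subrK.
Qed.

Definition gauss' (b xi y : R) : R[i] :=
  ((- (2 * pi * a * y)) +i* (2 * pi * xi - 2 * pi * b * y)) * gauss a b xi y.

Lemma gauss_cderive (b xi k : R) :
  cderive (fun y => gauss a b xi (y + k)) (fun y => gauss' b xi (y + k)).
Proof.
move=> y; rewrite /gauss' /gauss /cexp /cis; split => /=.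
- by apply: is_derive_eq; rewrite /GRing.scale /=; move: (@pi R) => p; ring.
- by apply: is_derive_eq; rewrite /GRing.scale /=; move: (@pi R) => p; ring.
Qed.

End decay.
End gaussian.

(** * Poisson summation *)

Section poisson_summation.
Variable R : realType.
Local Notation U := (uniform_prob (@ltr01 R)).
Variable a : R.
Hypothesis a0 : 0 < a.

Lemma cderive_ccont (f f' : R -> R[i]) : cderive f f' -> ccontinuous f.
Proof.
by move=> df; split => t; apply: differentiable_continuous; apply/derivable1_diffP;
  case: (df t) => -[d1 _] [d2 _].
Qed.

Lemma ccont_gauss (b xi k : R) : ccontinuous (fun y => gauss a b xi (y + k)).
Proof. exact: cderive_ccont (gauss_cderive a b xi k). Qed.

Lemma theta_lip (b xi Y : R) : exists2 L, 0 <= L & forall x y : R, `|x| <= Y -> `|y| <= Y ->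
  normc (theta a b xi x - theta a b xi y) <= L * `|x - y|.
Proof.
pose D := 2 * pi * (a + `|b| + `|xi|).
have D0 : 0 <= D by rewrite !mulr_ge0 ?pi_ge0// !addr_ge0// ltW.
have S0 := shift_const_ge0 a0 Y.
have DS : 0 <= 2 * (D * shift_const a Y).
  by apply: mulr_ge0 => //; exact: mulr_ge0.
exists (8 * (2 * (D * shift_const a Y))); first exact: mulr_ge0.
move=> x y xY yY.
apply: (ccvg_le (u := fun N => \sum_(k <- zr N) gauss a b xi (x + k%:~R) +
   -1 * \sum_(k <- zr N) gauss a b xi (y + k%:~R))).
  by rewrite -[- theta a b xi y]mulN1r; apply: ccvgD; [exact: theta_cvg|apply: ccvgZ; exact: theta_cvg].
move=> N; rewrite mulN1r -sumrB; apply: le_trans (normc_sum _ _ _) _.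
rewrite -mulrA; apply: sum_zr_le => [k|]; last exact: mulr_ge0.
rewrite mulrAC.
have -> : 2 * (D * shift_const a Y) / (1 + k%:~R ^+ 2) =
   2 * (D * (shift_const a Y / (1 + k%:~R ^+ 2))) by ring.
apply: (cderive_lip (f := fun y => gauss a b xi (y + k%:~R)) (A := - Y) (B := Y)
  (gauss_cderive a b xi k%:~R)); try by move: xY yY; rewrite !ler_norml => /andP[? ?] /andP[? ?].
move=> t tA tB; have tY : `|t| <= Y by rewrite ler_norml tA.
set u := t + k%:~R; rewrite /gauss' normcM.
have h := gauss_shift_w a0 b xi (k := k) tY (sqr_ge0 (1 + (t + k%:~R) ^+ 2)) (lexx _).
apply: le_trans (ler_wpM2l D0 h); rewrite -/u mulrCA mulrC ler_wpM2l ?normc_ge0//.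
apply: le_trans (normc_ReIm _) _; rewrite /=.
have u1 : `|u| <= (1 + u ^+ 2) ^+ 2.
  by rewrite -[u ^+ 2]real_normK ?num_real//; have := normr_ge0 u; move: `|u| => v; nra.
have u2 : 1 <= (1 + u ^+ 2) ^+ 2 by rewrite exprn_ege1// lerDl sqr_ge0.
apply: (@le_trans _ _ (2 * pi * a * `|u| + (2 * pi * `|xi| + 2 * pi * `|b| * `|u|))).
  rewrite normrN; have p0 := @pi_ge0 R; apply: lerD.
    by rewrite !normrM (ger0_norm p0) (gtr0_norm a0) ger0_norm.
  apply: le_trans (ler_normB _ _) _.
  by rewrite !normrM (ger0_norm p0) [`|2|]ger0_norm.
have p0 := @pi_ge0 R.
have e1 := ler_wpM2l (mulr_ge0 (mulr_ge0 (ler0n R 2) p0) (ltW a0)) u1.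
have e2 := ler_wpM2l (mulr_ge0 (mulr_ge0 (ler0n R 2) p0) (normr_ge0 b)) u1.
have e3 := ler_wpM2l (mulr_ge0 (mulr_ge0 (ler0n R 2) p0) (normr_ge0 xi)) u2.
rewrite /D; lra.
Qed.

Lemma ccont_theta (b xi : R) : ccontinuous (theta a b xi).
Proof. by apply: ccont_lip => Y; have [L _ H] := theta_lip b xi Y; exists L. Qed.

(** The Fourier integral of the Gaussian [gauss a b 0] at [-xi], folded onto the
    unit interval so that no integral over the line is needed. *)
Definition gaussF (b xi : R) : R[i] := cint U (theta a b xi).

Definition gaussFN (b xi : R) (N : nat) : R[i] :=
  cint U (fun y => \sum_(k <- zr N) gauss a b xi (y + k%:~R)).

Lemma gaussFN_cvg (b xi : R) : ccvg (gaussFN b xi) (gaussF b xi).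
Proof.
apply: (ccvg_bound (C := 8 * shift_const a 1)) => N.
have c1 : ccontinuous (fun y => \sum_(k <- zr N) gauss a b xi (y + k%:~R)).
  by apply: ccont_sum => k; exact: ccont_gauss.
rewrite -cintB; try exact: ccont_integrable; last exact/ccont_integrable/ccont_theta.
apply: cint_uniform_le.
  have := ccontD c1 (ccontM (ccont_cst (-1)) (ccont_theta b xi)).
  by under [X in ccontinuous X -> _]eq_fun do rewrite mulN1r.
move=> y y0 y1; apply: theta_tail => //; by rewrite ger0_norm.
Qed.

Lemma gauss_shift_freq (b xi h u : R) :
  gauss a b (xi + h) u = gauss a b xi u * cis (2 * pi * h * u).
Proof. by rewrite !gauss_cis -[RHS]mulrA -cisD; congr (_ * cis _); ring. Qed.

Lemma theta_twist (b xi y : R) (n : int) :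
  theta a b xi y * cis (- (2 * pi * n%:~R * y)) = theta a b (xi - n%:~R) y.
Proof.
have h := ccvgZ (cis (- (2 * pi * n%:~R * y))) (theta_cvg a0 b xi y).
rewrite mulrC; apply: (ccvg_unique h).
have := theta_cvg a0 b (xi - n%:~R) y; congr ccvg; apply/funext => N.
rewrite mulr_sumr; apply: eq_bigr => k _.
rewrite gauss_shift_freq mulrC; congr (_ * _).
have -> : 2 * pi * - n%:~R * (y + k%:~R) =
    - (2 * pi * n%:~R * y) + 2 * pi * (- (n * k))%:~R :> R.
  by rewrite mulrNz intrM; ring.
by rewrite cisD cis2piz mulr1.
Qed.

Let e (n : int) (y : measurableTypeR R) : R[i] := cis (2 * pi * n%:~R * y).

Lemma orthonormal_cis (s : seq int) : orthonormal_on U e s.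
Proof.
move=> i j _ _; rewrite -subr_eq0 -cint_cis2pi; apply: eq_cint => y.
by rewrite /e cisJ -cisD; congr cis; rewrite intrB; ring.
Qed.

Lemma bounded_terms_cvg0 (v : int -> R) (M : R) : (forall k, 0 <= v k) ->
  (forall N, \sum_(k <- zr N) v k <= M) ->
  forall eps : R, 0 < eps -> exists N0, forall N, (N0 <= N)%N -> v N.+1%:Z + v (- N.+1%:Z) <= eps.
Proof.
move=> v0 vM eps e0.
pose w N := \sum_(k <- zr N) v k.
have hs : has_sup (range w).
  split; first by exists (w 0%N); exists 0%N.
  by exists M => _ [N _ <-]; exact: vM.
have [_ [N0 _ <-] wN0] := sup_adherent e0 hs.
have wS N : w N.+1 = v N.+1%:Z + v (- N.+1%:Z) + w N by rewrite /w /= !big_cons addrA.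
have wm N : (N0 <= N)%N -> w N0 <= w N.
  move/subnK <-; elim: (N - N0)%N => // k IH; apply: le_trans IH _.
  by rewrite addSn wS; have := v0 (k + N0).+1%:Z; have := v0 (- (k + N0).+1%:Z); lra.
exists N0 => N /wm NN.
have := ub_le_sup hs.2 (ex_intro2 _ _ N.+1 I erefl : range w (w N.+1)).
rewrite wS; lra.
Qed.

(** Chernoff's argument: after division by [e(y - l) - 1] the partial Fourier
    sums at [l] telescope, and Bessel's inequality disposes of the two ends. *)
Lemma poisson (b xi l : R) :
  ccvg (fun N => \sum_(n <- zr N) gaussF b (xi - n%:~R) * cis (2 * pi * n%:~R * l))
       (theta a b xi l).
Proof.
pose F (y : R) := theta a b xi y - theta a b xi l.
pose D (y : R) : R[i] := cis (2 * pi * (y - l)) - 1.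
have [L L0 FL] : exists2 L, 0 <= L & forall y, normc (F y) <= L * normc (D y).
  have [L L0 H] := theta_lip b xi (`|l| + 1).
  have c0 := @chord_gt0 R; have p0 := @pi_gt0 R.
  exists (L / (chord R * pi)); first by apply: divr_ge0 => //; apply: mulr_ge0; exact: ltW.
  move=> y; pose m := Num.floor (y - l + 2^-1); pose t := y - l - m%:~R.
  have m1 : m%:~R <= y - l + 2^-1 by exact: ge_floor.
  have m2 : y - l + 2^-1 < m%:~R + 1 by rewrite -intrD1 floorD1_gt.
  have t2 : `|t| <= 2^-1 by rewrite ler_norml /t; apply/andP; split; lra.
  have -> : F y = theta a b xi (l + t) - theta a b xi l.
    rewrite /F -(theta_periodicz a0 b xi (l + t) m); congr (theta _ _ _ _ - _).
    by rewrite /t; ring.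
  have -> : D y = cis (2 * pi * t) - 1.
    rewrite /D -[y - l](subrK (m%:~R)) -/t mulrDr cisD cis2piz mulr1//.
  apply: le_trans (H _ _ _ _) _.
  - by apply: le_trans (ler_normD _ _) _; rewrite lerD2l; lra.
  - by rewrite lerDl.
  have -> : l + t - l = t by ring.
  have key : `|t| * (chord R * pi) <= normc (cis (2 * pi * t) - 1).
    have := @cis_ge_chord R (2 * pi * t); rewrite !normrM (gtr0_norm p0) ger0_norm//.
    move=> /(_ ltac:(nra)) h; apply: le_trans h.
    have := mulr_ge0 (mulr_ge0 (ltW c0) (ltW p0)) (normr_ge0 t); lra.
  set X := normc _ in key *.
  have -> : L / (chord R * pi) * X = L * (X / (chord R * pi)) by ring.
  by rewrite ler_wpM2l// ler_pdivlMr// mulr_gt0.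
pose h (y : measurableTypeR R) := F y * (D y)^-1.
have hD y : h y * D y = F y.
  rewrite /h; have [D0|D0] := eqVneq (D y) 0; last by rewrite mulfVK.
  rewrite D0 mulr0; apply/esym/eqP; rewrite -normc_eq0 eq_le normc_ge0 andbT.
  by have := FL y; rewrite D0 normc0 mulr0.
have hL y : normc (h y) <= L.
  rewrite normcM; have [D0|D0] := eqVneq (D y) 0; first by rewrite D0 invr0 normc0 mulr0.
  by rewrite normcV ler_pdivrMr ?normc_gt0.
have cF : ccontinuous F by apply: ccontD; [exact: ccont_theta|exact: ccont_cst].
have clin c : continuous (fun y : R => 2 * pi * c * (y - l)).
  move=> y; apply: cvgM; first exact: cvg_cst.
  by apply: cvgB; [exact: cvg_id|exact: cvg_cst].
have cD : ccontinuous D.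
  apply: ccontD; last exact: ccont_cst.
  apply: ccont_cis; have := clin 1; by under eq_fun do rewrite mulr1.
have mh : cmeasurable h.
  have mD := ccont_measurable cD.
  have mV : measurable_fun setT (fun y : measurableTypeR R => (normc (D y) ^+ 2) `^ (-1)).
    apply: (measurableT_comp (f := fun x : R => x `^ (-1))); first exact: measurable_powR.
    by apply: measurable_funX; exact: measurable_normc.
  have -> : h = fun y => F y * ((D y)^*%C * ((normc (D y) ^+ 2) `^ (-1))%:C).
    apply/funext => y; rewrite /h; congr (_ * _).
    rewrite powR_inv1 ?sqr_ge0//; have [D0|D0] := eqVneq (D y) 0.
      by rewrite D0 invr0 conjc0 mul0r.
    apply: (mulfI D0); rewrite mulfV// mulrA mulcJ -rmorphM divff//.
    by rewrite expf_neq0// normc_eq0.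
  apply: cmeasurableM; first exact: ccont_measurable.
  apply: cmeasurableM; first exact: cmeasurableJ.
  by split => //=; exact: measurable_cst.
have me n : cmeasurable (e n) by exact: cmeasurable_cis2pi.
have e1 n y : normc (e n y) <= 1 by rewrite normc_cis.
have ih : cintegrable U h by exact: bounded_cintegrable hL.
pose bn n := cint U (fun y => h y * (e n y)^*%C).
have ih2 : U.-integrable setT (fun x => (normc (h x) ^+ 2)%:E).
  apply: (bounded_integrable (M := L ^+ 2)).
    by apply: measurable_funX; exact: measurable_normc.
  by move=> x; rewrite ger0_norm ?sqr_ge0// lerXn2r ?nnegrE ?normc_ge0.
have Bes N : \sum_(n <- zr N) normc (bn n) ^+ 2 <= \int[U]_x (normc (h x) ^+ 2).
  by apply: bessel => //; [exact: uniq_zr|exact: orthonormal_cis].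
pose an n := cis (2 * pi * n%:~R * l) * bn n.
have ihe n : cintegrable U (fun y => h y * (e n y)^*%C).
  apply: (cintegrableMb (M := 1)) => //; first exact: cmeasurableJ.
  by move=> y; rewrite normc_conj.
have step n : gaussF b (xi - n%:~R) * cis (2 * pi * n%:~R * l) -
    theta a b xi l * (n == 0)%:R = an (n - 1) - an n.
  have E : cint U (fun y => F y * (e n y)^*%C) =
      gaussF b (xi - n%:~R) - theta a b xi l * (n == 0)%:R.
    transitivity (cint U (fun y => theta a b (xi - n%:~R) y - theta a b xi l * e (- n) y)).
      apply: eq_cint => y; rewrite mulrBl /e cisJ theta_twist.
      by congr (_ - _ * cis _); rewrite mulrNz; ring.
    have ie : cintegrable U (e (- n)) by apply: (bounded_cintegrable (M := 1)).
    rewrite cintB; [|exact/ccont_integrable/ccont_theta|exact: cintegrableZ].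
    by rewrite cintZ// cint_cis2pi oppr_eq0.
  have E' : cint U (fun y => F y * (e n y)^*%C) = cis (- (2 * pi * l)) * bn (n - 1) - bn n.
    rewrite -cintZ// -cintB//; last exact: cintegrableZ.
    apply: eq_cint => y; rewrite -hD /D mulrBr mulr1 mulrBl; congr (_ - _).
    rewrite /e !cisJ -mulrA -cisD [RHS]mulrCA -cisD; congr (_ * cis _).
    by rewrite intrB; ring.
  have -> : gaussF b (xi - n%:~R) * cis (2 * pi * n%:~R * l) - theta a b xi l * (n == 0)%:R =
      (gaussF b (xi - n%:~R) - theta a b xi l * (n == 0)%:R) * cis (2 * pi * n%:~R * l).
    rewrite mulrBl; congr (_ - _); case: eqVneq => [->|_]; last by rewrite mulr0 mul0r.
    by rewrite mulr0 mul0r cis0 !mulr1.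
  rewrite -E E' mulrBl /an; congr (_ - _); last by rewrite mulrC.
  rewrite mulrAC [RHS]mulrC; rewrite [cis _ * cis _]mulrC -cisD [RHS]mulrC; congr (cis _ * _).
  by rewrite intrB; ring.
have tot N : \sum_(n <- zr N) gaussF b (xi - n%:~R) * cis (2 * pi * n%:~R * l) -
    theta a b xi l = an (- N.+1%:Z) - an N%:Z.
  have d0 : theta a b xi l = \sum_(n <- zr N) theta a b xi l * (n == 0)%:R.
    by rewrite (sum_delta (fun=> theta a b xi l))// ?uniq_zr// mem_zr.
  rewrite d0 -sumrB; under eq_bigr do rewrite step.
  have := telescope_zr (fun k => - an (k - 1)) N.
  have -> : - an (N.+1%:Z - 1) - - an (- N%:Z - 1) = an (- N.+1%:Z) - an N%:Z.
    rewrite opprK addrC; congr (an _ - an _); lia.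
  by move=> <-; apply: eq_bigr => k _; rewrite addrK opprK addrC.
have [_ nb] : True /\ forall n, normc (an n) = normc (bn n) by split => // n; rewrite normcM normc_cis mul1r.
move=> eps ep; have ep2 : 0 < (eps / 2) ^+ 2 by rewrite exprn_gt0// divr_gt0.
have [N0 HN] := bounded_terms_cvg0 (fun k => sqr_ge0 (normc (bn k))) Bes ep2.
have small n : (N0 < `|n|)%N -> normc (an n) <= eps / 2.
  rewrite nb => nN; rewrite -(@ler_pXn2r _ 2)// ?nnegrE ?normc_ge0 ?divr_ge0 ?(ltW ep)//.
  have := HN `|n|.-1; rewrite -ltnS (ltn_predK nN) => /(_ nN).
  have := sqr_ge0 (normc (bn `|n|%N)); have := sqr_ge0 (normc (bn (- `|n|%N%:Z))).
  have [->|->] : n = `|n|%N :> int \/ n = - (`|n|%N)%:Z by lia.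
    by rewrite /= ; lra.
  rewrite abszN /=; lra.
exists N0.+1 => N NN; rewrite tot.
have -> : eps = eps / 2 + eps / 2 by field.
by apply: normc_leD; rewrite ?normcN; apply: small; lia.
Qed.

End poisson_summation.

(** * The Fourier transform of a Gaussian: one-step relations *)

Section gaussian_fourier.
Variable R : realType.
Local Notation U := (uniform_prob (@ltr01 R)).
Variable a : R.
Hypothesis a0 : 0 < a.

Let z (b : R) : R[i] := a +i* b.

Let z0 b : z b != 0.
Proof. by rewrite eq_complex /= negb_and gt_eqF. Qed.

Let normz b : a <= normc (z b).
Proof. by apply: le_trans (ger_Re (z b)); rewrite /= ler_norm. Qed.

Lemma continuous_shiftX (m : nat) (k : R) : continuous (fun y : R => (y + k) ^+ m).
Proof.
move=> y; apply: (continuous_comp (f := fun y => y + k) (g := fun x => x ^+ m)).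
  by apply: continuousD => //; exact: cst_continuous.
exact: exprn_continuous.
Qed.

(** The weighted partial sums. The first three powers of [u] enter through the
    second order Taylor expansions in the parameters. *)
Definition momentN (m : nat) (b xi : R) (N : nat) : R[i] :=
  cint U (fun y => \sum_(k <- zr N) gauss a b xi (y + k%:~R) * ((y + k%:~R) ^+ m)%:C).

Lemma ccont_moment (m : nat) (b xi k : R) :
  ccontinuous (fun y => gauss a b xi (y + k) * ((y + k) ^+ m)%:C).
Proof.
apply: ccontM; first exact: ccont_gauss.
apply: ccont_real; exact: continuous_shiftX.
Qed.

Lemma momentN0 (b xi : R) (N : nat) : momentN 0 b xi N = gaussFN a b xi N.
Proof. by apply: eq_cint => y; apply: eq_bigr => k _; rewrite expr0 mulr1. Qed.

Lemma gauss'E (b xi u : R) : gauss' a b xi u =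
  (- (2 * pi)%:C * z b * u%:C + (0 +i* (2 * pi * xi))) * gauss a b xi u.
Proof.
rewrite /gauss'; congr (_ * _).
by apply: complexP => /=; move: (@pi R) => p; ring.
Qed.

Lemma cint_sum_gauss' (m : nat) (b xi : R) (N : nat) :
  cint U (fun y => \sum_(k <- zr N) gauss' a b xi (y + k%:~R) * ((y + k%:~R) ^+ m)%:C) =
  - (2 * pi)%:C * z b * momentN m.+1 b xi N + (0 +i* (2 * pi * xi)) * momentN m b xi N.
Proof.
rewrite -!cintZ; try by apply: ccont_integrable; apply: ccont_sum => k; exact: ccont_moment.
rewrite -cintD; try by apply/cintegrableZ/ccont_integrable; apply: ccont_sum => k; exact: ccont_moment.
apply: eq_cint => y; rewrite !mulr_sumr -big_split /=; apply: eq_bigr => k _.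
by rewrite gauss'E exprS rmorphM /=; ring.
Qed.

Lemma momentN_by_parts0 (b xi : R) (N : nat) :
  - (2 * pi)%:C * z b * momentN 1 b xi N + (0 +i* (2 * pi * xi)) * momentN 0 b xi N =
  gauss a b xi (0 + N.+1%:Z%:~R) - gauss a b xi (0 + (- N%:Z)%:~R).
Proof.
rewrite -(cint_sum_gauss' 0) -(telescope_zr (fun k => gauss a b xi (0 + k%:~R))).
have cg k : ccontinuous (fun y => gauss' a b xi (y + k%:~R)).
  have -> : (fun y => gauss' a b xi (y + k%:~R)) = fun y =>
    (- (2 * pi)%:C * z b) * (gauss a b xi (y + k%:~R) * ((y + k%:~R) ^+ 1)%:C) +
    (0 +i* (2 * pi * xi)) * (gauss a b xi (y + k%:~R) * ((y + k%:~R) ^+ 0)%:C).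
    by apply/funext => y; rewrite gauss'E expr0 expr1; ring.
  by apply: ccontD; apply: ccontM; (try exact: ccont_cst); exact: ccont_moment.
transitivity (cint U (fun y => \sum_(k <- zr N) gauss' a b xi (y + k%:~R))).
  by apply: eq_cint => y; apply: eq_bigr => k _; rewrite expr0 mulr1.
rewrite cint_sum; last by move=> k; exact: ccont_integrable.
apply: eq_bigr => k _; rewrite (cint_FTC (cg k) (gauss_cderive a b xi k%:~R)).
by congr (gauss _ _ _ _ - _); rewrite add0r intrD addrC.
Qed.

Lemma momentN_by_parts1 (b : R) (N : nat) :
  momentN 0 b 0 N - (2 * pi)%:C * z b * momentN 2 b 0 N =
  gauss a b 0 (0 + N.+1%:Z%:~R) * (0 + N.+1%:Z%:~R)%:C -
  gauss a b 0 (0 + (- N%:Z)%:~R) * (0 + (- N%:Z)%:~R)%:C.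
Proof.
rewrite -(telescope_zr (fun k => gauss a b 0 (0 + k%:~R) * (0 + k%:~R)%:C)).
pose f (k : int) (y : R) := gauss a b 0 (y + k%:~R) * (y + k%:~R)%:C.
pose f' (k : int) (y : R) := gauss a b 0 (y + k%:~R) * ((y + k%:~R) ^+ 0)%:C +
  (- (2 * pi)%:C * z b) * (gauss a b 0 (y + k%:~R) * ((y + k%:~R) ^+ 2)%:C).
have df k : cderive (f k) (f' k).
  move=> y; have [d1 d2] := gauss_cderive a b 0 k%:~R y.
  have E : f' k y = gauss a b 0 (y + k%:~R) + gauss' a b 0 (y + k%:~R) * (y + k%:~R)%:C.
    rewrite gauss'E /f' mulr0 expr0.
    have -> : (0 +i* 0) = 0 :> R[i] by [].
    by rewrite expr2 rmorphM /=; ring.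
  rewrite E; split.
  - have -> : (fun y => complex.Re (f k y)) =
        fun y => complex.Re (gauss a b 0 (y + k%:~R)) * (y + k%:~R).
      by apply/funext => t; rewrite cReM (_ : complex.Im (t + k%:~R)%:C = 0)// mulr0 subr0.
    by apply: is_derive_eq; rewrite cReD cReM /GRing.scale /=; ring.
  - have -> : (fun y => complex.Im (f k y)) =
        fun y => complex.Im (gauss a b 0 (y + k%:~R)) * (y + k%:~R).
      by apply/funext => t; rewrite cImM (_ : complex.Im (t + k%:~R)%:C = 0)// mulr0 add0r.
    by apply: is_derive_eq; rewrite cImD cImM /GRing.scale /=; ring.
have cf' k : ccontinuous (f' k).
  by apply: ccontD; [exact: ccont_moment|apply: ccontM; [exact: ccont_cst|exact: ccont_moment]].
transitivity (cint U (fun y => \sum_(k <- zr N) f' k y)).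
  have -> : momentN 0 b 0 N - (2 * pi)%:C * z b * momentN 2 b 0 N =
    momentN 0 b 0 N + (- (2 * pi)%:C * z b) * momentN 2 b 0 N by ring.
  rewrite /momentN -cintZ; last first.
    by apply: ccont_integrable; apply: ccont_sum => k; exact: ccont_moment.
  rewrite -cintD; try by apply/ccont_integrable; apply: ccont_sum => k; exact: ccont_moment.
    by apply: eq_cint => y; rewrite mulr_sumr -big_split.
  by apply/cintegrableZ/ccont_integrable; apply: ccont_sum => k; exact: ccont_moment.
rewrite cint_sum; last by move=> k; exact: ccont_integrable.
apply: eq_bigr => k _; rewrite (cint_FTC (cf' k) (df k)) /f.
by rewrite (_ : 0 + (k + 1)%:~R = 1 + k%:~R)// add0r intrD addrC.
Qed.

Lemma gaussF_step_freq (b : R) : exists C, forall xi h : R,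
  normc (gaussF a b (xi + h) - gaussF a b xi * (1 - (2 * pi * xi * h)%:C / z b)) <= C * h ^+ 2.
Proof.
exists (8 * (8 * pi ^+ 2 * shift_const a 1)) => xi h.
pose r N := gauss a b xi (0 + N.+1%:Z%:~R) - gauss a b xi (0 + (- N%:Z)%:~R).
have rc : ccvg r 0 by apply: ccvg_bound => N; rewrite subr0; exact: gauss_ends1.
pose w := (1 - (2 * pi * xi * h)%:C / z b).
have lim : ccvg (fun N => gaussFN a b (xi + h) N + ((- w) * gaussFN a b xi N + (0 +i* h) / z b * r N))
    (gaussF a b (xi + h) - gaussF a b xi * w).
  have -> : gaussF a b (xi + h) - gaussF a b xi * w =
     gaussF a b (xi + h) + ((- w) * gaussF a b xi + (0 +i* h) / z b * 0) by ring.
  by apply: ccvgD; [exact: gaussFN_cvg|apply: ccvgD; apply: ccvgZ => //; exact: gaussFN_cvg].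
apply: ccvg_le lim _ => N.
have p0 : (2 * pi : R) != 0 by rewrite mulf_neq0// gt_eqF// pi_gt0.
have -> : gaussFN a b (xi + h) N + ((- w) * gaussFN a b xi N + (0 +i* h) / z b * r N) =
    gaussFN a b (xi + h) N - (momentN 0 b xi N + (0 +i* (2 * pi * h)) * momentN 1 b xi N).
  rewrite /r -momentN_by_parts0 momentN0 /w.
  have -> : (2 * pi * xi * h)%:C = - ((0 +i* h) * (0 +i* (2 * pi * xi))) :> R[i].
    by apply: complexP => /=; ring.
  have -> : (0 +i* (2 * pi * h)) = (0 +i* h) * (2 * pi)%:C :> R[i].
    by apply: complexP => /=; ring.
  move: (z0 b) (gaussFN _ _ _ _) (gaussFN _ _ _ _) (momentN _ _ _ _).
  move: (z b) (0 +i* h) (0 +i* _) ((2 * pi)%:C) => u t q p u0 A B M.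
  by field.
have -> : gaussFN a b (xi + h) N - (momentN 0 b xi N + (0 +i* (2 * pi * h)) * momentN 1 b xi N) =
    cint U (fun y => \sum_(k <- zr N) gauss a b xi (y + k%:~R) *
      (cis (2 * pi * h * (y + k%:~R)) - 1 - (0 +i* (2 * pi * h * (y + k%:~R))))).
  rewrite -cintZ; last by apply: ccont_integrable; apply: ccont_sum => k; exact: ccont_moment.
  rewrite -cintD; [|by apply/ccont_integrable; apply: ccont_sum => k; exact: ccont_moment|
    by apply/cintegrableZ/ccont_integrable; apply: ccont_sum => k; exact: ccont_moment].
  rewrite -cintB; [|by apply/ccont_integrable; apply: ccont_sum => k; exact: ccont_gauss|
    by apply: cintegrableD; [|apply/cintegrableZ];
       apply/ccont_integrable; apply: ccont_sum => k; exact: ccont_moment].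
  apply: eq_cint => y; rewrite mulr_sumr -big_split /= -sumrB; apply: eq_bigr => k _.
  rewrite gauss_shift_freq expr0 expr1; set u := y + _.
  have -> : (0 +i* (2 * pi * h * u)) = (0 +i* (2 * pi * h)) * u%:C :> R[i].
    by apply: complexP => /=; ring.
  by rewrite mulr1; ring.
apply: cint_uniform_le.
  apply: ccont_sum => k; apply: ccontM; first exact: ccont_gauss.
  have cl : continuous (fun y : R => 2 * pi * h * (y + k%:~R)).
    move=> y; apply: cvgM; first exact: cvg_cst.
    by apply: cvgD; [exact: cvg_id|exact: cvg_cst].
  under eq_fun do rewrite -addrA.
  apply: ccontD; first exact: ccont_cis.
  under eq_fun do rewrite -opprD -mulN1r.
  apply: ccontM; first exact: ccont_cst.
  apply: ccontD; first exact: ccont_cst.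
  by split => //= y; exact: cst_continuous.
move=> y y0 y1; apply: le_trans (normc_sum _ _ _) _.
have y1' : `|y| <= 1 by rewrite ger0_norm.
rewrite -[leRHS]mulrA; apply: sum_zr_le => [k|]; last first.
  by rewrite mulr_ge0 ?sqr_ge0// mulr_ge0 ?shift_const_ge0// mulr_ge0 ?sqr_ge0.
set u := y + _; rewrite normcM.
apply: le_trans (ler_wpM2l (normc_ge0 _) (cis_taylor _)) _.
have u2 : u ^+ 2 <= (1 + u ^+ 2) ^+ 2 by have := sqr_ge0 u; nra.
have hh := gauss_shift_w a0 b xi (k := k) y1' (sqr_ge0 _) u2.
have -> : normc (gauss a b xi u) * (2 * (2 * pi * h * u) ^+ 2) =
   8 * pi ^+ 2 * h ^+ 2 * (normc (gauss a b xi u) * u ^+ 2) by ring.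
have -> : 8 * pi ^+ 2 * shift_const a 1 * h ^+ 2 / (1 + k%:~R ^+ 2) =
   8 * pi ^+ 2 * h ^+ 2 * (shift_const a 1 / (1 + k%:~R ^+ 2)) by ring.
by rewrite ler_wpM2l// mulr_ge0 ?sqr_ge0// mulr_ge0 ?sqr_ge0.
Qed.

Lemma gaussF_step_im : exists C, forall b h : R,
  normc (gaussF a (b + h) 0 - gaussF a b 0 * (1 - (0 +i* (h / 2)) / z b)) <= C * h ^+ 2.
Proof.
exists (8 * (2 * pi ^+ 2 * shift_const a 1)) => b h.
pose r N := gauss a b 0 (0 + N.+1%:Z%:~R) * (0 + N.+1%:Z%:~R)%:C -
  gauss a b 0 (0 + (- N%:Z)%:~R) * (0 + (- N%:Z)%:~R)%:C.
have rc : ccvg r 0.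
  apply: ccvg_bound => N; rewrite subr0; apply: (gauss_ends a0 b 0 0 (w := id)) => // u.
  by rewrite -[u ^+ 2]real_normK ?num_real//; have := normr_ge0 u; move: `|u| => v; nra.
pose w := (1 - (0 +i* (h / 2)) / z b).
have lim : ccvg (fun N => gaussFN a (b + h) 0 N + ((- w) * gaussFN a b 0 N + (- (0 +i* (h / 2)) / z b) * r N))
    (gaussF a (b + h) 0 - gaussF a b 0 * w).
  have -> : gaussF a (b + h) 0 - gaussF a b 0 * w =
     gaussF a (b + h) 0 + ((- w) * gaussF a b 0 + (- (0 +i* (h / 2)) / z b) * 0) by ring.
  by apply: ccvgD; [exact: gaussFN_cvg|apply: ccvgD; apply: ccvgZ => //; exact: gaussFN_cvg].
apply: ccvg_le lim _ => N.
have -> : gaussFN a (b + h) 0 N + ((- w) * gaussFN a b 0 N + (- (0 +i* (h / 2)) / z b) * r N) =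
    gaussFN a (b + h) 0 N - (momentN 0 b 0 N + (0 +i* (- (pi * h))) * momentN 2 b 0 N).
  rewrite /r -momentN_by_parts1 momentN0 /w.
  have -> : (0 +i* (- (pi * h))) = - ((0 +i* (h / 2)) * (2 * pi)%:C) :> R[i].
    by apply: complexP => /=; field.
  move: (z0 b) (gaussFN _ _ _ _) (gaussFN _ _ _ _) (momentN _ _ _ _).
  move: (z b) (0 +i* _) ((2 * pi)%:C) => u t p u0 A B M.
  by field.
have -> : gaussFN a (b + h) 0 N - (momentN 0 b 0 N + (0 +i* (- (pi * h))) * momentN 2 b 0 N) =
    cint U (fun y => \sum_(k <- zr N) gauss a b 0 (y + k%:~R) *
      (cis (- (pi * h) * (y + k%:~R) ^+ 2) - 1 - (0 +i* (- (pi * h) * (y + k%:~R) ^+ 2)))).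
  rewrite -cintZ; last by apply: ccont_integrable; apply: ccont_sum => k; exact: ccont_moment.
  rewrite -cintD; [|by apply/ccont_integrable; apply: ccont_sum => k; exact: ccont_moment|
    by apply/cintegrableZ/ccont_integrable; apply: ccont_sum => k; exact: ccont_moment].
  rewrite -cintB; [|by apply/ccont_integrable; apply: ccont_sum => k; exact: ccont_gauss|
    by apply: cintegrableD; [|apply/cintegrableZ];
       apply/ccont_integrable; apply: ccont_sum => k; exact: ccont_moment].
  apply: eq_cint => y; rewrite mulr_sumr -big_split /= -sumrB; apply: eq_bigr => k _.
  rewrite expr0; set u := y + _.
  have -> : gauss a (b + h) 0 u = gauss a b 0 u * cis (- (pi * h) * u ^+ 2).
    by rewrite !gauss_cis -[RHS]mulrA -cisD; congr (_ * cis _); ring.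
  have -> : (0 +i* (- (pi * h) * u ^+ 2)) = (0 +i* (- (pi * h))) * (u ^+ 2)%:C :> R[i].
    by apply: complexP => /=; ring.
  by rewrite mulr1; ring.
apply: cint_uniform_le.
  apply: ccont_sum => k; apply: ccontM; first exact: ccont_gauss.
  have cl : continuous (fun y : R => - (pi * h) * (y + k%:~R) ^+ 2).
    by move=> y; apply: cvgM; [exact: cvg_cst|exact: continuous_shiftX].
  under eq_fun do rewrite -addrA.
  apply: ccontD; first exact: ccont_cis.
  under eq_fun do rewrite -opprD -mulN1r.
  apply: ccontM; first exact: ccont_cst.
  apply: ccontD; first exact: ccont_cst.
  by split => //= y; exact: cst_continuous.
move=> y y0 y1; apply: le_trans (normc_sum _ _ _) _.
have y1' : `|y| <= 1 by rewrite ger0_norm.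
rewrite -[leRHS]mulrA; apply: sum_zr_le => [k|]; last first.
  by rewrite mulr_ge0 ?sqr_ge0// mulr_ge0 ?shift_const_ge0// mulr_ge0 ?sqr_ge0.
set u := y + _; rewrite normcM.
apply: le_trans (ler_wpM2l (normc_ge0 _) (cis_taylor _)) _.
have u4 : u ^+ 4 <= (1 + u ^+ 2) ^+ 2.
  have -> : u ^+ 4 = (u ^+ 2) ^+ 2 by ring.
  by have := sqr_ge0 u; nra.
have hh := gauss_shift_w a0 b 0 (k := k) y1' (exprn_even_ge0 _ (erefl : ~~ odd 4)) u4.
have -> : normc (gauss a b 0 u) * (2 * (- (pi * h) * u ^+ 2) ^+ 2) =
   2 * pi ^+ 2 * h ^+ 2 * (normc (gauss a b 0 u) * u ^+ 4) by ring.
have -> : 2 * pi ^+ 2 * shift_const a 1 * h ^+ 2 / (1 + k%:~R ^+ 2) =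
   2 * pi ^+ 2 * h ^+ 2 * (shift_const a 1 / (1 + k%:~R ^+ 2)) by ring.
by rewrite ler_wpM2l// mulr_ge0 ?sqr_ge0// mulr_ge0 ?sqr_ge0.
Qed.

End gaussian_fourier.

(** * The Fourier transform of a Gaussian: closed form *)

Opaque gaussF theta.

Section gaussian_fourier_formula.
Variable R : realType.
Local Notation U := (uniform_prob (@ltr01 R)).
Variable a : R.
Hypothesis a0 : 0 < a.

Let z (b : R) : R[i] := a +i* b.

Let z0 b : z b != 0.
Proof. by rewrite eq_complex /= negb_and gt_eqF. Qed.

Let normz b : a <= normc (z b).
Proof. by apply: le_trans (ger_Re (z b)); rewrite /= ler_norm. Qed.

Let normz_gt0 b : 0 < normc (z b).
Proof. exact: lt_le_trans (normz b). Qed.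

Lemma theta_le (b xi y : R) :
  normc (theta a b xi y) <= 4 * (1 + (Num.sqrt a)^-1).
Proof.
have s0 : 0 < Num.sqrt a by rewrite sqrtr_gt0.
apply: ccvg_le (theta_cvg a0 b xi y) _ => N.
apply: le_trans (normc_sum _ _ _) _.
apply: le_trans (sum_lorentz (- y) N (_ : 0 < (Num.sqrt a)^-1)); last by rewrite invr_gt0.
apply: ler_sum => k _; rewrite normc_gauss.
have x0 : 0 <= pi * a * (y + k%:~R) ^+ 2.
  exact: mulr_ge0 (mulr_ge0 (pi_ge0 R) (ltW a0)) (sqr_ge0 _).
apply: le_trans (expRN_le x0) _.
rewrite lef_pV2 ?posrE; last 2 first.
- by rewrite ltr_pwDl.
- by rewrite ltr_pwDl// sqr_ge0.
rewrite lerD2l invrK exprMn sqr_sqrtr ?(ltW a0)//.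
have -> : (- y - k%:~R) ^+ 2 * a = a * (y + k%:~R) ^+ 2 by ring.
rewrite -[leRHS]mulrA; apply: ler_peMl; first exact: mulr_ge0 (ltW a0) (sqr_ge0 _).
by have := @pi_ge2 R; move: (@pi R) => p; lra.
Qed.

Lemma gaussF_le (b xi : R) : normc (gaussF a b xi) <= 4 * (1 + (Num.sqrt a)^-1).
Proof. by apply: cint_uniform_le => [|y _ _]; [exact: ccont_theta|exact: theta_le]. Qed.

Lemma normc_imag (x : R) : normc (0 +i* x) = `|x|.
Proof. by rewrite normc_sqrtE /= expr0n add0r sqrtr_sqr. Qed.

Lemma normc_divz (x b : R) : normc (x%:C / z b) <= `|x| / a.
Proof.
by rewrite normcM normcR normcV ler_wpM2l// lef_pV2 ?posrE.
Qed.

Lemma gaussF_formula (b xi : R) :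
  gaussF a b xi = gaussF a b 0 * cexp (- (pi * xi ^+ 2)%:C / z b).
Proof.
pose Phi s := gaussF a b s * cexp ((pi * s ^+ 2)%:C / z b).
suff E : Phi xi = Phi 0.
  have -> : gaussF a b 0 = Phi xi by rewrite E /Phi expr0n mulr0 mul0r cexp0 mulr1.
  by rewrite /Phi -mulrA -cexpD mulNr subrr cexp0 mulr1.
have p0 := @pi_gt0 R.
suff H A B : A <= B -> Phi B = Phi A.
  by have [x0|/ltW x0] := leP 0 xi; [exact: H|rewrite (H _ _ x0)].
move=> AB; have [C HC] := gaussF_step_freq a0 b.
pose S := `|A| + `|B|; pose c := (2 * pi * S + pi) / a.
pose K : R := 4 * (1 + (Num.sqrt a)^-1); pose E0 := expR (pi * S ^+ 2 / a).
pose D := E0 * (`|C| * expR c + K * (pi / a + c ^+ 2 + (1 + c) * (5 * c ^+ 2 * expR c))).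
have S0 : 0 <= S by rewrite addr_ge0.
have c0 : 0 <= c.
  by rewrite divr_ge0 ?(ltW a0)// addr_ge0 ?mulr_ge0 ?(ltW p0).
apply: (quadratic_step_const (C := D) AB) => s h As h0 h1 sB.
have sS : `|s| <= S.
  rewrite ler_norml /S; have := ler_norm B; have := lerNnormlW (lexx `|A|).
  by move=> *; apply/andP; split; have := normr_ge0 A; have := normr_ge0 B; lra.
pose w := (2 * pi * s * h)%:C / z b; pose v := (2 * pi * s * h + pi * h ^+ 2)%:C / z b.
have nw : normc w <= c * h.
  apply: le_trans (normc_divz _ _) _; rewrite /c [leRHS]mulrAC ler_wpM2r ?invr_ge0 ?(ltW a0)//.
  rewrite !normrM (ger0_norm h0) (gtr0_norm p0) ger0_norm//.
  have := ler_wpM2l (mulr_ge0 (ltW p0) h0) sS; have := mulr_ge0 (ltW p0) h0; lra.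
have nv : normc v <= c * h.
  apply: le_trans (normc_divz _ _) _; rewrite /c [leRHS]mulrAC ler_wpM2r ?invr_ge0 ?(ltW a0)//.
  apply: le_trans (ler_normD _ _) _.
  rewrite !normrM (ger0_norm h0) (gtr0_norm p0) ger0_norm//.
  have := ler_wpM2l (mulr_ge0 (ltW p0) h0) sS; have := ler_wpM2l (mulr_ge0 (ltW p0) h0) h1; lra.
have nvc : normc v <= c by apply: le_trans nv _; rewrite ler_piMr.
pose e1 := gaussF a b (s + h) - gaussF a b s * (1 - w).
pose e2 := cexp v - 1 - v.
have ne1 : normc e1 <= `|C| * h ^+ 2.
  by apply: le_trans (HC s h) _; rewrite ler_wpM2r ?sqr_ge0// ler_norm.
have ne2 : normc e2 <= 5 * c ^+ 2 * expR c * h ^+ 2.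
  apply: le_trans (cexp_taylor v) _.
  have -> : 5 * c ^+ 2 * expR c * h ^+ 2 = 5 * (c * h) ^+ 2 * expR c by ring.
  apply: ler_pM; [by rewrite mulr_ge0 ?sqr_ge0|exact: expR_ge0| |by rewrite ler_expR].
  by rewrite ler_wpM2l// lerXn2r ?nnegrE ?normc_ge0// mulr_ge0.
have -> : Phi (s + h) - Phi s = cexp ((pi * s ^+ 2)%:C / z b) *
   (e1 * cexp v + gaussF a b s * ((pi * h ^+ 2)%:C / z b - w * v + (1 - w) * e2)).
  have -> : Phi (s + h) = (e1 + gaussF a b s * (1 - w)) * (cexp ((pi * s ^+ 2)%:C / z b) * cexp v).
    rewrite /Phi /e1 subrK -cexpD; congr (_ * cexp _); rewrite /v -mulrDl -rmorphD.
    by congr (_%:C / _); ring.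
  have -> : (pi * h ^+ 2)%:C / z b = v - w.
    by rewrite /v /w -mulrBl -rmorphB; congr (_%:C / _); ring.
  by rewrite /Phi /e2; ring.
rewrite normcM /D -[leRHS]mulrA; apply: ler_pM; rewrite ?normc_ge0//.
  rewrite normc_cexp ler_expR; apply: le_trans (ler_norm _) _; apply: le_trans (ger_Re _) _.
  apply: le_trans (normc_divz _ _) _; rewrite ler_wpM2r ?invr_ge0 ?(ltW a0)//.
  rewrite normrM normrX (gtr0_norm p0) ler_wpM2l ?(ltW p0)//.
  by rewrite lerXn2r ?nnegrE.
rewrite [leRHS]mulrDl; apply: normc_leD.
  rewrite normcM -[leRHS]mulrAC; apply: ler_pM; rewrite ?normc_ge0//.
  rewrite normc_cexp ler_expR; apply: le_trans (ler_norm _) _.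
  exact: le_trans (ger_Re _) nvc.
rewrite normcM -[leRHS]mulrA; apply: ler_pM; rewrite ?normc_ge0 ?gaussF_le//.
rewrite [leRHS]mulrDl [X in _ <= X + _]mulrDl; apply: normc_leD; first apply: normc_leD.
- apply: le_trans (normc_divz _ _) _.
  by rewrite normrM normrX (gtr0_norm p0) (ger0_norm h0) mulrAC.
- by rewrite normcN normcM -exprMn expr2; apply: ler_pM; rewrite ?normc_ge0.
- rewrite normcM -[leRHS]mulrA; apply: ler_pM; rewrite ?normc_ge0//.
  apply: le_trans (le_normcD _ _) _; rewrite normcN normc1 lerD2l.
  by apply: le_trans nw _; rewrite ler_piMr.
Qed.

Lemma gaussF_sqr (b : R) : gaussF a b 0 ^+ 2 * z b = gaussF a 0 0 ^+ 2 * a%:C.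
Proof.
pose Psi s := gaussF a s 0 ^+ 2 * z s.
suff H A B : A <= B -> Psi B = Psi A.
  have E : Psi b = Psi 0.
    by have [x0|/ltW x0] := leP 0 b; [exact: H|rewrite (H _ _ x0)].
  exact: E.
move=> AB; have [C HC] := gaussF_step_im a0.
pose S := a + `|A| + `|B| + 1; pose K : R := 4 * (1 + (Num.sqrt a)^-1).
have s0 : 0 < Num.sqrt a by rewrite sqrtr_gt0.
have K0 : 0 <= K by rewrite mulr_ge0// addr_ge0// invr_ge0 ltW.
have S0 : 0 <= S by rewrite !addr_ge0// ltW.
pose q0 := (2 * a)^-1.
have q00 : 0 <= q0 by rewrite invr_ge0 mulr_ge0// ltW.
pose D := K ^+ 2 * S * (3 * q0 ^+ 2 + 2 * q0 ^+ 3) +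
  (2 * K * (1 + q0) * `|C| + `|C| ^+ 2) * S.
apply: (quadratic_step_const (C := D) AB) => s h As h0 h1 sB.
have nz t : A <= t -> t <= B -> normc (z t) <= S.
  move=> At tB; apply: le_trans (normc_ReIm _) _; rewrite /= (gtr0_norm a0) /S -!addrA lerD2l.
  rewrite ler_norml; have := ler_norm B; have := lerNnormlW (lexx `|A|).
  by move=> *; apply/andP; split; have := normr_ge0 A; have := normr_ge0 B; lra.
pose q := (0 +i* (h / 2)) / z s.
have nq : normc q <= q0 * h.
  rewrite normcM normcV normc_imag ger0_norm ?divr_ge0//.
  have -> : q0 * h = h / 2 * a^-1 by rewrite /q0 invfM; ring.
  by rewrite ler_wpM2l ?divr_ge0// lef_pV2 ?posrE.
have nq1 : normc q <= q0 by apply: le_trans nq _; rewrite ler_piMr.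
pose e1 := gaussF a (s + h) 0 - gaussF a s 0 * (1 - q).
have ne1 : normc e1 <= `|C| * h ^+ 2.
  by apply: le_trans (HC s h) _; rewrite ler_wpM2r ?sqr_ge0// ler_norm.
have h2 : h ^+ 2 <= 1 by rewrite expr_le1.
have ne1' : normc e1 <= `|C| by apply: le_trans ne1 _; rewrite ler_piMr.
have zE : z (s + h) = z s + 2 * q * z s.
  rewrite /q -mulrA mulfVK// mulr_natl mulr2n.
  by apply: complexP; rewrite /z !(cReD, cImD) /=; field.
have -> : Psi (s + h) - Psi s = gaussF a s 0 ^+ 2 * z s * (- 3 * q ^+ 2 + 2 * q ^+ 3) +
   (2 * gaussF a s 0 * (1 - q) * e1 + e1 ^+ 2) * z (s + h).
  have -> : Psi (s + h) = (e1 + gaussF a s 0 * (1 - q)) ^+ 2 * z (s + h).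
    by rewrite /Psi /e1 subrK.
  by rewrite /Psi zE; ring.
have nG : normc (gaussF a s 0) <= K by exact: gaussF_le.
have n2 : normc (2 : R[i]) = 2 by rewrite -(rmorph_nat (real_complex R) 2) normcR ger0_norm.
have n3 : normc (3 : R[i]) = 3 by rewrite -(rmorph_nat (real_complex R) 3) normcR ger0_norm.
rewrite /D [leRHS]mulrDl; apply: normc_leD.
  rewrite normcM -[leRHS]mulrA; apply: ler_pM; rewrite ?normc_ge0//.
    rewrite normcM normcX; apply: ler_pM; rewrite ?exprn_ge0 ?normc_ge0//.
      by rewrite lerXn2r ?nnegrE ?normc_ge0.
    by apply: nz => //; lra.
  rewrite [leRHS]mulrDl; apply: normc_leD.
    rewrite normcM normcN n3 normcX -mulrA ler_wpM2l// -exprMn.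
    by rewrite lerXn2r ?nnegrE ?normc_ge0// mulr_ge0.
  have -> : 2 * q0 ^+ 3 * h ^+ 2 = 2 * ((q0 * h) ^+ 2 * q0) by ring.
  rewrite normcM n2 normcX ler_wpM2l// [leLHS]exprSr.
  apply: ler_pM; rewrite ?sqr_ge0 ?normc_ge0//.
  by rewrite lerXn2r ?nnegrE ?normc_ge0// mulr_ge0.
rewrite normcM [leRHS]mulrAC; apply: ler_pM; rewrite ?normc_ge0//; last first.
  by apply: nz => //; lra.
rewrite [leRHS]mulrDl; apply: normc_leD.
  rewrite 3!normcM n2 -[leRHS]mulrA; apply: ler_pM; rewrite ?mulr_ge0 ?normc_ge0//.
  apply: ler_pM; rewrite ?mulr_ge0 ?normc_ge0//.
    by rewrite ler_wpM2l.
  by apply: le_trans (le_normcD _ _) _; rewrite normcN normc1 lerD2l.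
rewrite normcX expr2 [`|C| ^+ 2]expr2 -mulrA; apply: ler_pM; rewrite ?normc_ge0//.
Qed.

Let normc_sqr_eq (g g0 w : R[i]) : g ^+ 2 * w = g0 ^+ 2 * a%:C ->
  normc g * Num.sqrt (normc w) = normc g0 * Num.sqrt a.
Proof.
move=> E; apply/eqP; rewrite -(@eqrXn2 _ 2)// ?mulr_ge0 ?sqrtr_ge0 ?normc_ge0//.
rewrite [X in X == _]exprMn [X in _ == X]exprMn (sqr_sqrtr (normc_ge0 w)) (sqr_sqrtr (ltW a0)).
by rewrite -!normcX -normcM E normcM normcR (gtr0_norm a0).
Qed.

Lemma gaussF0_le (b : R) : normc (gaussF a b 0) * Num.sqrt (normc (z b)) <= 4 * (1 + Num.sqrt a).
Proof.
have s0 : 0 < Num.sqrt a by rewrite sqrtr_gt0.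
rewrite (normc_sqr_eq (gaussF_sqr b)); apply: le_trans (ler_wpM2r (ltW s0) (gaussF_le _ _)) _.
by rewrite -mulrA ler_wpM2l// mulrDl mul1r mulVf ?gt_eqF// addrC.
Qed.

Let step_split (g g' q : R[i]) : g' - g = - (g * q) + (g' - g * (1 - q)).
Proof. by ring. Qed.

Lemma gaussF0_lip (be b b' : R) : 0 < be -> be <= b -> b <= b' ->
  normc (gaussF a b' 0 - gaussF a b 0) <=
  2 * (1 + Num.sqrt a) / (Num.sqrt be * be) * (b' - b).
Proof.
move=> be0 beb bb'; have [C HC] := gaussF_step_im a0.
apply: (quadratic_step_lip (Phi := fun b => gaussF a b 0) (C := C) bb') => s h bs h0 h1 sb.
rewrite (step_split _ _ ((0 +i* (h / 2)) / z s)).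
apply: normc_leD; last exact: HC.
have nz : be <= normc (z s).
  apply: le_trans (ger_Im (z s)); apply: le_trans (ler_norm _); rewrite /=; lra.
have sbe : 0 < Num.sqrt be by rewrite sqrtr_gt0.
have k1 : normc (gaussF a s 0) <= 4 * (1 + Num.sqrt a) / Num.sqrt be.
  rewrite ler_pdivlMr//; apply: le_trans (gaussF0_le s).
  by apply: ler_wpM2l; [exact: normc_ge0|exact: ler_wsqrtr].
have -> : 2 * (1 + Num.sqrt a) / (Num.sqrt be * be) * h =
   4 * (1 + Num.sqrt a) / Num.sqrt be * (h / 2 * be^-1).
  move: (Num.sqrt be) sbe (Num.sqrt a) => u u0 v; field.
  by rewrite (gt_eqF u0) (gt_eqF be0).
rewrite normcN normcM; apply: ler_pM; [exact: normc_ge0|exact: normc_ge0|exact: k1|].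
rewrite normcM normcV normc_imag ger0_norm; last by rewrite divr_ge0.
apply: ler_wpM2l; first by rewrite divr_ge0.
by rewrite lef_pV2 ?posrE//; exact: lt_le_trans nz.
Qed.

End gaussian_fourier_formula.

(** * Kernels on the lattice *)

Section lattice_kernel.
Variable R : realType.

Definition dot (l : seq R) (k : seq int) : R := \sum_(p <- zip l k) p.1 * p.2%:~R.

(** A positive definite form in triangular coordinates: the entry [(q, l)]
    stands for the square [q * (k_0 + l . k')^2]. *)
Fixpoint qform (D : seq (R * seq R)) (k : seq int) : R :=
  match D, k with
  | (q, l) :: D', k0 :: k' => q * (dot l k' + k0%:~R) ^+ 2 + qform D' k'
  | _, _ => 0
  end.

Fixpoint triangular (D : seq (R * seq R)) : bool :=
  if D is (q, l) :: D' then [&& 0 < q, size l == size D' & triangular D'] else true.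

Fixpoint box (Ns : seq nat) : seq (seq int) :=
  if Ns is N :: Ns' then [seq k0 :: k' | k0 <- zr N, k' <- box Ns'] else [:: [::]].

Lemma mem_box (Ns : seq nat) (k : seq int) : size k = size Ns ->
  all2 (fun k0 N => (`|k0|%N <= N)%N) k Ns -> k \in box Ns.
Proof.
elim: Ns k => [|N Ns IH] [|k0 k] //= [sk] /andP[k0N kN].
by apply: allpairs_f; [rewrite mem_zr|exact: IH].
Qed.

Lemma size_box (Ns : seq nat) (k : seq int) : k \in box Ns -> size k = size Ns.
Proof.
elim: Ns k => [|N Ns IH] k /=; first by rewrite inE => /eqP ->.
by move=> /allpairsP[[k0 k'] /= [_ /IH <- ->]].
Qed.

Lemma uniq_box (Ns : seq nat) : uniq (box Ns).
Proof.
elim: Ns => //= N Ns IH; apply: allpairs_uniq => //; first exact: uniq_zr.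
by move=> [x y] [x' y'] _ _ /= [-> ->].
Qed.

Lemma dot_cons (t : R) (k0 : int) (x : seq R) (k : seq int) :
  dot (t :: x) (k0 :: k) = t * k0%:~R + dot x k.
Proof. by rewrite /dot /= big_cons. Qed.

Lemma dot_shear (t : R) (x l : seq R) (k : seq int) : size x = size l ->
  dot [seq p.1 - t * p.2 | p <- zip x l] k = dot x k - t * dot l k.
Proof.
elim: x l k => [|x0 x IH] [|l0 l] [|k0 k] //= sxl; try by rewrite /dot /= ?big_nil mulr0 subr0.
by rewrite !dot_cons IH; [ring|case: sxl].
Qed.

Lemma qform_ge0 (D : seq (R * seq R)) (k : seq int) : triangular D -> 0 <= qform D k.
Proof.
elim: D k => [|[q l] D IH] [|k0 k] //= /and3P[q0 _ tD].
by rewrite addr_ge0 ?IH// mulr_ge0 ?sqr_ge0// ltW.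
Qed.

Variable a : R.
Hypothesis a0 : 0 < a.

(** [cexp (- pi (a + i b) Q)], the heat-Schroedinger multiplier. *)
Definition chirp (b Q : R) : R[i] := cexp ((- (pi * a * Q)) +i* (- (pi * b * Q))).

Lemma chirp0 (b : R) : chirp b 0 = 1.
Proof. by rewrite /chirp !mulr0 oppr0 cexp0. Qed.

Lemma chirpD (b Q Q' : R) : chirp b (Q + Q') = chirp b Q * chirp b Q'.
Proof. by rewrite -cexpD; congr cexp; apply: complexP => /=; ring. Qed.

Lemma normc_chirp_le1 (b Q : R) : 0 <= Q -> normc (chirp b Q) <= 1.
Proof.
by move=> Q0; rewrite normc_cexp /= expR_le1 oppr_le0 !mulr_ge0 ?pi_ge0// ltW.
Qed.

Lemma chirp_gauss (q b y xi : R) :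
  chirp b (q * y ^+ 2) * cis (2 * pi * xi * y) = gauss (q * a) (q * b) xi y.
Proof.
rewrite /chirp /cexp /= gauss_cis -mulrA -cisD; congr (_%:C * cis _).
  by congr expR; ring.
by ring.
Qed.

Fixpoint gaussF_prod (D : seq (R * seq R)) (b : R) (xi : seq R) : R[i] :=
  match D, xi with
  | (q, _) :: D', x :: xi' => gaussF (q * a) (q * b) x * gaussF_prod D' b xi'
  | _, _ => 1
  end.

Lemma gaussF_summable (q b : R) : 0 < q -> exists2 C, 0 <= C &
  forall x M, \sum_(n <- zr M) normc (gaussF (q * a) (q * b) (x - n%:~R)) <= C.
Proof.
move=> q0; have qa : 0 < q * a by rewrite mulr_gt0.
set z : R[i] := (q * a) +i* (q * b).
pose K := normc (gaussF (q * a) (q * b) 0).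
have n0 : 0 < normc z.
  by apply: lt_le_trans (ger_Re z); rewrite /= gtr0_norm.
pose V := normc z / Num.sqrt (q * a).
have V0 : 0 < V by rewrite divr_gt0// sqrtr_gt0.
exists (K * (4 * (1 + V))); first by rewrite !mulr_ge0 ?normc_ge0 ?addr_ge0// ltW.
move=> x M; apply: le_trans (ler_wpM2l (normc_ge0 _) (sum_lorentz x M V0)).
rewrite mulr_sumr; apply: ler_sum => n _; set y := x - _.
rewrite gaussF_formula// normcM ler_wpM2l ?normc_ge0// normc_cexp.
have -> : complex.Re (- (pi * y ^+ 2)%:C / z) = - (pi * ((y / V) ^+ 2)).
  have -> : z^-1 = ((normc z ^+ 2)^-1)%:C * z^*%C.
    have zn : z != 0 by rewrite -normc_gt0.
    apply: (mulfI zn); rewrite mulfV// mulrCA mulcJ -rmorphM mulVf//.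
    by rewrite expf_neq0// gt_eqF.
  have -> : (y / V) ^+ 2 = y ^+ 2 * (q * a) / normc z ^+ 2.
    rewrite -[in RHS](sqr_sqrtr (ltW qa)) /V.
    have : 0 < Num.sqrt (q * a) by rewrite sqrtr_gt0.
    by move: (Num.sqrt _) (normc z) n0 => u w w0 u0; field; rewrite (gt_eqF w0) (gt_eqF u0).
  rewrite mulrA -rmorphN -rmorphM cReM /= mul0r subr0.
  by ring.
have x0 : 0 <= pi * (y / V) ^+ 2 by rewrite mulr_ge0 ?pi_ge0 ?sqr_ge0.
apply: le_trans (expRN_le x0) _.
rewrite lef_pV2 ?posrE ?ltr_pwDl ?sqr_ge0// lerD2l ler_peMl ?sqr_ge0//.
by have := @pi_ge2 R; move: (@pi R) => p; lra.
Qed.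

Opaque gaussF theta chirp.

Section bound.
Variables (I : Type) (rs : seq I) (b : I -> R).
Variables (L : Type) (js : seq L) (phi : L -> R -> R) (Phi : L -> R).
Hypothesis phi0 : forall j x, 0 <= phi j x.
Hypothesis phi_sum : forall j x M, \sum_(n <- zr M) phi j (x - n%:~R) <= Phi j.

Let Phi0 j : 0 <= Phi j.
Proof. by apply: le_trans (phi_sum j 0 0); rewrite big_seq1. Qed.

(** Poisson summation in one variable after the other replaces the frequencies
    [k] by the dual lattice. Bounds are kept linear in the coefficients [c], so
    that cancellation between the terms [r] is carried along. *)
Lemma kernel_bound (D : seq (R * seq R)) : triangular D ->
  forall (eps : R) (N0 : nat), 0 < eps -> exists Ns, [/\ size Ns = size D,
    all (leq N0) Ns &
    forall (c : I -> R[i]) (x : seq R) (B : L -> R), size x = size D -> (forall j, 0 <= B j) ->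
    (forall xi, size xi = size D ->
      normc (\sum_(r <- rs) c r * gaussF_prod D (b r) xi) <=
      \sum_(j <- js) B j * \prod_(t <- xi) phi j t) ->
    normc (\sum_(k <- box Ns) \sum_(r <- rs)
        c r * (chirp (b r) (qform D k) * cis (2 * pi * dot x k))) <=
      \sum_(j <- js) B j * Phi j ^+ size D + eps * \sum_(r <- rs) normc (c r)].
Proof.
elim: D => [_ eps N0 e0|[q l] D IH /and3P[q0 /eqP sl tD] eps N0 e0].
  exists [::]; split => // c [|//] B _ B0 /(_ [::] erefl).
  under [X in _ <= X -> _]eq_bigr do rewrite big_nil.
  rewrite big_seq1 /= => H; apply: ler_wpDr.
    by rewrite mulr_ge0 ?(ltW e0)// sumr_ge0// => r _; exact: normc_ge0.
  under [leRHS]eq_bigr do rewrite expr0.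

  apply: le_trans H.
  rewrite le_eqVlt; apply/orP; left; apply/eqP; congr normc; apply: eq_bigr => r _.
  by rewrite chirp0 /dot big_nil mulr0 cis0 mulr1.
have qa : 0 < q * a by rewrite mulr_gt0.
have [Cg Cg0 HCg] : exists2 Cg, 0 <= Cg & forall c : I -> R[i], forall x M,
    \sum_(n <- zr M) \sum_(r <- rs) normc (c r * gaussF (q * a) (q * b r) (x - n%:~R)) <=
    Cg * \sum_(r <- rs) normc (c r).
  elim: rs => [|r s [C C0 HC]].
    by exists 0 => // c x M; rewrite mul0r big1// => n _; rewrite big_nil.
  have [C1 C10 HC1] := gaussF_summable (b r) q0.
  exists (C1 + C) => [|c x M]; first exact: addr_ge0.
  under eq_bigr do rewrite big_cons.
  rewrite big_split /= big_cons.
  have h1 : \sum_(n <- zr M) normc (c r * gaussF (q * a) (q * b r) (x - n%:~R)) <= C1 * normc (c r).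
    under eq_bigr do rewrite normcM.
    by rewrite -mulr_sumr mulrC ler_wpM2r ?normc_ge0.
  have h2 := HC c x M.
  have s0 : 0 <= \sum_(j <- s) normc (c j) by apply: sumr_ge0 => j _; exact: normc_ge0.
  have := mulr_ge0 C10 s0; have := mulr_ge0 C0 (normc_ge0 (c r)); lra.
pose eps1 := eps / 2 / (1 + Cg).
have e1 : 0 < eps1 by rewrite !divr_gt0// ltr_pwDl.
have [Ns [sNs aNs HNs]] := IH tD eps1 N0 e1.
pose E := \sum_(k <- box Ns) 8 * shift_const (q * a) `|dot l k|.
have e2 : 0 < eps / 2 by rewrite divr_gt0.
have [M0 HM0] := inv_small E e2.
pose M := maxn N0 M0.
exists (M :: Ns); split; [by rewrite /= sNs|by rewrite /= leq_maxl|].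
move=> c [//|x0 x] B [sx] B0 Hxi.
have C0 : 0 <= \sum_(r <- rs) normc (c r) by apply: sumr_ge0 => r _; exact: normc_ge0.
pose coef r k' := c r * (chirp (b r) (qform D k') * cis (2 * pi * (dot x k' - x0 * dot l k'))).
pose full := \sum_(k' <- box Ns) \sum_(r <- rs) coef r k' * theta (q * a) (q * b r) x0 (dot l k').
have termE r k0 k' : c r * (chirp (b r) (qform ((q, l) :: D) (k0 :: k')) * cis (2 * pi * dot (x0 :: x) (k0 :: k')))
   = coef r k' * gauss (q * a) (q * b r) x0 (dot l k' + k0%:~R).
  rewrite [qform ((q, l) :: D) _]/= chirpD dot_cons -chirp_gauss /coef.
  have -> : cis (2 * pi * (x0 * k0%:~R + dot x k')) =
     cis (2 * pi * (dot x k' - x0 * dot l k')) * cis (2 * pi * x0 * (dot l k' + k0%:~R)).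
    by rewrite -cisD; congr cis; ring.
  by ring.
have trunc : normc (\sum_(k <- box (M :: Ns)) \sum_(r <- rs)
      c r * (chirp (b r) (qform ((q, l) :: D) k) * cis (2 * pi * dot (x0 :: x) k)) - full) <=
    eps / 2 * \sum_(r <- rs) normc (c r).
  rewrite [box _]/= big_allpairs_dep exchange_big /= -sumrB.
  apply: (@le_trans _ _ (\sum_(k' <- box Ns) 8 * shift_const (q * a) `|dot l k'| / M.+1%:R * \sum_(r <- rs) normc (c r))); last first.
    rewrite -mulr_suml ler_wpM2r// -mulr_suml.
    by apply: HM0; exact: leq_maxr.
  apply: le_trans (normc_sum _ _ _) _; apply: ler_sum => k' _.
  rewrite exchange_big /= -sumrB; apply: le_trans (normc_sum _ _ _) _.
  rewrite mulr_sumr; apply: ler_sum => r _.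
  under eq_bigr do rewrite termE.
  rewrite -mulr_sumr -mulrBr normcM mulrC; apply: ler_pM; rewrite ?normc_ge0//.
    exact: (theta_tail qa).
  rewrite normcM normcM normc_cis mulr1; apply: ler_piMr; first exact: normc_ge0.
  by apply: normc_chirp_le1; exact: qform_ge0.
have main : normc full <= \sum_(j <- js) B j * Phi j ^+ (size D).+1 +
    eps / 2 * \sum_(r <- rs) normc (c r).
  apply: (ccvg_le (u := fun K => \sum_(k' <- box Ns) \sum_(r <- rs) coef r k' *
     \sum_(n <- zr K) gaussF (q * a) (q * b r) (x0 - n%:~R) * cis (2 * pi * n%:~R * dot l k'))).
    by apply: ccvg_sum => k'; apply: ccvg_sum => r; apply: ccvgZ; exact: (poisson qa).
  move=> K.
  have -> : \sum_(k' <- box Ns) \sum_(r <- rs) coef r k' *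
     \sum_(n <- zr K) gaussF (q * a) (q * b r) (x0 - n%:~R) * cis (2 * pi * n%:~R * dot l k') =
     \sum_(n <- zr K) \sum_(k' <- box Ns) \sum_(r <- rs)
       (c r * gaussF (q * a) (q * b r) (x0 - n%:~R)) * (chirp (b r) (qform D k') *
       cis (2 * pi * dot [seq p.1 - (x0 - n%:~R) * p.2 | p <- zip x l] k')).
    rewrite [RHS]exchange_big; apply: eq_bigr => k' _ /=.
    rewrite [RHS]exchange_big; apply: eq_bigr => r _ /=.
    rewrite mulr_sumr; apply: eq_bigr => n _.
    rewrite dot_shear ?sx// /coef.
    have -> : cis (2 * pi * (dot x k' - (x0 - n%:~R) * dot l k')) =
       cis (2 * pi * (dot x k' - x0 * dot l k')) * cis (2 * pi * n%:~R * dot l k').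
      by rewrite -cisD; congr cis; ring.
    by ring.
  apply: le_trans (normc_sum _ _ _) _.
  apply: (@le_trans _ _ (\sum_(n <- zr K) (\sum_(j <- js) B j * phi j (x0 - n%:~R) * Phi j ^+ size D +
     eps1 * \sum_(r <- rs) normc (c r * gaussF (q * a) (q * b r) (x0 - n%:~R))))).
    apply: ler_sum => n _; apply: HNs.
    - by rewrite size_map size_zip sx sl minnn.
    - by move=> j; rewrite mulr_ge0.
    - move=> xi sxi; have := Hxi ((x0 - n%:~R) :: xi); rewrite /= sxi => /(_ erefl).
      under [X in _ <= X -> _]eq_bigr do rewrite big_cons mulrA.
      apply: le_trans; rewrite le_eqVlt; apply/orP; left.
      by apply/eqP; congr normc; apply: eq_bigr => r _; rewrite mulrA.
  rewrite big_split /=; apply: lerD.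
    rewrite exchange_big /=; apply: ler_sum => j _.
    by rewrite -mulr_suml -mulr_sumr exprS mulrA ler_wpM2r ?exprn_ge0// ler_wpM2l.
  rewrite -mulr_sumr; apply: le_trans (ler_wpM2l (ltW e1) (HCg _ _ _)) _.
  rewrite mulrA ler_wpM2r// /eps1 mulrAC ler_pdivrMr ?ltr_pwDl// ler_wpM2l ?divr_ge0 ?(ltW e0)//.
  lra.
rewrite [size (_ :: _)]/=; move: main trunc.
set X := \sum_(j <- js) _; set Y := \sum_(r <- rs) normc _ => main trunc.
have -> : X + eps * Y = eps / 2 * Y + (X + eps / 2 * Y) by field.
by rewrite -[X in normc X](subrK full); apply: normc_leD.
Qed.

End bound.
End lattice_kernel.

(** * Exponential sums *)

Lemma chord_le1 (R : realType) : chord R <= 1.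
Proof. by rewrite /chord; have := @cos_le1 R 1; lra. Qed.

Opaque chord.

Section exponential_sums.
Variable R : realType.
Implicit Types (f g : nat -> R) (A W : nat -> R[i]).

Lemma abel_diff A W n :
  \sum_(0 <= r < n.+1) (A r.+1 - A r) * W r =
  A n.+1 * W n - A 0%N * W 0%N - \sum_(0 <= r < n) A r.+1 * (W r.+1 - W r).
Proof.
elim: n => [|n IH]; first by rewrite big_nat1 big_geq// subr0 mulrBl.
by rewrite big_nat_recr//= IH [in RHS]big_nat_recr//=; ring.
Qed.

Lemma abel_diff_le A W n (L : R) : (forall r, (r <= n.+1)%N -> normc (A r) <= L) ->
  normc (\sum_(0 <= r < n.+1) (A r.+1 - A r) * W r) <=
  L * (normc (W n) + normc (W 0%N) + \sum_(0 <= r < n) normc (W r.+1 - W r)).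
Proof.
move=> AL; rewrite abel_diff 2!mulrDr.
apply: normc_leD; first apply: normc_leD.
- by rewrite normcM ler_wpM2r ?normc_ge0// AL.
- by rewrite normcN normcM ler_wpM2r ?normc_ge0// AL.
- rewrite normcN; apply: le_trans (normc_sum _ _ _) _; rewrite mulr_sumr.
  rewrite big_nat [leRHS]big_nat; apply: ler_sum => r /andP[_ rn].
  by rewrite normcM ler_wpM2r ?normc_ge0// AL// ltnS ltnW.
Qed.

Lemma weighted_sum_le (a W : nat -> R[i]) n (L : R) :
  (forall r, (r <= n)%N -> normc (\sum_(0 <= i < r) a i) <= L) ->
  normc (\sum_(0 <= r < n) W r * a r) <=
  L * (2 * normc (W 0%N) + 2 * \sum_(0 <= r < n.-1) normc (W r.+1 - W r)).
Proof.
case: n => [|n] H.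
  rewrite big_geq// normc0 mulr_ge0//; first exact: le_trans (normc_ge0 _) (H 0%N _).
  by rewrite addr_ge0 ?mulr_ge0 ?normc_ge0// sumr_ge0// => r _; exact: normc_ge0.
have L0 : 0 <= L by exact: le_trans (normc_ge0 _) (H 0%N _).
pose A r := \sum_(0 <= i < r) a i.
have -> : \sum_(0 <= r < n.+1) W r * a r = \sum_(0 <= r < n.+1) (A r.+1 - A r) * W r.
  by apply: eq_bigr => r _; rewrite /A big_nat_recr//= addrAC subrr add0r mulrC.
apply: le_trans (abel_diff_le W H) _; rewrite ler_wpM2l//=.
suff : normc (W n) <= normc (W 0%N) + \sum_(0 <= r < n) normc (W r.+1 - W r) by lra.
elim: n {H} => [|n IH]; first by rewrite big_geq// addr0.
rewrite big_nat_recr//= addrA -[X in normc X](subrK (W n)) addrC.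
by apply: normc_leD.
Qed.

Definition kl_const : R := 4 / chord R ^+ 2.

Lemma kl_const_ge0 : 0 <= kl_const.
Proof. by rewrite divr_ge0// sqr_ge0. Qed.

(** Kusmin-Landau: [cis (f r)] is a difference divided by [cis (g r) - 1],
    whose inverse has bounded variation because [g] is monotone. *)
Lemma kusmin_landau f n (mu : R) (pos : bool) : 0 < mu ->
  (forall r, (r < n)%N -> mu <= (-1) ^+ (~~ pos) * (f r.+1 - f r)) ->
  (forall r, (r < n)%N -> `|f r.+1 - f r| <= pi) ->
  (forall r, (r.+1 < n)%N -> f r.+1 - f r <= f r.+2 - f r.+1) ->
  normc (\sum_(0 <= r < n) cis (f r)) <= kl_const / mu.
Proof.
move=> mu0 gmu gpi gmon; have c0 := @chord_gt0 R.
case: n gmu gpi gmon => [|n] gmu gpi gmon.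
  by rewrite big_geq// normc0 divr_ge0 ?kl_const_ge0// ltW.
pose g r := f r.+1 - f r.
have gabs r : (r < n.+1)%N -> mu <= `|g r|.
  move=> /gmu; rewrite -/(g r) => h; apply: le_trans h _.
  by apply: le_trans (ler_norm _) _; rewrite normrM normrX normrN normr1 expr1n mul1r.
have gn0 r : (r < n.+1)%N -> g r != 0.
  by move=> /gabs h; rewrite -normr_gt0; exact: lt_le_trans h.
have chg r : (r < n.+1)%N -> chord R * `|g r| <= normc (cis (g r) - 1).
  by move=> rn; apply: cis_ge_chord; exact: gpi.
have cis1 r : (r < n.+1)%N -> cis (g r) - 1 != 0 :> R[i].
  move=> rn; rewrite -normc_gt0; apply: lt_le_trans (chg r rn).
  by rewrite mulr_gt0// (lt_le_trans mu0)// gabs.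
pose W r : R[i] := (cis (g r) - 1)^-1.
have Wle r : (r < n.+1)%N -> normc (W r) <= (chord R * mu)^-1.
  move=> rn; have p1 : 0 < chord R * mu by exact: mulr_gt0.
  have p2 : 0 < normc (cis (g r) - 1) by rewrite normc_gt0 cis1.
  rewrite normcV lef_pV2 ?posrE//.
  by apply: le_trans (chg r rn); apply: ler_wpM2l; [exact: ltW|exact: gabs].
have -> : \sum_(0 <= r < n.+1) cis (f r) =
    \sum_(0 <= r < n.+1) (cis (f r.+1) - cis (f r)) * W r :> R[i].
  rewrite big_nat [RHS]big_nat; apply: eq_bigr => r /andP[_ rn].
  have -> : cis (f r.+1) - cis (f r) = cis (f r) * (cis (g r) - 1).
    by rewrite mulrBr mulr1 -cisD (_ : f r + g r = f r.+1)// /g; ring.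
  by rewrite mulfK// cis1.
apply: le_trans (abel_diff_le (A := fun r => cis (f r)) W (L := 1) _) _.
  by move=> r _; rewrite normc_cis.
rewrite mul1r.
have Wd r : (r < n)%N -> normc (W r.+1 - W r) <= ((g r)^-1 - (g r.+1)^-1) / chord R ^+ 2.
  move=> rn; have rn1 : (r < n.+1)%N by rewrite ltnS ltnW.
  have r1n : (r.+1 < n.+1)%N by rewrite ltnS.
  have -> : W r.+1 - W r = (cis (g r) - cis (g r.+1)) / ((cis (g r.+1) - 1) * (cis (g r) - 1)).
    by rewrite /W; field; rewrite !cis1.
  rewrite normcM normcV normcM.
  have gr : g r <= g r.+1 by exact: gmon.
  have s0 : 0 < g r * g r.+1.
    have := gmu r rn1; have := gmu r.+1 r1n; rewrite -/(g r) -/(g r.+1).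
    case: pos {gmu} => /=; rewrite ?expr0 ?expr1 ?mul1r ?mulN1r => h1 h2; nra.
  have -> : ((g r)^-1 - (g r.+1)^-1) / chord R ^+ 2 = (g r.+1 - g r) * (chord R ^+ 2 * (g r * g r.+1))^-1.
    by field; rewrite (gt_eqF c0) !gn0.
  have p1 : 0 < normc (cis (g r.+1) - 1) * normc (cis (g r) - 1).
    by rewrite mulr_gt0 ?normc_gt0 ?cis1.
  have p2 : 0 < chord R ^+ 2 * (g r * g r.+1) by rewrite mulr_gt0 ?exprn_gt0.
  apply: ler_pM; [exact: normc_ge0|by rewrite invr_ge0 ltW| |].
    by apply: le_trans (cis_lip _ _) _; rewrite distrC ger0_norm ?subr_ge0.
  rewrite lef_pV2 ?posrE// -(gtr0_norm s0) normrM.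
  have q0 (t : R) : 0 <= chord R * `|t| by apply: mulr_ge0; [exact: ltW|].
  have h := ler_pM (q0 (g r.+1)) (q0 (g r)) (chg _ r1n) (chg _ rn1).
  apply: le_trans h.
  by rewrite le_eqVlt; apply/orP; left; apply/eqP; ring.
have sumW : \sum_(0 <= r < n) normc (W r.+1 - W r) <= 2 / mu / chord R ^+ 2.
  apply: (@le_trans _ _ (\sum_(0 <= r < n) ((g r)^-1 - (g r.+1)^-1) / chord R ^+ 2)).
    by rewrite big_nat [leRHS]big_nat; apply: ler_sum => r /andP[_ /Wd].
  rewrite -mulr_suml ler_wpM2r ?invr_ge0 ?sqr_ge0//.
  have -> : \sum_(0 <= r < n) ((g r)^-1 - (g r.+1)^-1) = (g 0%N)^-1 - (g n)^-1.
    elim: n {gmu gpi gmon gabs gn0 chg cis1 Wle Wd} => [|n IH]; first by rewrite big_geq// subrr.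
    by rewrite big_nat_recr//= IH; ring.
  have gV r : (r < n.+1)%N -> `|(g r)^-1| <= mu^-1.
    by move=> rn; rewrite normfV lef_pV2 ?posrE ?gabs// (lt_le_trans mu0)// gabs.
  have := gV 0%N isT; have := gV n (ltnSn n); rewrite !ler_norml.
  have -> : 2 / mu = mu^-1 + mu^-1 by rewrite mulr_natl mulr2n.
  by move: (mu^-1) => p /andP[? ?] /andP[? ?]; lra.
apply: le_trans (lerD (lerD (Wle n (ltnSn n)) (Wle 0%N isT)) sumW) _.
have -> : (chord R * mu)^-1 + (chord R * mu)^-1 + 2 / mu / chord R ^+ 2 =
  (2 * chord R + 2) / chord R ^+ 2 / mu by field; rewrite (gt_eqF c0) (gt_eqF mu0).
rewrite ler_wpM2r ?invr_ge0 ?(ltW mu0)// ler_wpM2r ?invr_ge0 ?sqr_ge0//.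
by have := chord_le1 R; lra.
Qed.

(** Monotone increments cross a level once, so the places where they are small
    form a single stretch. *)
Lemma monotone_threshold g (n : nat) (P : R -> bool) :
  (forall x y, x <= y -> P x -> P y) ->
  (forall r, (r.+1 < n)%N -> g r <= g r.+1) ->
  exists m, [/\ (m <= n)%N, forall r, (r < m)%N -> ~~ P (g r) &
    forall r, (m <= r)%N -> (r < n)%N -> P (g r)].
Proof.
move=> Pm; elim: n => [_|n IH gm]; first by exists 0%N.
have [|m [mn m1 m2]] := IH; first by move=> r rn; apply: gm; exact: ltnW.
have [Pn|Pn] := boolP (P (g n)).
  exists m; split => //; first exact: leqW.
  move=> r mr; rewrite ltnS leq_eqVlt => /predU1P[->//|]; exact: m2.
exists n.+1; split => // r; last by move=> h1 h2; move: (leq_trans h2 h1); rewrite ltnn.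
rewrite ltnS leq_eqVlt => /predU1P[->//|rn].
have [rm|mr] := ltnP r m; first exact: m1.
exfalso; move/negP: Pn; apply.
have n0 : (0 < n)%N by exact: leq_trans rn.
have nn : (n.-1 < n)%N by rewrite prednK.
apply: (Pm (g n.-1)); last by apply: m2 => //; rewrite -ltnS prednK//; exact: leq_ltn_trans rn.
by have := gm n.-1; rewrite prednK//; apply.
Qed.

(** The second derivative test: the stretch where the increments are below
    [mu] is short, and Kusmin-Landau handles its two sides. *)
Lemma van_der_corput f n (mu M : R) : 0 < mu -> 0 <= M ->
  (forall r, (r < n)%N -> `|f r.+1 - f r| <= pi) ->
  (forall r, (r.+1 < n)%N -> f r.+1 - f r <= f r.+2 - f r.+1) ->
  (forall r r', (r <= r')%N -> (r' < n)%N -> `|f r.+1 - f r| <= mu -> `|f r'.+1 - f r'| <= mu ->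
    (r' - r)%:R <= M) ->
  normc (\sum_(0 <= r < n) cis (f r)) <= 2 * (kl_const / mu) + (M + 1).
Proof.
move=> mu0 M0 gpi gmon near.
pose g r := f r.+1 - f r.
have [m1 [m1n m1a m1b]] := @monotone_threshold g n (fun x => - mu <= x)
  (fun x y xy h => le_trans h xy) gmon.
have [m2 [m2n m2a m2b]] := @monotone_threshold g n (fun x => mu < x)
  (fun x y xy h => lt_le_trans h xy) gmon.
have m12 : (m1 <= m2)%N.
  rewrite leqNgt; apply/negP => h; have m2n' : (m2 < n)%N by exact: leq_trans m1n.
  have := m1a m2 h; have := m2b m2 (leqnn _) m2n'; rewrite -ltNge; lra.
rewrite (big_cat_nat (n := m1))//= (big_cat_nat (n := m2) (m := m1))//=.
have -> : 2 * (kl_const / mu) + (M + 1) = kl_const / mu + (M + 1 + kl_const / mu) by ring.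
apply: normc_leD; last apply: normc_leD.
- apply: (kusmin_landau (pos := false)) => //.
  + move=> r /m1a; rewrite -ltNge /= expr1 mulN1r -/(g r); lra.
  + by move=> r rm; apply: gpi; exact: leq_trans m1n.
  + by move=> r rm; apply: gmon; exact: leq_trans m1n.
- apply: le_trans (normc_sum _ _ _) _; under eq_bigr do rewrite normc_cis.
  rewrite sumr_const_nat.
  have [->|nm] := eqVneq m1 m2; first by rewrite subnn mulr0n addr_ge0.
  have lm : (m1 < m2)%N by rewrite ltn_neqAle nm.
  have p2 : (m2.-1 < m2)%N by rewrite prednK//; exact: leq_trans lm.
  have p1 : (m1 <= m2.-1)%N by rewrite -ltnS (ltn_predK lm).
  have mid r : (m1 <= r)%N -> (r < m2)%N -> `|g r| <= mu.
    move=> h1 h2; rewrite ler_norml m1b ?(leq_trans h2)//=.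
    by have := m2a r h2; rewrite -leNgt.
  have := near m1 m2.-1 p1 (leq_trans p2 m2n) (mid _ (leqnn _) lm) (mid _ p1 p2).
  move=> h; rewrite -(ltn_predK lm) subSn// -natr1; lra.
- rewrite -{1}[m2]add0n big_addn.
  apply: (kusmin_landau (f := fun r => f (r + m2)%N) (pos := true)) => //.
  + move=> r rm; have rn : (r + m2 < n)%N by lia.
    by rewrite /= mul1r; apply: ltW; apply: (m2b (r + m2)%N (leq_addl _ _) rn).
  + by move=> r rm; have rn : (r + m2 < n)%N by [lia]; exact: (gpi (r + m2)%N rn).
  + by move=> r rm; have rn : ((r + m2).+1 < n)%N by [lia]; exact: (gmon (r + m2)%N rn).
Qed.

End exponential_sums.

(** * The phase of a dyadic block *)

Section block_phase.
Variable R : realType.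

Definition vdc_const : R := 2 * kl_const R + 5.

Lemma vdc_const_ge0 : 0 <= vdc_const.
Proof. by rewrite addr_ge0// mulr_ge0// kl_const_ge0. Qed.

(** The derivative of the phase at two points is close to zero only if the two
    values of [q / (x * y)] are close to each other and to [lam ^ 2]; since the
    values decrease at a definite rate, so are the points. *)
Lemma phase_near (lam s q x y x' y' : R) : 0 < lam -> 0 < s -> 1 <= lam * s ->
  0 < x -> x <= y -> x <= x' -> x' <= y' -> y <= y' -> x' <= 2 * s ^+ 2 ->
  `|lam ^+ 2 - q / (x * y)| <= lam / (2 * s) ->
  `|lam ^+ 2 - q / (x' * y')| <= lam / (2 * s) ->
  x' - x <= 4 * s / lam.
Proof.
move=> lam0 s0 ls x0 xy xx' xy' yy' x2 h1 h2.
have y0 : 0 < y by exact: lt_le_trans xy.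
have x'0 : 0 < x' by exact: lt_le_trans xx'.
have y'0 : 0 < y' by exact: lt_le_trans xy'.
have e1 : q = q / (x * y) * (x * y) by field; rewrite !gt_eqF.
have e2 : q = q / (x' * y') * (x' * y') by field; rewrite !gt_eqF.
move: h1 h2 e1 e2; set u := q / (x * y); set v := q / _.
have n1 : lam / (2 * s) * s = lam / 2 by field; rewrite gt_eqF.
move: (lam / _) n1 => nu n1; rewrite !ler_norml => /andP[h0 h1] /andP[_ h2] e1 e2.
have nu0 : 0 < nu.
  by rewrite -(pmulr_lgt0 _ s0) n1 divr_gt0.
have nule : nu <= lam ^+ 2 / 2.
  by rewrite -(ler_pM2r s0) n1; have := ler_wpM2l (ltW lam0) ls; lra.
have u2 : lam ^+ 2 / 2 <= u by lra.
have uv : u * (x * y) = v * (x' * y') by rewrite -e1 -e2.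
have d1 : (x' - x) * y' <= x' * y' - x * y by nra.
have d2 : u * (x' * y' - x * y) = (u - v) * (x' * y') by rewrite mulrBr uv; ring.
have huv : u - v <= 2 * nu by lra.
have p0 : 0 < x' * y' by exact: mulr_gt0.
have d3 : u * ((x' - x) * y') <= 2 * nu * (x' * y').
  apply: le_trans (ler_wpM2r (ltW p0) huv); rewrite -d2 ler_wpM2l//.
  by apply: le_trans u2; rewrite divr_ge0 ?sqr_ge0.
have d4 : lam ^+ 2 / 2 * (x' - x) <= 2 * nu * x'.
  rewrite -(ler_pM2r y'0) -[leRHS]mulrA; apply: le_trans d3.
  rewrite -[leLHS]mulrA; apply: ler_wpM2r u2.
  by rewrite mulr_ge0 ?subr_ge0// ltW.
have d5 : lam ^+ 2 / 2 * (x' - x) <= 2 * lam * s.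
  apply: le_trans d4 _; have := ler_wpM2l (ltW nu0) x2; have := n1; nra.
rewrite ler_pdivlMr// -(ler_pM2l lam0); lra.
Qed.

(** The threshold [lam * h / sqrt U] balances the length of the stationary stretch
    against the bound of Kusmin and Landau outside it. *)
Lemma block_phase_sum (lam U h q : R) (n : nat) : 1 <= lam -> 1 <= lam * U -> 0 < h ->
  h * lam ^+ 6 <= 1 -> 0 <= q -> q <= lam ^+ 4 -> n%:R * h <= U ->
  normc (\sum_(0 <= r < n)
    cis (pi * (lam ^+ 2 * (U + r%:R * h) + q / (U + r%:R * h)))) <=
  vdc_const * (Num.sqrt U / (lam * h)).
Proof.
move=> l1 lU h0 hl q0 ql nh.
have l0 : 0 < lam by exact: lt_le_trans l1.
have U0 : 0 < U by rewrite -(pmulr_rgt0 _ l0); exact: lt_le_trans lU.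
pose s := Num.sqrt U; have s0 : 0 < s by rewrite sqrtr_gt0.
have sU : s ^+ 2 = U by rewrite sqr_sqrtr// ltW.
have lp k : 1 <= lam ^+ k by exact: exprn_ege1.
have b0 r : 0 < U + r%:R * h by rewrite ltr_pwDl// mulr_ge0// ltW.
have bU r : U <= U + r%:R * h by rewrite lerDl mulr_ge0// ltW.
have bS r : U + r.+1%:R * h = U + r%:R * h + h by rewrite -natr1; ring.
pose f r := pi * (lam ^+ 2 * (U + r%:R * h) + q / (U + r%:R * h)) : R.
have p0 := pi_gt0 R; have p2 := @pi_ge2 R.
have gE r : f r.+1 - f r = pi * h * (lam ^+ 2 - q / ((U + r%:R * h) * (U + r.+1%:R * h))).
  rewrite /f bS; have := b0 r; have := b0 r.+1; rewrite bS; move: (U + _) => x y1 x1.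
  by move: (@pi R) => p; field; rewrite !gt_eqF.
have qb r : 0 <= q / ((U + r%:R * h) * (U + r.+1%:R * h)) <= q / U ^+ 2.
  have yp := mulr_gt0 (b0 r) (b0 r.+1).
  rewrite divr_ge0 ?(ltW yp)//= ler_wpM2l// lef_pV2 ?posrE ?exprn_gt0// expr2.
  by apply: ler_pM; rewrite ?(ltW U0).
have l2h : h * lam ^+ 2 <= 1.
  by apply: le_trans hl; rewrite ler_wpM2l ?(ltW h0)// ler_weXn2l.
have qh : h * (q / U ^+ 2) <= 1.
  rewrite mulrA ler_pdivrMr ?exprn_gt0// mul1r.
  have a1 : h * q <= h * lam ^+ 4 by rewrite ler_wpM2l// ltW.
  have a2 : 1 <= lam ^+ 2 * U ^+ 2 by rewrite -exprMn exprn_ege1.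
  apply: le_trans a1 _; apply: le_trans (ler_peMr _ a2) _; first by rewrite mulr_ge0 ?exprn_ge0 ?(ltW l0) ?(ltW h0).
  have -> : h * lam ^+ 4 * (lam ^+ 2 * U ^+ 2) = h * lam ^+ 6 * U ^+ 2 by ring.
  by rewrite ler_piMl ?sqr_ge0.
have ls : 1 <= lam * s by nra.
have lh0 : 0 < lam * h by exact: mulr_gt0.
have lhs : lam * h <= s.
  have k1 : lam * h * lam <= 1 by rewrite mulrAC -expr2 mulrC.
  have k2 : lam * h <= 1.
    by apply: le_trans k1; rewrite ler_peMr// ltW.
  rewrite -(@ler_pXn2r _ 2)// ?nnegrE ?(ltW s0) ?(ltW lh0)// sU -(ler_pM2l l0).
  apply: le_trans lU; apply: le_trans k1; rewrite mulrC expr2 ler_wpM2r ?(ltW l0)//.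
  by rewrite ler_piMl// ltW.
have mu0 : 0 < lam * h / s by exact: divr_gt0.
have M0 : 0 <= 4 * s / (lam * h) by rewrite divr_ge0 ?mulr_ge0// ltW.
apply: le_trans (van_der_corput (f := f) mu0 M0 _ _ _) _.
- move=> r rn; rewrite gE -mulrA normrM (gtr0_norm p0) ler_piMr ?(ltW p0)//.
  have /andP[q1 q2] := qb r; have := ler_wpM2l (ltW h0) q1; have := ler_wpM2l (ltW h0) q2.
  rewrite mulr0 ler_norml mulrBr; have := ler_wpM2l (ltW h0) (sqr_ge0 lam).
  move: qh l2h; rewrite mulr0; set x := h * (q / _); set y := h * (q / _); set z := h * _.
  by clearbody x y z => *; apply/andP; split; lra.
- move=> r rn; rewrite !gE ler_wpM2l ?mulr_ge0 ?(ltW p0) ?(ltW h0)// lerB// ler_wpM2l//.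
  rewrite lef_pV2 ?posrE ?mulr_gt0// mulrC ler_wpM2l ?(ltW (b0 _))//.
  by rewrite (bS r.+1) (bS r); lra.
- move=> r r' rr r'n.
  have conv t : `|f t.+1 - f t| <= lam * h / s ->
     `|lam ^+ 2 - q / ((U + t%:R * h) * (U + t.+1%:R * h))| <= lam / (2 * s).
    rewrite gE normrM gtr0_norm ?mulr_gt0// => hh.
    have phn : 2 * h * `|lam ^+ 2 - q / ((U + t%:R * h) * (U + t.+1%:R * h))| <= lam * h / s.
      by apply: le_trans hh; rewrite ler_wpM2r// ler_wpM2r// ltW.
    rewrite -(ler_pM2l (mulr_gt0 (ltr0Sn _ 1) h0)); apply: le_trans phn _.
    by rewrite le_eqVlt; apply/orP; left; apply/eqP; field; rewrite gt_eqF.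
  move=> /conv k1 /conv k2.
  have mono u v : (u <= v)%N -> U + u%:R * h <= U + v%:R * h.
    by move=> uv; rewrite lerD2l ler_wpM2r ?(ltW h0)// ler_nat.
  have x2 : U + r'%:R * h <= 2 * s ^+ 2.
    rewrite sU; apply: le_trans (mono _ _ (ltnW r'n)) _; lra.
  have := phase_near l0 s0 ls (b0 r) (mono r r.+1 (leqnSn _)) (mono _ _ rr)
    (mono _ _ (leqnSn _)) (mono r.+1 r'.+1 rr) x2 k1 k2.
  rewrite ler_pdivlMr// ler_pdivlMr// natrB//; nra.
- have -> : 2 * (kl_const R / (lam * h / s)) + (4 * s / (lam * h) + 1) =
     (2 * kl_const R + 4) * (s / (lam * h)) + 1.
    by field; rewrite !gt_eqF.
  rewrite /vdc_const -/s; have : 1 <= s / (lam * h) by rewrite ler_pdivlMr// mul1r.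
  by move: (s / _) (kl_const R) => x k; lra.
Qed.

End block_phase.

(** * Slowly varying amplitudes *)

Section slow_amplitudes.
Variable R : realType.
Implicit Types (W : nat -> R[i]).

(** [W] has size [K] and varies by at most [K * L] over [dl^-1] steps. *)
Definition slow (n : nat) (dl K L : R) W :=
  (forall r, (r <= n)%N -> normc (W r) <= K) /\
  (forall r, (r < n)%N -> normc (W r.+1 - W r) <= K * L * dl).

Lemma slow_mul n dl K L K' L' W W' : slow n dl K L W -> slow n dl K' L' W' ->
  slow n dl (K * K') (L + L') (fun r => W r * W' r).
Proof.
move=> [H1 H2] [H1' H2']; split => [r rn|r rn].
  by rewrite normcM; apply: ler_pM; rewrite ?normc_ge0 ?H1 ?H1'.
have -> : W r.+1 * W' r.+1 - W r * W' r =
  (W r.+1 - W r) * W' r.+1 + W r * (W' r.+1 - W' r) by ring.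
have -> : K * K' * (L + L') * dl = K * L * dl * K' + K * (K' * L' * dl) by ring.
apply: normc_leD; rewrite normcM; apply: ler_pM; rewrite ?normc_ge0//.
- exact: H2.
- exact: H1'.
- by apply: H1; exact: ltnW.
- exact: H2'.
Qed.

Lemma slow_sum n dl K L La W (a : nat -> R[i]) : 0 <= L -> 0 <= K -> n%:R * dl <= 1 ->
  slow n dl K L W ->
  (forall r, (r <= n)%N -> normc (\sum_(0 <= i < r) a i) <= La) ->
  normc (\sum_(0 <= r < n) W r * a r) <= La * (2 * K * (1 + L)).
Proof.
move=> L0 K0 nd [H1 H2] H.
have La0 : 0 <= La by apply: le_trans (normc_ge0 _) (H 0%N _).
have [n0|n0] := leP dl 0.
  apply: le_trans (weighted_sum_le W H) _; apply: ler_wpM2l => //.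
  have : \sum_(0 <= r < n.-1) normc (W r.+1 - W r) <= 0.
    rewrite big_nat; apply: sumr_le0 => r /andP[_ rn].
    apply: le_trans (H2 r _) _; first by apply: leq_trans rn _; exact: leq_pred.
    by rewrite mulr_ge0_le0// mulr_ge0.
  have := H1 0%N (leq0n _); have := mulr_ge0 K0 L0; lra.
apply: le_trans (weighted_sum_le W H) _; apply: ler_wpM2l => //.
have : \sum_(0 <= r < n.-1) normc (W r.+1 - W r) <= K * L.
  apply: (@le_trans _ _ (\sum_(0 <= r < n.-1) K * L * dl)).
    rewrite big_nat [leRHS]big_nat; apply: ler_sum => r /andP[_ rn].
    by apply: H2; apply: leq_trans rn _; exact: leq_pred.
  rewrite sumr_const_nat subn0 -mulr_natl.
  rewrite [leLHS](_ : _ = K * L * (n.-1%:R * dl)); last by ring.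
  apply: ler_piMr; first exact: mulr_ge0.
  by apply: le_trans nd; rewrite ler_wpM2r ?(ltW n0)// ler_nat leq_pred.
have := H1 0%N (leq0n _); lra.
Qed.

Lemma slow_weight (X J n : nat) : (0 < X)%N -> (X + n <= J)%N ->
  slow n (X%:R)^-1 (J%:R)^-1 1 (fun r => ((J%:R - (X + r)%:R) / J%:R ^+ 2)%:C).
Proof.
move=> X0 XJ.
have J0 : (0 < J)%N by apply: leq_trans X0 _; exact: leq_trans (leq_addr _ _) XJ.
have XR : 0 < X%:R :> R by rewrite ltr0n.
have JR : 0 < J%:R :> R by rewrite ltr0n.
have J2 : 0 < (J%:R ^+ 2)^-1 :> R by rewrite invr_gt0 exprn_gt0.
split=> r rn.
  rewrite normcR normrM (gtr0_norm J2) ler_pdivrMr ?exprn_gt0//.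
  have -> : J%:R^-1 * J%:R ^+ 2 = J%:R :> R by field; rewrite gt_eqF.
  have : (X + r)%:R <= J%:R :> R by rewrite ler_nat; apply: leq_trans XJ; rewrite leq_add2l.
  by have := ler0n R (X + r); rewrite ler_norml => *; apply/andP; split; lra.
rewrite -rmorphB normcR addnS -natr1 -mulrBl normrM (gtr0_norm J2).
have -> : J%:R - ((X + r)%:R + 1) - (J%:R - (X + r)%:R) = -1 :> R by ring.
rewrite normrN normr1 mul1r mulr1 expr2 invfM ler_wpM2l ?invr_ge0 ?(ltW JR)//.
by rewrite lef_pV2 ?posrE// ler_nat; apply: leq_trans XJ; exact: leq_addr.
Qed.

Definition kappa_const (q : R) : R := 4 * (1 + Num.sqrt q) / Num.sqrt q.

Lemma kappa_const_ge0 q : 0 <= kappa_const q.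
Proof. by rewrite divr_ge0 ?sqrtr_ge0// mulr_ge0// addr_ge0 ?sqrtr_ge0. Qed.

Lemma slow_gaussF0 (q a U h : R) n : 0 < q -> 0 < a -> a <= 1 -> 0 < U -> 0 < h ->
  slow n (h / U) (kappa_const q / Num.sqrt U) 1
    (fun r => gaussF (q * a) (q * (U + r%:R * h)) 0).
Proof.
move=> q0 a0 a1 U0 h0.
have qa : 0 < q * a by exact: mulr_gt0.
have sq : 0 < Num.sqrt q by rewrite sqrtr_gt0.
have sU : 0 < Num.sqrt U by rewrite sqrtr_gt0.
have sqa : Num.sqrt (q * a) <= Num.sqrt q by rewrite ler_wsqrtr// ler_piMr// ltW.
have qU : Num.sqrt (q * U) = Num.sqrt q * Num.sqrt U by rewrite sqrtrM// ltW.
have bU (r : nat) : U <= U + r%:R * h by rewrite lerDl mulr_ge0// ltW.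
split=> r rn.
  have h1 := gaussF0_le qa (q * (U + r%:R * h)).
  have -> : kappa_const q / Num.sqrt U = 4 * (1 + Num.sqrt q) / Num.sqrt (q * U).
    by rewrite /kappa_const qU; field; rewrite !gt_eqF.
  rewrite ler_pdivlMr ?sqrtr_gt0 ?mulr_gt0//.
  have h3 : 4 * (1 + Num.sqrt (q * a)) <= 4 * (1 + Num.sqrt q) by rewrite ler_wpM2l// lerD2l.
  apply: le_trans h3; apply: le_trans h1; rewrite ler_wpM2l ?normc_ge0// ler_wsqrtr//.
  apply: le_trans (ger_Im _) => /=; rewrite ger0_norm; first by rewrite ler_wpM2l ?(ltW q0).
  by rewrite mulr_ge0 ?(ltW q0)//; exact: le_trans (ltW U0) (bU r).
have h2 := @gaussF0_lip _ _ qa (q * U) (q * (U + r%:R * h)) (q * (U + r.+1%:R * h)) (mulr_gt0 q0 U0).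
have bb : q * (U + r%:R * h) <= q * (U + r.+1%:R * h).
  by rewrite ler_wpM2l ?(ltW q0)// lerD2l ler_wpM2r ?(ltW h0)// ler_nat.
apply: le_trans (h2 (ler_wpM2l (ltW q0) (bU r)) bb) _.
have -> : q * (U + r.+1%:R * h) - q * (U + r%:R * h) = q * h by rewrite -natr1; ring.
rewrite qU /kappa_const.
move: sqa; move: (Num.sqrt (q * a)) (Num.sqrt q) sq (Num.sqrt U) sU => x y y0 z z0 xy.
have -> : 2 * (1 + x) / (y * z * (q * U)) * (q * h) = 2 * (1 + x) * (h / (y * z * U)).
  by field; rewrite !gt_eqF.
have -> : 4 * (1 + y) / y / z * 1 * (h / U) = 4 * (1 + y) * (h / (y * z * U)).
  by field; rewrite !gt_eqF.
by rewrite ler_wpM2r; [|rewrite divr_ge0 ?mulr_ge0// ltW|lra].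
Qed.

(** The part of [exp (- pi q / (a + i b))] left when the rapidly oscillating
    [exp (i pi q / b)] is taken out. *)
Definition rho (a b : R) : R[i] := (a / (a ^+ 2 + b ^+ 2)) +i* (a ^+ 2 / (b * (a ^+ 2 + b ^+ 2))).

(** [- 1 / (a + i b) = i / b - rho a b]. *)
Lemma cexp_split (a b q : R) : 0 < a -> 0 < b ->
  cexp (- (pi * q)%:C / (a +i* b)) = cis (pi * (q / b)) * cexp (- (pi * q)%:C * rho a b).
Proof.
move=> a0 b0; rewrite -(cexp_imag (pi * (q / b))) -cexpD; congr cexp.
have n0 : a ^+ 2 + b ^+ 2 != 0 by rewrite gt_eqF// ltr_pwDl ?exprn_gt0// sqr_ge0.
have z0 : (a +i* b) != 0 :> R[i] by rewrite eq_complex /= gt_eqF.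
apply: (mulIf z0); rewrite mulfVK//.
move: (@pi R) => p; apply: complexP; rewrite /rho /=; field; rewrite ?n0 ?gt_eqF//.
Qed.

Lemma rho_lip (a b b' U : R) : 0 < a -> a <= U -> U <= b -> b <= b' -> b' <= 2 * U ->
  normc (rho a b' - rho a b) <= 6 * a / U ^+ 3 * (b' - b).
Proof.
move=> a0 aU Ub bb b2.
have U0 : 0 < U by exact: lt_le_trans aU.
have b0 : 0 < b by exact: lt_le_trans Ub.
have b'0 : 0 < b' by exact: lt_le_trans bb.
have np (x : R) : 0 < x -> 0 < a ^+ 2 + x ^+ 2 by move=> x0; rewrite ltr_pwDl ?exprn_gt0// sqr_ge0.
have n0 := np _ b0; have n0' := np _ b'0.
have zn (x : R) : 0 < x -> x <= normc (a +i* x).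
  by move=> x0; apply: le_trans (ger_Im _); rewrite /= gtr0_norm.
have z0 (x : R) : (a +i* x) != 0 :> R[i] by rewrite eq_complex /= gt_eqF.
have E : (rho a b' - rho a b) * ((a +i* b) * (a +i* b') * (b * b')%:C) =
    (0 +i* - (b' - b)) * (a%:C * (a +i* (b + b'))).
  rewrite /rho; apply: complexP => /=; field; rewrite ?(gt_eqF n0) ?(gt_eqF n0') ?gt_eqF//.
have p0 : 0 < b * b' by exact: mulr_gt0.
have E2 : normc (rho a b' - rho a b) * (normc (a +i* b) * normc (a +i* b') * (b * b')) =
   (b' - b) * (a * normc (a +i* (b + b'))).
  have := congr1 (@normc R) E; rewrite !normcM normc_imag normrN !normcR.
  by rewrite (gtr0_norm p0) (gtr0_norm a0) ger0_norm ?subr_ge0.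
have l4 : U ^+ 4 <= normc (a +i* b) * normc (a +i* b') * (b * b').
  have -> : U ^+ 4 = U * U * (U * U) by ring.
  have U1 := ltW U0.
  apply: ler_pM; [exact: mulr_ge0|exact: mulr_ge0| |].
    apply: ler_pM => //; [exact: le_trans (zn _ b0)|].
    by apply: le_trans (zn _ b'0); exact: le_trans bb.
  by apply: ler_pM => //; exact: le_trans bb.
have u5 : normc (a +i* (b + b')) <= 6 * U.
  apply: le_trans (normc_ReIm _) _ => /=; rewrite gtr0_norm// gtr0_norm ?addr_gt0//; lra.
rewrite -(ler_pM2r (exprn_gt0 4 U0)); apply: le_trans (ler_wpM2l (normc_ge0 _) l4) _.
rewrite E2.
have -> : 6 * a / U ^+ 3 * (b' - b) * U ^+ 4 = (b' - b) * (a * (6 * U)) by field; rewrite gt_eqF.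
by rewrite ler_wpM2l ?subr_ge0// ler_wpM2l// ltW.
Qed.

Lemma slow_exp (q a U h : R) n : 0 < a -> a <= U -> 0 < h -> 0 <= q -> n%:R * h <= U ->
  slow n (h / U) (expR (- (pi * q * a / (10 * U ^+ 2)))) 120
    (fun r => cexp (- (pi * q)%:C * rho a (U + r%:R * h))).
Proof.
move=> a0 aU h0 q0 nh; have U0 : 0 < U by exact: lt_le_trans aU.
have pq : 0 <= pi * q by rewrite mulr_ge0 ?pi_ge0.
have bU (r : nat) : U <= U + r%:R * h by rewrite lerDl mulr_ge0// ltW.
have b2 r : (r <= n)%N -> U + r%:R * h <= 2 * U.
  move=> rn; have : r%:R * h <= n%:R * h by rewrite ler_wpM2r ?(ltW h0)// ler_nat.
  lra.
set x := pi * q * a / (10 * U ^+ 2).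
have x0 : 0 <= x.
  apply: divr_ge0; apply: mulr_ge0; rewrite ?sqr_ge0//; exact: ltW.
have Re_le r : (r <= n)%N -> complex.Re (- (pi * q)%:C * rho a (U + r%:R * h)) <= - (2 * x).
  move=> rn; rewrite cReM /= oppr0 mul0r subr0 mulNr lerN2 /x.
  have -> : 2 * (pi * q * a / (10 * U ^+ 2)) = pi * q * (a / (5 * U ^+ 2)).
    by move: (@pi R) => p; field; rewrite gt_eqF.
  have b0 : 0 < U + r%:R * h by exact: lt_le_trans (bU r).
  rewrite ler_wpM2l// ler_wpM2l ?(ltW a0)// lef_pV2 ?posrE.
  - have h1 : a ^+ 2 <= U ^+ 2 by rewrite lerXn2r// nnegrE ltW.
    have h2 : (U + r%:R * h) ^+ 2 <= (2 * U) ^+ 2.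
      by rewrite lerXn2r ?b2// nnegrE ?mulr_ge0 ?(ltW U0) ?(ltW b0).
    move: h2; rewrite exprMn; lra.
  - by rewrite mulr_gt0 ?exprn_gt0.
  - by rewrite ltr_pwDl ?exprn_gt0// sqr_ge0.
split=> r rn.
  rewrite normc_cexp ler_expR; apply: le_trans (Re_le _ rn) _; lra.
apply: le_trans (cexp_lip (Re_le _ rn) (Re_le _ (ltnW rn))) _.
rewrite -mulrBr normcM normcN normcR (ger0_norm pq).
have bb : U + r%:R * h <= U + r.+1%:R * h.
  by rewrite lerD2l ler_wpM2r ?(ltW h0)// ler_nat.
have := rho_lip a0 aU (bU r) bb (b2 _ rn).
have -> : U + r.+1%:R * h - (U + r%:R * h) = h by rewrite -natr1; ring.
move=> hr; have e0 : 0 <= 2 * expR (- (2 * x)) by rewrite mulr_ge0 ?expR_ge0.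
apply: le_trans (ler_wpM2l e0 (ler_wpM2l pq hr)) _.
have -> : pi * q * (6 * a / U ^+ 3 * h) = 60 * x * (h / U).
  by rewrite /x; move: (@pi R) => p; field; rewrite gt_eqF.
have -> : - (2 * x) = - x + - x by ring.
rewrite expRD.
have xe : x * expR (- x) <= 1.
  rewrite expRN ler_pdivrMr ?expR_gt0// mul1r.
  by apply: le_trans (expR_ge1Dx x); lra.
have hU : 0 <= h / U by rewrite divr_ge0 ?(ltW h0) ?(ltW U0).
have e1 := expR_ge0 (- x); move: (expR _) (h / U) hU xe e1 {e0} => e y y0 xe e0.
rewrite [leLHS](_ : _ = 120 * y * e * (x * e)); last by ring.
rewrite [leRHS](_ : _ = 120 * y * e * 1); last by ring.
by apply: ler_wpM2l => //; apply: mulr_ge0 => //; exact: mulr_ge0.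
Qed.

End slow_amplitudes.

(** * Estimates for one dyadic block *)

Section block_estimates.
Variable R : realType.
Implicit Types (D : seq (R * seq R)) (xi : seq R).

(** The quadratic form dual to [qform D], in the coordinates produced by
    successive Poisson summation. *)
Definition dualq D xi : R := \sum_(p <- zip D xi) p.2 ^+ 2 / p.1.1.

Definition kappa (a : R) D (b : R) : R[i] := \prod_(p <- D) gaussF (p.1 * a) (p.1 * b) 0.

Lemma dualq_ge0 D xi : triangular D -> 0 <= dualq D xi.
Proof.
rewrite /dualq; elim: D xi => [|[q l] D IH] [|x xi] //=; rewrite ?big_nil//.
by move=> /and3P[q0 _ tD]; rewrite big_cons addr_ge0 ?IH// divr_ge0 ?sqr_ge0 ?(ltW q0).
Qed.

Lemma gaussF_prodE (a b : R) D xi : 0 < a -> 0 < b -> triangular D -> size xi = size D ->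
  gaussF_prod a D b xi = kappa a D b * cexp (- (pi * dualq D xi)%:C / (a +i* b)).
Proof.
move=> a0 b0; rewrite /kappa /dualq; elim: D xi => [|[q l] D IH] [|x xi] //=.
  by rewrite !big_nil mulr0 oppr0 mul0r cexp0 mulr1.
move=> /and3P[q0 _ tD] [sx]; rewrite !big_cons /= (IH _ tD sx) (gaussF_formula (mulr_gt0 q0 a0)).
rewrite [LHS]mulrACA -cexpD; congr (_ * cexp _).
have z0 : (a +i* b) != 0 :> R[i] by rewrite eq_complex /= gt_eqF.
have q0' : q%:C != 0 :> R[i] by rewrite eq_complex /= gt_eqF.
have -> : ((q * a) +i* (q * b))%C = q%:C * (a +i* b) by apply: complexP => /=; ring.
have -> : (pi * (x ^+ 2 / q + \sum_(p <- zip D xi) p.2 ^+ 2 / p.1.1))%:C =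
  (pi * x ^+ 2)%:C / q%:C + (pi * \sum_(p <- zip D xi) p.2 ^+ 2 / p.1.1)%:C :> R[i].
  by rewrite -fmorphV -rmorphM -rmorphD; congr _%:C; ring.
move: (q%:C) q0' ((pi * x ^+ 2)%:C) ((pi * _)%:C) (a +i* b) z0 => w w0 u v z z0.
by field; rewrite z0 w0.
Qed.

(** Polynomial decay is all that the lattice sums require, and it factors over
    the coordinates. *)
Lemma prod_lorentz_ge D xi (c s : R) : 0 < c -> 0 < s -> triangular D ->
  all (fun p => 10 * p.1 <= c ^+ 2) D -> size xi = size D ->
  expR (- (dualq D xi / (10 * s ^+ 2))) <= \prod_(t <- xi) (1 + (t / (c * s)) ^+ 2)^-1.
Proof.
move=> c0 s0; rewrite /dualq; elim: D xi => [|[q l] D IH] [|x xi] //=.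
  by rewrite !big_nil mul0r oppr0 expR0.
move=> /and3P[q0 _ tD] /andP[qc cD] [sx]; rewrite !big_cons /= mulrDl opprD expRD.
apply: ler_pM; [exact: expR_ge0|exact: expR_ge0| |exact: IH].
have y0 : 0 <= x ^+ 2 / q / (10 * s ^+ 2).
  by rewrite !divr_ge0 ?sqr_ge0 ?(ltW q0)// mulr_ge0 ?sqr_ge0.
apply: le_trans (expRN_le y0) _.
rewrite lef_pV2 ?posrE ?ltr_pwDl ?sqr_ge0// lerD2l.
have -> : x ^+ 2 / q / (10 * s ^+ 2) = x ^+ 2 / (10 * q * s ^+ 2).
  by field; rewrite !gt_eqF.
rewrite exprMn exprVn exprMn ler_wpM2l ?sqr_ge0// lef_pV2 ?posrE ?mulr_gt0 ?exprn_gt0//.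
by rewrite ler_wpM2r ?sqr_ge0.
Qed.

Definition kappas D : R := \prod_(p <- D) kappa_const p.1.

Lemma kappas_ge0 D : 0 <= kappas D.
Proof. by apply: prodr_ge0 => p _; exact: kappa_const_ge0. Qed.

Lemma slow_kappa (a U h : R) n D : 0 < a -> a <= 1 -> 0 < U -> 0 < h -> triangular D ->
  slow n (h / U) (kappas D / Num.sqrt U ^+ size D) (size D)%:R
    (fun r => kappa a D (U + r%:R * h)).
Proof.
move=> a0 a1 U0 h0; rewrite /kappas /kappa; elim: D => [_|[q l] D IH /= /and3P[q0 _ tD]].
  rewrite big_nil expr0 divr1 mulr0n; split=> r _; rewrite !big_nil; first by rewrite normc1.
  by rewrite subrr normc0 mulr0 mul0r.
have := slow_mul (slow_gaussF0 n q0 a0 a1 U0 h0) (IH tD).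
have E : kappa_const q / Num.sqrt U * ((\prod_(p <- D) kappa_const p.1) / Num.sqrt U ^+ size D) =
   kappa_const q * (\prod_(p <- D) kappa_const p.1) / Num.sqrt U ^+ (size D).+1.
  by rewrite exprS invfM; ring.
rewrite big_cons /= -E -natr1 [_ + 1]addrC.
set W := (X in slow _ _ _ _ X) => H; set W' := (X in slow _ _ _ _ X).
by have -> : W' = W by apply/funext => r; rewrite /W' big_cons.
Qed.

Definition block_const D : R := 2 * (122 + (size D)%:R) * kappas D * (vdc_const R + 20).

Lemma block_const_ge0 D : 0 <= block_const D.
Proof.
apply: mulr_ge0; last by rewrite addr_ge0// vdc_const_ge0.
by apply: mulr_ge0; [exact: mulr_ge0|exact: kappas_ge0].
Qed.

Definition weight (lam h : R) (J r : nat) : R[i] :=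
  ((J%:R - r%:R) / J%:R ^+ 2)%:C * cis (pi * (lam ^+ 2 * (r%:R * h))).

Section one_block.
Variables (lam h : R) (J X : nat) (D : seq (R * seq R)).
Hypotheses (lam1 : 1 <= lam) (h0 : 0 < h) (hlam : h * lam ^+ 6 <= 1) (X0 : (0 < X)%N)
  (XJ : (X + X <= J)%N) (tD : triangular D).
Let a := (lam ^+ 2)^-1.
Let U := X%:R * h.

Let lam0 : 0 < lam. Proof. exact: lt_le_trans lam1. Qed.
Let U0 : 0 < U. Proof. by rewrite mulr_gt0// ltr0n. Qed.
Let a0 : 0 < a. Proof. by rewrite invr_gt0 exprn_gt0. Qed.
Let a1 : a <= 1. Proof. by rewrite invf_le1 ?exprn_gt0// exprn_ege1. Qed.

Let amp q (r : nat) : R[i] := ((J%:R - (X + r)%:R) / J%:R ^+ 2)%:C *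
  (kappa a D (U + r%:R * h) * cexp (- (pi * q)%:C * rho a (U + r%:R * h))).

Let phase q (r : nat) : R := pi * (lam ^+ 2 * (U + r%:R * h) + q / (U + r%:R * h)).

Let block_sumE xi : size xi = size D ->
  \sum_(X <= r < X + X) weight lam h J r * gaussF_prod a D (r%:R * h) xi =
  \sum_(0 <= r < X) amp (dualq D xi) r * cis (phase (dualq D xi) r).
Proof.
move=> sxi; rewrite -{1}[X]add0n big_addn addnK; apply: eq_bigr => r _.
have -> : (r + X)%:R * h = U + r%:R * h by rewrite natrD mulrDl addrC.
have b0 : 0 < U + r%:R * h by rewrite ltr_pwDl// mulr_ge0// ltW.
rewrite gaussF_prodE// cexp_split// /weight /amp /phase addnC mulrDr cisD.
have -> : (X + r)%:R * h = U + r%:R * h by rewrite natrD mulrDl.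
by ring.
Qed.

(** Below [q = lam ^ 4] partial summation separates the oscillation from the
    slowly varying amplitude. Above it the Gaussian factor alone gains more than
    the oscillation would; half of its exponent pays for that gain. *)
Lemma block_oscillating xi : size xi = size D -> 1 <= lam * U -> U <= 1 ->
  normc (\sum_(X <= r < X + X) weight lam h J r * gaussF_prod a D (r%:R * h) xi) <=
  block_const D * (Num.sqrt U / (lam * h)) / J%:R / Num.sqrt U ^+ size D *
  expR (- (dualq D xi / (10 * (lam * U) ^+ 2))).
Proof.
move=> sxi lU U1; rewrite block_sumE//.
have q0 := dualq_ge0 xi tD; move: (dualq D xi) q0 => q q0.
have sU : 0 < Num.sqrt U by rewrite sqrtr_gt0.
have aU : a <= U.
  rewrite /a -[leLHS]mul1r ler_pdivrMr ?exprn_gt0//.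
  have -> : U * lam ^+ 2 = lam * (lam * U) by ring.
  by rewrite -[leLHS]mulr1; apply: ler_pM.
have J0 : 0 < (J%:R : R) by rewrite ltr0n; apply: leq_trans X0 _; apply: leq_trans XJ; exact: leq_addr.
have dl : h / U = (X%:R)^-1 by rewrite /U; field; rewrite !gt_eqF// ltr0n.
have sl : slow X (h / U) (J%:R^-1 * (kappas D / Num.sqrt U ^+ size D *
    expR (- (pi * q * a / (10 * U ^+ 2))))) (1 + ((size D)%:R + 120)) (amp q).
  apply: slow_mul; first by rewrite dl; exact: slow_weight.
  by apply: slow_mul; [exact: slow_kappa|apply: slow_exp].
have x1 : 2 * (q / (10 * (lam * U) ^+ 2)) <= pi * q * a / (10 * U ^+ 2).
  have -> : pi * q * a / (10 * U ^+ 2) = pi * (q / (10 * (lam * U) ^+ 2)).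
    by rewrite /a; move: (@pi R) => p; field; rewrite !gt_eqF.
  by rewrite ler_wpM2r ?pi_ge2// divr_ge0// mulr_ge0// sqr_ge0.
set x := q / _ in x1 *; have xx0 : 0 <= x by rewrite divr_ge0// mulr_ge0// sqr_ge0.
have eK : expR (- (pi * q * a / (10 * U ^+ 2))) <= expR (- x) * expR (- x).
  by rewrite -expRD ler_expR; lra.
have ks0 : 0 <= kappas D / Num.sqrt U ^+ size D.
  by rewrite divr_ge0 ?kappas_ge0// exprn_ge0// ltW.
set K := J%:R^-1 * _ in sl.
have K0 : 0 <= K.
  apply: mulr_ge0; first by rewrite invr_ge0 ltW.
  by apply: mulr_ge0 => //; exact: expR_ge0.
have KE : K <= J%:R^-1 * (kappas D / Num.sqrt U ^+ size D * (expR (- x) * expR (- x))).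
  by rewrite /K ler_wpM2l ?invr_ge0 ?(ltW J0)// ler_wpM2l.
pose Q0 := kappas D / J%:R / Num.sqrt U ^+ size D * expR (- x).
have Q00 : 0 <= Q0.
  rewrite /Q0; apply: mulr_ge0; last exact: expR_ge0.
  by rewrite mulrAC; apply: mulr_ge0 => //; rewrite invr_ge0 ltW.
have e1 : expR (- x) <= 1 by rewrite expR_le1 oppr_le0.
have KQ : K <= Q0 * expR (- x).
  by apply: le_trans KE _; rewrite /Q0 le_eqVlt; apply/orP; left; apply/eqP; ring.
have L0 : 0 <= Num.sqrt U / (lam * h) by rewrite divr_ge0 ?mulr_ge0// ltW.
have -> : block_const D * (Num.sqrt U / (lam * h)) / J%:R / Num.sqrt U ^+ size D * expR (- x) =
   (vdc_const R + 20) * (Num.sqrt U / (lam * h)) * (2 * Q0 * (122 + (size D)%:R)).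
  by rewrite /block_const /Q0; ring.
have v0 := vdc_const_ge0 R.
have [ql|/ltW ql] := leP q (lam ^+ 4).
  have X1 : X%:R * (h / U) <= 1 by rewrite mulrA mulfV// gt_eqF.
  apply: le_trans (slow_sum (La := vdc_const R * (Num.sqrt U / (lam * h))) _ K0 X1 sl _) _.
  - by rewrite !addr_ge0.
  - move=> r rX; apply: block_phase_sum => //.
    by rewrite ler_wpM2r ?(ltW h0)// ler_nat.
  - apply: ler_pM.
    + exact: mulr_ge0.
    + by apply: mulr_ge0; [exact: mulr_ge0|rewrite !addr_ge0].
    + by rewrite ler_wpM2r//; lra.
    + have -> : 1 + (1 + ((size D)%:R + 120)) = 122 + (size D)%:R :> R by ring.
      rewrite ler_wpM2r ?addr_ge0// ler_wpM2l//; apply: le_trans KQ _.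
      by rewrite ler_piMr.
have tri : normc (\sum_(0 <= r < X) amp q r * cis (phase q r)) <= X%:R * K.
  apply: le_trans (normc_sum _ _ _) _.
  apply: (@le_trans _ _ (\sum_(0 <= r < X) K)); last by rewrite sumr_const_nat subn0 mulr_natl.
  rewrite big_nat [leRHS]big_nat; apply: ler_sum => r /andP[_ rX].
  by rewrite normcM normc_cis mulr1; apply: (proj1 sl); exact: ltnW.
apply: le_trans tri _; apply: (@le_trans _ _ (X%:R * (Q0 * expR (- x)))); first by rewrite ler_wpM2l.
have xe : x * expR (- x) <= 1.
  rewrite expRN ler_pdivrMr ?expR_gt0// mul1r.
  by apply: le_trans (expR_ge1Dx x); lra.
have l2 : lam ^+ 2 <= 10 * x.
  have -> : 10 * x = q / (lam * U) ^+ 2 by rewrite /x; field; rewrite !gt_eqF.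
  rewrite (ler_pdivlMr _ _ (exprn_gt0 2 (mulr_gt0 lam0 U0))); apply: (le_trans _ ql).
  have -> : lam ^+ 4 = lam ^+ 2 * lam ^+ 2 by ring.
  have lU4 : (lam * U) ^+ 2 <= lam ^+ 2.
    rewrite lerXn2r ?nnegrE ?(ltW lam0)//; last by rewrite ler_piMr// ltW.
    by apply: mulr_ge0; exact: ltW.
  by rewrite ler_wpM2l ?sqr_ge0.
have key : X%:R * expR (- x) <= 20 * (Num.sqrt U / (lam * h)).
  have -> : X%:R * expR (- x) = U * expR (- x) / h by rewrite /U; field; rewrite gt_eqF.
  have -> : 20 * (Num.sqrt U / (lam * h)) = 20 * (Num.sqrt U * lam^-1) / h.
    by field; rewrite !gt_eqF.
  have UsU : U <= Num.sqrt U.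
    by rewrite -[leLHS]sqr_sqrtr ?(ltW U0)// expr2 ler_piMr ?(ltW sU)// -sqrtr1 ler_wsqrtr.
  have el : expR (- x) <= 10 / lam.
    rewrite ler_pdivlMr//; have := ler_wpM2r (expR_ge0 (- x)) l2.
    have l3 : lam <= lam ^+ 2 by rewrite expr2 ler_peMr// ltW.
    have := ler_wpM2r (expR_ge0 (- x)) l3; move: (expR _) xe => e; nra.
  rewrite ler_wpM2r ?invr_ge0 ?(ltW h0)//.
  have i0 : 0 <= lam^-1 by rewrite invr_ge0 ltW.
  have := ler_pM (ltW U0) (expR_ge0 (- x)) UsU el; have := mulr_ge0 (ltW sU) i0.
  move: (expR _) (lam^-1) (Num.sqrt U) => e il s; lra.
rewrite mulrCA; apply: le_trans (ler_wpM2l Q00 key) _.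
have n0 : 0 <= (size D)%:R :> R by [].
have Y0 := mulr_ge0 Q00 L0.
move: (Num.sqrt U / (lam * h)) ((size D)%:R) n0 (vdc_const R) v0 Y0 => L n n0 v v0 Y0.
have -> : Q0 * (20 * L) = (20 * 1) * (Q0 * L) by ring.
have -> : (v + 20) * L * (2 * Q0 * (122 + n)) = ((v + 20) * (2 * (122 + n))) * (Q0 * L) by ring.
by rewrite ler_wpM2r//; apply: ler_pM => //; lra.
Qed.

(** At times below [1 / lam] there is no cancellation to exploit, and the width of
    the dual Gaussians is at most one. *)
Lemma block_trivial xi : size xi = size D -> lam * U <= 1 ->
  normc (\sum_(X <= r < X + X) weight lam h J r * gaussF_prod a D (r%:R * h) xi) <=
  block_const D * X%:R / J%:R / Num.sqrt U ^+ size D *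
  expR (- (dualq D xi / (10 * 1 ^+ 2))).
Proof.
move=> sxi lU; have q0 := dualq_ge0 xi tD.
have J0 : 0 < (J%:R : R) by rewrite ltr0n; apply: leq_trans X0 _; apply: leq_trans XJ; exact: leq_addr.
have pq : 0 <= pi * dualq D xi by rewrite mulr_ge0 ?pi_ge0.
have term r : (r < X)%N -> normc (weight lam h J (r + X) * gaussF_prod a D ((r + X)%:R * h) xi) <=
    kappas D / J%:R / Num.sqrt U ^+ size D * expR (- (dualq D xi / (10 * 1 ^+ 2))).
  move=> rX; have -> : (r + X)%:R * h = U + r%:R * h by rewrite natrD mulrDl addrC.
  have b0 : 0 < U + r%:R * h by rewrite ltr_pwDl// mulr_ge0// ltW.
  have bU : U + r%:R * h <= 2 * U.
    have : r%:R * h <= U by rewrite ler_wpM2r ?(ltW h0)// ler_nat ltnW.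
    lra.
  rewrite gaussF_prodE// /weight normcM [normc (_ * cis _)]normcM normc_cis mulr1.
  rewrite [normc (kappa _ _ _ * _)]normcM normc_cexp.
  have [sw _] := slow_weight R X0 XJ; have := sw r (ltnW rX); rewrite addnC => w1.
  have [sk _] := slow_kappa X a0 a1 U0 h0 tD; have k1 := sk r (ltnW rX).
  have -> : kappas D / J%:R / Num.sqrt U ^+ size D * expR (- (dualq D xi / (10 * 1 ^+ 2))) =
    J%:R^-1 * (kappas D / Num.sqrt U ^+ size D * expR (- (dualq D xi / (10 * 1 ^+ 2)))) by ring.
  apply: ler_pM; rewrite ?normc_ge0//; first by apply: mulr_ge0; [exact: normc_ge0|exact: expR_ge0].
  apply: ler_pM; rewrite ?normc_ge0 ?expR_ge0// ler_expR.
  have n2 : 0 < a ^+ 2 + (U + r%:R * h) ^+ 2 by rewrite ltr_pwDl ?exprn_gt0// sqr_ge0.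
  have -> : complex.Re (- (pi * dualq D xi)%:C / (a +i* (U + r%:R * h))) =
     - (pi * dualq D xi * (a / (a ^+ 2 + (U + r%:R * h) ^+ 2))).
    by rewrite cReM /=; move: (pi * _) => y; ring.
  rewrite lerN2 expr1n mulr1.
  have a5 : 5^-1 <= a / (a ^+ 2 + (U + r%:R * h) ^+ 2).
    rewrite ler_pdivlMr// mulrC ler_pdivrMr//.
    have b2 : (U + r%:R * h) ^+ 2 <= 4 * a.
      have -> : 4 * a = (2 / lam) ^+ 2 by rewrite /a; field; rewrite gt_eqF.
      rewrite lerXn2r ?nnegrE ?divr_ge0 ?(ltW b0) ?(ltW lam0)//.
      rewrite ler_pdivlMr//; apply: le_trans (ler_wpM2r (ltW lam0) bU) _.
      by rewrite -mulrA [X in _ * X]mulrC ler_piMr.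
    have : a ^+ 2 <= a by rewrite expr2 ler_piMr// ltW.
    lra.
  apply: le_trans (ler_wpM2l pq a5); have := ler_wpM2r q0 (@pi_ge2 R).
  rewrite -mulrA; move: (pi * dualq D xi) (dualq D xi) q0 => u v *; lra.
rewrite -{1}[X]add0n big_addn addnK; apply: le_trans (normc_sum _ _ _) _.
set Y := kappas D / _ / _ * _ in term.
have Y0 : 0 <= Y by apply: le_trans (normc_ge0 _) (term 0%N X0).
apply: (@le_trans _ _ (\sum_(0 <= r < X) Y)).
  by rewrite big_nat [leRHS]big_nat; apply: ler_sum => r /andP[_ rX]; exact: term.
rewrite sumr_const_nat subn0 -[Y *+ X]mulr_natl.
have -> : block_const D * X%:R / J%:R / Num.sqrt U ^+ size D * expR (- (dualq D xi / (10 * 1 ^+ 2))) =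
   (2 * (122 + (size D)%:R) * (vdc_const R + 20)) * (X%:R * Y) by rewrite /block_const /Y; ring.
rewrite ler_peMl//; first exact: mulr_ge0.
have v0 := vdc_const_ge0 R; have := ler0n R (size D); move: (vdc_const R) v0 (_%:R) => v v0 n n0; nra.
Qed.

End one_block.

End block_estimates.

(** * The kernel of a range of times *)

Section kernel_estimate.
Variable R : realType.
Implicit Types (D : seq (R * seq R)).

Lemma sum_geometric_down (y : nat -> R) m : (forall i, 0 <= y i) ->
  (forall i, y i.+1 <= 3 / 4 * y i) -> \sum_(0 <= i < m) y i <= 4 * y 0%N.
Proof.
move=> y0 ys; suff : \sum_(0 <= i < m) y i <= 4 * (y 0%N - y m) by have := y0 m; lra.
elim: m => [|m IH]; first by rewrite big_geq// subrr mulr0.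
by rewrite big_nat_recr//=; have := ys m; lra.
Qed.

Lemma sum_geometric_up (z : nat -> R) m : (forall i, 0 <= z i) ->
  (forall i, 2 * z i <= z i.+1) -> \sum_(0 <= i < m) z i <= z m.
Proof.
move=> z0 zs; elim: m => [|m IH]; first by rewrite big_geq.
by rewrite big_nat_recr//=; have := zs m; lra.
Qed.

Lemma sum_dyadic_blocks (V : nmodType) (F : nat -> V) (r0 m : nat) :
  \sum_(r0 <= r < r0 * 2 ^ m) F r =
  \sum_(0 <= i < m) \sum_(r0 * 2 ^ i <= r < r0 * 2 ^ i + r0 * 2 ^ i) F r.
Proof.
elim: m => [|m IH]; first by rewrite expn0 muln1 !big_geq.
rewrite big_nat_recr//= -IH addnn -mul2n mulnCA -expnS -big_cat_nat//=.
  by rewrite leq_pmulr// expn_gt0.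
by rewrite leq_mul2l leq_pexp2l ?orbT.
Qed.

Lemma bounded_dilation D : triangular D -> exists2 c : R, 1 <= c &
  all (fun p => 10 * p.1 <= c ^+ 2) D.
Proof.
elim: D => [|[q l] D IH]; first by exists 1.
move=> /and3P[q0 _ /IH[c c1 cD]]; exists (c + 10 * q) => [|/=]; first by have := ltW q0; lra.
have q0' := ltW q0; apply/andP; split; first by nra.
apply: sub_all cD => p /= h; apply: le_trans h _.
by rewrite lerXn2r ?nnegrE; lra.
Qed.

Lemma dyadic_block_size (c lam s h J K : R) n : 1 <= c -> 1 <= lam -> 0 < s -> 0 < h -> 0 < J ->
  0 <= K -> 1 <= lam * s ^+ 2 ->
  K * (s / (lam * h)) / J / s ^+ n.+2 * (4 * (1 + c * (lam * s ^+ 2))) ^+ n.+2 <=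
  K * (8 * c) ^+ n.+2 * ((h * J)^-1 * (lam ^+ n.+1 * s ^+ n.+3)).
Proof.
move=> c1 l1 s0 h0 J0 K0 ls; have l0 : 0 < lam by exact: lt_le_trans l1.
have c0 : 0 < c by exact: lt_le_trans c1.
have e1 : (4 * (1 + c * (lam * s ^+ 2))) ^+ n.+2 <= (8 * c * (lam * s ^+ 2)) ^+ n.+2.
  have : 1 <= c * (lam * s ^+ 2) by rewrite -[leLHS]mulr1; apply: ler_pM.
  move: (lam * s ^+ 2) => y h1; rewrite lerXn2r ?nnegrE//; lra.
have k0 : 0 <= K * (s / (lam * h)) / J / s ^+ n.+2.
  apply: divr_ge0; last by rewrite exprn_ge0// ltW.
  by apply: divr_ge0; [rewrite mulr_ge0// divr_ge0 ?mulr_ge0// ltW|exact: ltW].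
apply: le_trans (ler_wpM2l k0 e1) _.
rewrite le_eqVlt; apply/orP; left; apply/eqP.
have -> : (8 * c * (lam * s ^+ 2)) ^+ n.+2 = (8 * c) ^+ n.+2 * (lam * lam ^+ n.+1) * (s ^+ n.+2 * s ^+ n.+2).
  by rewrite exprMn (exprMn _ lam) -exprM mulnC exprM [(s ^+ n.+2) ^+ 2]expr2 [lam ^+ n.+2]exprS mulrA.
rewrite [s ^+ n.+3]exprS.
by have := exprn_gt0 n.+2 s0; move: (s ^+ n.+2) => S S0; field; rewrite !gt_eqF.
Qed.

Lemma short_block_size (c s h J K X : R) n : 1 <= c -> 0 < s -> 0 < h -> 0 < J -> 0 <= K ->
  X * h = s ^+ 2 ->
  K * X / J / s ^+ n.+2 * (4 * (1 + c)) ^+ n.+2 <=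
  K * (8 * c) ^+ n.+2 * ((h * J)^-1 * (s ^+ n)^-1).
Proof.
move=> c1 s0 h0 J0 K0 Xh.
have XE : X = s ^+ 2 / h by rewrite -Xh mulfK// gt_eqF.
have X0 : 0 <= X by rewrite XE divr_ge0 ?sqr_ge0 ?ltW.
have e1 : (4 * (1 + c)) ^+ n.+2 <= (8 * c) ^+ n.+2 by rewrite lerXn2r ?nnegrE//; lra.
have k0 : 0 <= K * X / J / s ^+ n.+2.
  apply: divr_ge0; last by rewrite exprn_ge0// ltW.
  by apply: divr_ge0; [exact: mulr_ge0|exact: ltW].
apply: le_trans (ler_wpM2l k0 e1) _.
rewrite le_eqVlt; apply/orP; left; apply/eqP.
rewrite XE [s ^+ n.+2]exprS [s ^+ n.+1]exprS.
by have := exprn_gt0 n s0; move: (s ^+ n) => S S0; field; rewrite !gt_eqF.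
Qed.

(** Blocks of times [b] around [U] contribute a geometric series: decreasing in
    [U] while [lam * U <= 1], increasing afterwards. *)
Lemma kernel_estimate D (n : nat) : triangular D -> size D = n.+3 -> exists2 C : R, 0 <= C &
  forall (lam h : R) (r0 m N0 : nat), 1 <= lam -> 0 < h -> h * lam ^+ 6 <= 1 ->
    (0 < r0)%N -> (r0 * 2 ^ m)%:R * h <= 1 ->
  exists Ns, [/\ size Ns = n.+3, all (leq N0) Ns & forall x, size x = n.+3 ->
    normc (\sum_(k <- box Ns) \sum_(r0 <= r < r0 * 2 ^ m)
      weight lam h (r0 * 2 ^ m) r *
        (chirp (lam ^+ 2)^-1 (r%:R * h) (qform D k) * cis (2 * pi * dot x k))) <=
    C / (h * (r0 * 2 ^ m)%:R) * ((Num.sqrt (r0%:R * h) ^+ n.+1)^-1 +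
      lam ^+ n.+2 * Num.sqrt ((r0 * 2 ^ m)%:R * h) ^+ n.+4)].
Proof.
move=> tD sD; have [c c1 cD] := bounded_dilation tD.
have c0 : 0 < c by exact: lt_le_trans c1.
pose K := block_const D; have K0 : 0 <= K by exact: block_const_ge0.
pose C1 := K * (8 * c) ^+ n.+3.
have C10 : 0 <= C1 by rewrite /C1 mulr_ge0// exprn_ge0// mulr_ge0// ltW.
exists (4 * C1 + 1); first by rewrite addr_ge0// mulr_ge0.
move=> lam h r0 m N0 l1 h0 hl r00; set J := (r0 * 2 ^ m)%N => Jh1.
have l0 : 0 < lam by exact: lt_le_trans l1.
have a0 : 0 < (lam ^+ 2)^-1 by rewrite invr_gt0 exprn_gt0.
have J0 : (0 < J)%N by rewrite muln_gt0 r00 expn_gt0.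
have JR : 0 < J%:R :> R by rewrite ltr0n.
pose X i := (r0 * 2 ^ i)%N; have X0 i : (0 < X i)%N by rewrite muln_gt0 r00 expn_gt0.
pose U i := (X i)%:R * h; have U0 i : 0 < U i by rewrite mulr_gt0// ltr0n.
pose s i := Num.sqrt (U i); have s0 i : 0 < s i by rewrite sqrtr_gt0.
have sU i : U i = s i ^+ 2 by rewrite sqr_sqrtr// ltW.
pose V i := if 1 <= lam * U i then lam * U i else 1.
have V0 i : 0 < V i by rewrite /V; case: ifP => // _; exact: mulr_gt0.
pose phi i t := (1 + (t / (c * V i)) ^+ 2)^-1.
have phi0 i t : 0 <= phi i t by rewrite invr_ge0 addr_ge0// sqr_ge0.
have phis i x M : \sum_(k <- zr M) phi i (x - k%:~R) <= 4 * (1 + c * V i).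
  by apply: sum_lorentz; exact: mulr_gt0.
pose A i := if 1 <= lam * U i then s i / (lam * h) else (X i)%:R.
pose B i := K * A i / J%:R / s i ^+ n.+3.
have B0 i : 0 <= B i.
  have A0 : 0 <= A i.
    by rewrite /A; case: ifP => // _; apply: divr_ge0; [exact: ltW|apply: mulr_ge0; exact: ltW].
  apply: divr_ge0; last by rewrite exprn_ge0// ltW.
  by apply: divr_ge0; [exact: mulr_ge0|exact: ltW].
have block i xi : (i < m)%N -> size xi = size D ->
   normc (\sum_(X i <= r < X i + X i) weight lam h J r *
      gaussF_prod (lam ^+ 2)^-1 D (r%:R * h) xi) <= B i * \prod_(t <- xi) phi i t.
  move=> im sxi; have XJ : (X i + X i <= J)%N.
    by rewrite addnn -mul2n /X mulnCA -expnS leq_mul2l leq_pexp2l ?orbT.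
  have U1 : U i <= 1.
    apply: le_trans Jh1; rewrite /U ler_wpM2r ?(ltW h0)// ler_nat.
    by apply: leq_trans XJ; exact: leq_addr.
  have := prod_lorentz_ge c0 (V0 i) tD cD sxi.
  have := B0 i; rewrite /B /A /phi /V; case: ifPn => [lU|lU] b0 hp.
    apply: le_trans (block_oscillating l1 h0 hl (X0 i) XJ tD sxi lU U1) _.
    by rewrite sD -/(s i) -/K; apply: ler_wpM2l.
  rewrite -ltNge in lU.
  apply: le_trans (block_trivial l1 h0 (X0 i) XJ tD sxi (ltW lU)) _.
  by rewrite sD -/(s i) -/K; apply: ler_wpM2l.
have hJ0 : 0 < (h * J%:R)^-1 by rewrite invr_gt0 mulr_gt0.
have [Ns [sN aN HN]] := kernel_bound a0 (index_iota r0 J) (fun r => r%:R * h)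
  (index_iota 0 m) phi0 phis tD N0 hJ0.
exists Ns; split => // [|x sx]; first by rewrite sN.
have sx' : size x = size D by rewrite sx.
apply: le_trans (HN (weight lam h J) x B sx' B0 _) _.
  move=> xi sxi; rewrite sum_dyadic_blocks.
  apply: le_trans (normc_sum _ _ _) _; rewrite big_nat [leRHS]big_nat.
  by apply: ler_sum => i /andP[_ im]; exact: block.
have sr i : s i.+1 = Num.sqrt 2 * s i.
  rewrite /s -sqrtrM// /U /X expnS mulnCA natrM mulrA; congr Num.sqrt.
have r2 : Num.sqrt 2 ^+ 2 = 2 :> R by rewrite sqr_sqrtr.
have r20 : 0 < Num.sqrt 2 :> R by rewrite sqrtr_gt0.
have r43 : 4 / 3 <= Num.sqrt 2 :> R.
  by rewrite -(@ler_pXn2r _ 2) ?nnegrE ?(ltW r20)// r2 expr2; lra.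
have r21 : 1 <= Num.sqrt 2 :> R by lra.
pose y i := (s i ^+ n.+1)^-1; pose z i := s i ^+ n.+4.
have y0 i : 0 <= y i by rewrite invr_ge0 exprn_ge0// ltW.
have z0 i : 0 <= z i by rewrite exprn_ge0// ltW.
have ys i : y i.+1 <= 3 / 4 * y i.
  rewrite /y sr exprMn invfM; apply: ler_wpM2r; first exact: (y0 i).
  have -> : 3 / 4 = (4 / 3)^-1 :> R by field.
  rewrite lef_pV2 ?posrE ?exprn_gt0//; apply: le_trans r43 _.
  by rewrite exprS ler_peMr ?(ltW r20)// exprn_ege1.
have zs i : 2 * z i <= z i.+1.
  by rewrite /z sr exprMn; apply: ler_wpM2r; [exact: (z0 i)|rewrite -[leLHS]r2 ler_weXn2l].
have term i : B i * (4 * (1 + c * V i)) ^+ size D <=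
   C1 / (h * J%:R) * (y i + lam ^+ n.+2 * z i).
  have Cj : 0 <= C1 / (h * J%:R) by apply: mulr_ge0 => //; exact: ltW.
  rewrite [leRHS]mulrDr sD /B /A /V; case: ifPn => lU.
    rewrite sU; rewrite sU in lU.
    apply: le_trans (dyadic_block_size n.+1 c1 l1 (s0 i) h0 JR K0 lU) _.
    rewrite -/C1 [leLHS]mulrA lerDr; exact: mulr_ge0.
  rewrite mulr1; apply: le_trans (short_block_size n.+1 c1 (s0 i) h0 JR K0 (sU i)) _.
  rewrite -/C1 [leLHS]mulrA lerDl; apply: mulr_ge0 => //; apply: mulr_ge0 => //.
  by rewrite exprn_ge0// ltW.
have sumB : \sum_(i <- index_iota 0 m) B i * (4 * (1 + c * V i)) ^+ size D <=
   4 * C1 / (h * J%:R) * (y 0%N + lam ^+ n.+2 * z m).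
  apply: (@le_trans _ _ (\sum_(0 <= i < m) C1 / (h * J%:R) * (y i + lam ^+ n.+2 * z i))).
    by apply: ler_sum => i _; exact: term.
  rewrite -mulr_sumr big_split /= -mulr_sumr.
  have Y := sum_geometric_down m y0 ys; have Z := sum_geometric_up m z0 zs.
  have -> : 4 * C1 / (h * J%:R) * (y 0%N + lam ^+ n.+2 * z m) =
     C1 / (h * J%:R) * (4 * y 0%N + 4 * (lam ^+ n.+2 * z m)) by ring.
  apply: ler_wpM2l; first by apply: mulr_ge0 => //; exact: ltW.
  apply: lerD => //; have lp : 0 <= lam ^+ n.+2 by rewrite exprn_ge0// ltW.
  apply: le_trans (ler_wpM2l lp Z) _; rewrite ler_peMl ?ler1n//.
  by apply: mulr_ge0 => //; exact: z0.
have cw r : (r <= J)%N -> normc (weight lam h J r) <= J%:R^-1.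
  move=> rJ; rewrite /weight normcM normc_cis mulr1 normcR ger0_norm.
    rewrite ler_pdivrMr ?exprn_gt0//.
    have -> : J%:R^-1 * J%:R ^+ 2 = J%:R :> R by field; rewrite gt_eqF.
    by rewrite lerBlDr lerDl.
  by rewrite divr_ge0 ?sqr_ge0// subr_ge0 ler_nat.
have sumc : \sum_(r <- index_iota r0 J) normc (weight lam h J r) <= 1.
  apply: (@le_trans _ _ (\sum_(r0 <= r < J) J%:R^-1)).
    by rewrite big_nat [leRHS]big_nat; apply: ler_sum => r /andP[_ /ltnW/cw].
  by rewrite sumr_const_nat -[leLHS]mulr_natl ler_pdivrMr// mul1r ler_nat leq_subr.
have y1 : 1 <= y 0%N.
  rewrite /y invf_ge1 ?exprn_gt0// expr_le1 ?(ltW (s0 0%N))//.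
  rewrite /s -sqrtr1 ler_wsqrtr//; apply: le_trans Jh1; rewrite /U ler_wpM2r ?(ltW h0)//.
  by rewrite ler_nat /X expn0 muln1 leq_pmulr// expn_gt0.
have -> : Num.sqrt (r0%:R * h) = s 0%N by rewrite /s /U /X expn0 muln1.
rewrite -/(y 0%N) -/(z m).
have lz : 0 <= lam ^+ n.+2 * z m by rewrite mulr_ge0// exprn_ge0// ltW.
have hh := ler_wpM2l (ltW hJ0) sumc; rewrite mulr1 in hh.
apply: le_trans (lerD sumB hh) _.
move: (h * J%:R) hJ0 => w w0.
have := ler_wpM2l (ltW w0) (_ : 1 <= y 0%N + lam ^+ n.+2 * z m).
move=> /(_ (ler_wpDr lz y1)); move: (y 0%N + _) => v; rewrite mulr1.
have -> : 4 * C1 / w * v = 4 * C1 * (w^-1 * v) by ring.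
have -> : (4 * C1 + 1) / w * v = 4 * C1 * (w^-1 * v) + w^-1 * v by ring.
by move=> ?; rewrite lerD2l.
Qed.

End kernel_estimate.

(** * Triangular coordinates *)

Section triangular_coordinates.
Variable R : realType.

Definition seq_of (T : Type) d (k : 'rV[T]_d) : seq T := [seq k 0 i | i <- enum 'I_d].

Definition row_of d (s : seq int) : 'rV[int]_d := \row_i nth 0 s i.

Lemma size_seq_of T d (k : 'rV[T]_d) : size (seq_of k) = d.
Proof. by rewrite size_map size_enum_ord. Qed.

Lemma seq_ofK d : cancel (@seq_of int d) (@row_of d).
Proof.
move=> k; apply/rowP => i; rewrite mxE (nth_map i) ?size_enum_ord//.
by rewrite nth_ord_enum.
Qed.

Lemma row_ofK d (s : seq int) : size s = d -> seq_of (row_of d s) = s.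
Proof.
move=> sd; apply: (@eq_from_nth _ 0) => [|i]; rewrite size_seq_of ?sd// => id.
rewrite (nth_map (Ordinal id)) ?size_enum_ord// mxE.
by rewrite nth_enum_ord.
Qed.

Lemma seq_of_cons T n (k : 'rV[T]_(1 + n)) : seq_of k = k 0 0 :: seq_of (rsubmx k).
Proof.
rewrite /seq_of enum_ordSl /=; congr (_ :: _); rewrite -map_comp; apply: eq_map => i /=.
by rewrite mxE; congr (k 0 _); apply: val_inj.
Qed.

Lemma dot_seq_of d (l : 'rV[R]_d) (k : 'rV[int]_d) :
  dot (seq_of l) (seq_of k) = \sum_i l 0 i * (k 0 i)%:~R.
Proof.
rewrite /dot /seq_of zip_map big_map big_enum /=.
by apply: eq_bigl => i; rewrite inE.
Qed.

(** Completing the square in the first variable, and induction. *)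
Lemma triangular_coordinates d (Q : 'rV[R]_d -> R) :
  quadratic_form Q -> positive_definite Q -> exists D : seq (R * seq R),
  [/\ triangular D, size D = d & forall k, Q (map_mx intr k) = qform D (seq_of k)].
Proof.
elim: d Q => [|n IH] Q [A QA] Qpos.
  exists [::]; split => // k; have -> : map_mx intr k = 0 :> 'rV[R]_0 by apply/rowP => -[].
  by rewrite QA mul0mx mul0mx mxE.
have {IH} IHn (Q' : 'rV[R]_n -> R) := IH Q'.
have tr00 (M : 'M[R]_1) : M 0 0 = M^T 0 0 by rewrite mxE.
pose A1 : 'M[R]_(1 + n) := A.
pose b (x y : 'rV[R]_(1 + n)) : R := (x *m A1 *m y^T) 0 0.
have bDl (x y z : 'rV[R]_(1 + n)) : b (x + y) z = b x z + b y z by rewrite /b !mulmxDl mxE.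
have bDr (x y z : 'rV[R]_(1 + n)) : b x (y + z) = b x y + b x z by rewrite /b linearD mulmxDr mxE.
have bZl c (x z : 'rV[R]_(1 + n)) : b (c *: x) z = c * b x z by rewrite /b -!scalemxAl mxE.
have bZr c (x z : 'rV[R]_(1 + n)) : b x (c *: z) = c * b x z by rewrite /b linearZ -scalemxAr mxE.
have QE (x : 'rV[R]_(1 + n)) : Q x = b x x by exact: QA.
pose e0 : 'rV[R]_(1 + n) := row_mx 1%:M 0.
pose em : 'M[R]_(n, 1 + n) := row_mx 0 1%:M.
pose q := b e0 e0.
have q0 : 0 < q.
  rewrite /q -QE; apply: Qpos; apply/eqP => /(congr1 (@lsubmx R 1 1 n)).
  by rewrite row_mxKl linear0 => /matrixP /(_ 0 0) /eqP; rewrite !mxE oner_eq0.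
pose w : 'cV[R]_n := em *m A1 *m e0^T + em *m A1^T *m e0^T.
pose l : 'cV[R]_n := (2 * q)^-1 *: w.
have cross (y : 'rV[R]_n) : b e0 (y *m em) + b (y *m em) e0 = (y *m w) 0 0.
  have -> : b e0 (y *m em) = (y *m (em *m A1^T *m e0^T)) 0 0.
    by rewrite /b tr00 !trmx_mul !trmxK !mulmxA.
  by rewrite /w mulmxDr [RHS]mxE addrC; congr (_ + _); rewrite /b !mulmxA.
pose N : 'M[R]_(n, 1 + n) := em - l *m e0.
have NE (y : 'rV[R]_n) : y *m N = y *m em - (y *m l) 0 0 *: e0.
  by rewrite /N mulmxBr mulmxA; set M := y *m l; rewrite [in LHS](mx11_scalar M) mul_scalar_mx.
have ortho (y : 'rV[R]_n) : b e0 (y *m N) + b (y *m N) e0 = 0.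
  rewrite NE -!scaleNr bDr bDl bZr bZl addrACA cross -/q.
  rewrite /l -scalemxAr; have -> : ((2 * q)^-1 *: (y *m w)) 0 0 = (2 * q)^-1 * (y *m w) 0 0 by rewrite [LHS]mxE.
  move: ((y *m w) 0 0) => W.
  by field; rewrite gt_eqF.
have decomp (t : R) (y : 'rV[R]_n) : row_mx t%:M y = (t + (y *m l) 0 0) *: e0 + y *m N.
  rewrite NE scalerDl -addrA [X in _ + X]addrCA subrr addr0.
  by rewrite /e0 /em scale_row_mx scale_scalar_mx mulr1 scaler0 mul_mx_row mulmx0 mulmx1
    add_row_mx addr0 add0r.
have QN (t : R) (y : 'rV[R]_n) :
    Q (row_mx t%:M y) = q * ((y *m l) 0 0 + t) ^+ 2 + Q (y *m N).
  rewrite !QE decomp; set s := t + _; rewrite bDl !bDr !bZl !bZr -/q.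
  have := ortho y; move: (y *m N) => p; move: (b e0 p) (b p e0) (b p p) => u v z uv.
  have -> : s * (s * q) + s * u + (s * v + z) = q * s ^+ 2 + s * (u + v) + z by ring.
  by rewrite uv mulr0 addr0 /s addrC [t + _]addrC addrC.
have [] := IHn (fun y => Q (y *m N)).
- exists (N *m A *m N^T) => y; rewrite QA; congr (_ 0 0).
  by rewrite trmx_mul !mulmxA.
- move=> y y0; apply: Qpos; apply: contra_neq y0 => yN.
  have : row_mx (- (y *m l) 0 0)%:M y = 0 :> 'rV[R]_(1 + n).
    by rewrite decomp addNr scale0r add0r yN.
  by move/(congr1 rsubmx); rewrite row_mxKr linear0.
move=> D [tD sD HD]; exists ((q, seq_of l^T) :: D); split => [/=||k].
- by rewrite q0 tD size_seq_of sD eqxx.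
- by rewrite /= sD.
pose k' : 'rV[int]_(1 + n) := k.
have -> : map_mx intr k = row_mx (k 0 0)%:~R%:M (map_mx intr (rsubmx k')) :> 'rV[R]_(1 + n).
  rewrite -[LHS](@hsubmxK _ 1 1 n) -map_rsubmx; congr row_mx.
  apply/rowP => i; rewrite !mxE ord1 eqxx mulr1n; congr (k _ _)%:~R.
  by apply: val_inj.
rewrite QN HD (@seq_of_cons _ n k) /= dot_seq_of; congr (_ * (_ + _) ^+ 2 + _).
by rewrite mxE; apply: eq_bigr => i _; rewrite !mxE mulrC.
Qed.

Lemma torus_char_dot d (k : 'rV[int]_d) (x y : d.-tuple R) :
  torus_char k y * (torus_char k x)^*%C =
  cis (2 * pi * dot [seq p.1 - p.2 | p <- zip y x] (seq_of k)).
Proof.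
rewrite !torus_char_cis cisJ -cisD -mulrN -mulrDr; congr (cis (_ * _)).
rewrite -sumrN -big_split /=.
have -> : [seq p.1 - p.2 | p <- zip y x] = seq_of (\row_i (tnth y i - tnth x i)).
  apply: (@eq_from_nth _ 0).
    by rewrite size_seq_of size_map size_zip !size_tuple minnn.
  rewrite size_map size_zip !size_tuple minnn => i id.
  rewrite (nth_map (0, 0)) ?size_zip ?size_tuple ?minnn// nth_zip ?size_tuple//=.
  rewrite /seq_of (nth_map (Ordinal id)) ?size_enum_ord// mxE.
  have -> : nth (Ordinal id) (enum 'I_d) i = Ordinal id by apply: val_inj; rewrite /= nth_enum_ord.
  by rewrite !(tnth_nth 0).
rewrite dot_seq_of; apply: eq_bigr => i _; rewrite mxE; ring.
Qed.

End triangular_coordinates.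

(** * A Fejer majorant and level sets at one scale *)

Transparent chirp.

Section fejer_multiplier.
Variable R : realType.

(** The left-hand side is nonnegative and has size [J ^ 2] where [th] is below
    [1 / J]; the right-hand side is a combination of single propagators. *)
Lemma fejer_identity (th : R) (J : nat) :
  normc (\sum_(0 <= j < J) cis (j%:R * th)) ^+ 2 =
  J%:R + 2 * \sum_(1 <= r < J) (J%:R - r%:R) * cos (r%:R * th).
Proof.
elim: J => [|J IH]; first by rewrite !big_geq// normc0 expr0n mulr0 addr0.
rewrite big_nat_recr//=; set S := \sum_(0 <= j < J) _ in IH *.
have reS : complex.Re (S * cis (- (J%:R * th))) = \sum_(1 <= r < J.+1) cos (r%:R * th).
  rewrite /S mulr_suml cRe_sum big_add1 succnK [RHS]big_nat_rev add0n.
  apply: eq_big_nat => j /andP[_ jJ].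
  rewrite -cisD /= -[LHS]cosN; congr cos.
  have -> : (J - j.+1).+1%:R = J%:R - j%:R :> R by rewrite -natrB ?(ltnW jJ)// subnSK.
  by ring.
have -> : normc (S + cis (J%:R * th)) ^+ 2 = normc S ^+ 2 + 1 + 2 * complex.Re (S * cis (- (J%:R * th))).
  rewrite !sqr_normcE cReM !cReD !cImD /= cosN sinN; have := cos2Dsin2 (J%:R * th).
  move: (cos _) (sin _) (complex.Re S) (complex.Im S) => c v x y cv.
  by lra.
rewrite reS IH.
have -> : \sum_(1 <= r < J.+1) (J.+1%:R - r%:R) * cos (r%:R * th) =
   \sum_(1 <= r < J) (J%:R - r%:R) * cos (r%:R * th) + \sum_(1 <= r < J.+1) cos (r%:R * th).
  have -> : \sum_(1 <= r < J) (J%:R - r%:R) * cos (r%:R * th) =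
     \sum_(1 <= r < J.+1) (J%:R - r%:R) * cos (r%:R * th).
    case: J {IH reS S} => [|J]; first by rewrite !big_geq.
    by rewrite [RHS]big_nat_recr//= subrr mul0r addr0.
  by rewrite -big_split /=; apply: eq_bigr => r _; rewrite -natr1; ring.
by rewrite -natr1; ring.
Qed.

Lemma cos_ge_half (t : R) : `|t| <= 1 -> 1 / 2 <= cos t.
Proof.
move=> t1; have -> : cos t = 1 - 2 * sin (t / 2) ^+ 2.
  rewrite [in LHS](_ : t = t / 2 + t / 2); last by field.
  by rewrite cosD -!expr2 cos2sin2; ring.
have := sin_le_norm (t / 2); rewrite normrM (@ger0_norm _ 2^-1)// => h.
have : sin (t / 2) ^+ 2 <= (1 / 2) ^+ 2.
  by rewrite -[leLHS]real_normK ?num_real// lerXn2r ?nnegrE//; lra.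
by lra.
Qed.

Lemma fejer_lower (th : R) (J : nat) : J%:R * `|th| <= 1 ->
  J%:R ^+ 2 / 4 <= normc (\sum_(0 <= j < J) cis (j%:R * th)) ^+ 2.
Proof.
move=> Jt; set S := \sum_(0 <= j < J) _.
have h : J%:R / 2 <= complex.Re S.
  rewrite /S cRe_sum; apply: (@le_trans _ _ (\sum_(0 <= j < J) 1 / 2)).
    by rewrite sumr_const_nat subn0 mul1r mulr_natl.
  rewrite big_nat [leRHS]big_nat; apply: ler_sum => j /andP[_ jJ] /=.
  apply: cos_ge_half; rewrite normrM normr_nat; apply: le_trans Jt.
  by rewrite ler_wpM2r// ler_nat ltnW.
have h2 : J%:R / 2 <= normc S by apply: le_trans h (le_trans (ler_norm _) (ger_Re _)).
have -> : J%:R ^+ 2 / 4 = (J%:R / 2) ^+ 2 :> R by field.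
by rewrite lerXn2r ?nnegrE ?normc_ge0.
Qed.

Variables (lam h : R) (J : nat).

Definition heat (q : R) : R := expR (- (pi * (lam ^+ 2)^-1 * q)).

Definition low_times (r0 : nat) (q : R) : R :=
  heat q * (J%:R^-1 + 2 * \sum_(1 <= r < r0)
    (J%:R - r%:R) / J%:R ^+ 2 * cos (r%:R * (pi * h * (lam ^+ 2 - q)))).

Definition high_times (r0 : nat) (q : R) : R[i] :=
  2%:C * \sum_(r0 <= r < J) weight lam h J r * chirp (lam ^+ 2)^-1 (r%:R * h) q.

Lemma low_high_times (r0 : nat) (q : R) : (0 < r0)%N -> (r0 <= J)%N ->
  complex.Re (high_times r0 q) + low_times r0 q =
  heat q * (normc (\sum_(0 <= j < J) cis (j%:R * (pi * h * (lam ^+ 2 - q)))) ^+ 2 / J%:R ^+ 2).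
Proof.
move=> r00 rJ; set th := pi * h * (lam ^+ 2 - q).
have J0 : 0 < J%:R :> R by rewrite ltr0n; exact: leq_trans r00 rJ.
have scale (x : R) z : complex.Re (x%:C * z) = x * complex.Re z.
  by rewrite cReM /= mul0r subr0.
have term r : complex.Re (weight lam h J r * chirp (lam ^+ 2)^-1 (r%:R * h) q) =
     heat q * ((J%:R - r%:R) / J%:R ^+ 2 * cos (r%:R * th)).
  have -> : weight lam h J r * chirp (lam ^+ 2)^-1 (r%:R * h) q =
      ((J%:R - r%:R) / J%:R ^+ 2 * heat q)%:C * cis (r%:R * th).
    rewrite /weight /chirp /cexp /= rmorphM /= mulrACA -cisD; congr (_ * cis _); rewrite /th; ring.
  by rewrite scale [complex.Re _]/=; move: (heat q) => e; ring.
have -> : complex.Re (high_times r0 q) =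
    2 * (heat q * \sum_(r0 <= r < J) (J%:R - r%:R) / J%:R ^+ 2 * cos (r%:R * th)).
  apply: (etrans (scale _ _)); rewrite cRe_sum; congr (_ * _); rewrite mulr_sumr.
  by apply: eq_bigr => r _; exact: term.
rewrite fejer_identity /low_times -/th (big_cat_nat (n := r0) (m := 1%N) (p := J))//=.
have E (a b : nat) : \sum_(a <= r < b) (J%:R - r%:R) / J%:R ^+ 2 * cos (r%:R * th) =
   (\sum_(a <= r < b) (J%:R - r%:R) * cos (r%:R * th)) / J%:R ^+ 2.
  by rewrite mulr_suml; apply: eq_bigr => r _; rewrite mulrAC.
by rewrite !E; move: (heat q) (\sum_(1 <= r < r0) _) (\sum_(r0 <= r < J) _) => e x y;
  field; rewrite gt_eqF.
Qed.

(** Every propagator has modulus at most one, so the times below [r0] contribute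
    no more than their total weight. *)
Lemma low_times_le (r0 : nat) (q : R) : 0 <= q -> (0 < r0)%N -> (r0 <= J)%N ->
  low_times r0 q <= 2 * r0%:R / J%:R.
Proof.
move=> q0 r00 rJ; have J0 : 0 < J%:R :> R by rewrite ltr0n; exact: leq_trans r00 rJ.
have h1 : heat q <= 1.
  rewrite expR_le1 oppr_le0; apply: mulr_ge0 => //; apply: mulr_ge0; first exact: pi_ge0.
  by rewrite invr_ge0 sqr_ge0.
have s1 : \sum_(1 <= r < r0) (J%:R - r%:R) / J%:R ^+ 2 *
    cos (r%:R * (pi * h * (lam ^+ 2 - q))) <= (r0%:R - 1) / J%:R.
  apply: (@le_trans _ _ (\sum_(1 <= r < r0) J%:R^-1)); last first.
    by rewrite sumr_const_nat -[leLHS]mulr_natl natrB.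
  rewrite big_nat [leRHS]big_nat; apply: ler_sum => r /andP[_ rr].
  have p : 0 <= (J%:R - r%:R) / J%:R ^+ 2 :> R.
    by rewrite divr_ge0 ?sqr_ge0// subr_ge0 ler_nat (leq_trans (ltnW rr)).
  apply: le_trans (ler_wpM2l p (cos_le1 _)) _; rewrite mulr1 ler_pdivrMr ?exprn_gt0//.
  have -> : J%:R^-1 * J%:R ^+ 2 = J%:R :> R by field; rewrite gt_eqF.
  by rewrite lerBlDr lerDl.
have s2 : J%:R^-1 + 2 * \sum_(1 <= r < r0) (J%:R - r%:R) / J%:R ^+ 2 *
    cos (r%:R * (pi * h * (lam ^+ 2 - q))) <= 2 * r0%:R / J%:R.
  have -> : 2 * r0%:R / J%:R = 2 * ((r0%:R - 1) / J%:R) + 2 / J%:R :> R by ring.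
  have : 0 <= J%:R^-1 :> R by rewrite invr_ge0 ltW.
  lra.
apply: le_trans (ler_wpM2l (expR_ge0 _) s2) _; rewrite ler_piMl//.
Qed.

End fejer_multiplier.

Section level_sets.
Variable R : realType.

(** The last hypothesis makes the contribution of the longest times no larger
    than that of the shortest ones; [g] is [sqrt (lambda * delta)] and [t] is
    [2 ^ (m / 2)]. *)
Lemma kernel_size_le (C0 lam g t : R) n : 0 <= C0 -> 0 < lam -> 1 <= g -> 1 <= t ->
  lam ^+ n.+2 <= g ^+ (2 * n + 5) ->
  2 * (C0 / (12 * g ^+ 2)^-1 * (((Num.sqrt 12 * g * t)^-1 ^+ n.+1)^-1 +
     lam ^+ n.+2 * (Num.sqrt 12 * g)^-1 ^+ n.+4)) <=
  24 * C0 * (Num.sqrt 12 ^+ n.+1 + 1) * (g ^+ n.+3 * t ^+ n.+1).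
Proof.
move=> C00 l0 g1 t1 lg; set k := Num.sqrt 12.
have g0 : 0 < g by exact: lt_le_trans g1.
have t0 : 0 < t by exact: lt_le_trans t1.
have k1 : 1 <= k.
  have : Num.sqrt 1 <= Num.sqrt 12 :> R by apply: ler_wsqrtr; lra.
  by rewrite sqrtr1.
have k0 : 0 < k by exact: lt_le_trans k1.
rewrite invrK !exprVn invrK.
have e2 : lam ^+ n.+2 / (k * g) ^+ n.+4 <= g ^+ n.+1 * t ^+ n.+1.
  rewrite ler_pdivrMr ?exprn_gt0 ?mulr_gt0//; apply: le_trans lg _.
  have -> : g ^+ (2 * n + 5) = g ^+ n.+1 * g ^+ n.+4 by rewrite -exprD; congr (_ ^+ _); lia.
  rewrite -mulrA ler_wpM2l ?exprn_ge0 ?(ltW g0)// exprMn mulrA ler_peMl ?exprn_ge0 ?(ltW g0)//.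
  by rewrite -[leLHS]mulr1; apply: ler_pM => //; exact: exprn_ege1.
have e3 : (k * g * t) ^+ n.+1 + lam ^+ n.+2 / (k * g) ^+ n.+4 <=
   (k ^+ n.+1 + 1) * (g ^+ n.+1 * t ^+ n.+1).
  have -> : (k * g * t) ^+ n.+1 = k ^+ n.+1 * (g ^+ n.+1 * t ^+ n.+1) by rewrite !exprMn mulrA.
  by rewrite mulrDl mul1r lerD2l.
have -> : 24 * C0 * (k ^+ n.+1 + 1) * (g ^+ n.+3 * t ^+ n.+1) =
   2 * (C0 * (12 * g ^+ 2)) * ((k ^+ n.+1 + 1) * (g ^+ n.+1 * t ^+ n.+1)).
  by rewrite !exprS; ring.
rewrite mulrA; apply: ler_wpM2l => //; apply: mulr_ge0 => //; apply: mulr_ge0 => //.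
by apply: mulr_ge0 => //; rewrite sqr_ge0.
Qed.

Definition window_const : R := expR (- (4 * pi)) / 4.

Lemma window_const_gt0 : 0 < window_const.
Proof. by rewrite divr_gt0// expR_gt0. Qed.

Lemma sqrt_window (q lam delta : R) : 0 <= q -> 1 <= lam -> 0 < delta -> delta <= 1 ->
  `|Num.sqrt q - lam| <= delta -> q <= 4 * lam ^+ 2 /\ `|lam ^+ 2 - q| <= 3 * (lam * delta).
Proof.
move=> q0 l1 d0 d1; have s0 := sqrtr_ge0 q; rewrite -{2 3}(sqr_sqrtr q0).
move: (Num.sqrt q) s0 => s s0; rewrite ler_norml => /andP[h1 h2].
split; first by nra.
rewrite ler_norml; apply/andP; split; nra.
Qed.

(** Duality for the multiplier cut at [2 ^ (- m)] times the full time span. The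
    symbol of the short times is [O (2 ^ (- m))], and the hypothesis on [alpha]
    says that the kernel of the long times is negligible at this height. *)
Lemma level_set_dyadic n (Q : 'rV[R]_n.+3 -> R) : quadratic_form Q -> positive_definite Q ->
  exists2 C : R, 0 <= C & forall (lam delta : R) (s : seq 'rV[int]_n.+3) (a : 'rV[int]_n.+3 -> R[i])
    (M alpha : R) (m : nat), 1 <= lam -> 0 < delta -> delta <= 1 ->
    1 <= lam * delta ->
    lam ^+ n.+2 <= Num.sqrt (lam * delta) ^+ (2 * n + 5) -> uniq s ->
    {in s, forall k, `|Num.sqrt (Q (map_mx intr k)) - lam| <= delta} ->
    \sum_(k <- s) normc (a k) ^+ 2 <= M -> 0 < alpha ->
    M * C * (Num.sqrt (lam * delta) ^+ n.+3 * Num.sqrt (2 ^+ m) ^+ n.+1) <= alpha ^+ 2 ->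
  alpha ^+ 2 * fine (torus_measure R n.+3
    [set x | alpha < normc (\sum_(k <- s) a k * torus_char k x)]) <=
  2 * M * (2 / 2 ^+ m) / window_const.
Proof.
move=> Qf Qp; have [D [tD sD QD]] := triangular_coordinates Qf Qp.
have [C0 C00 HC0] := kernel_estimate tD sD.
pose C3 := 24 * C0 * (Num.sqrt 12 ^+ n.+1 + 1).
have C30 : 0 <= C3.
  by apply: mulr_ge0; [exact: mulr_ge0|rewrite addr_ge0// exprn_ge0// sqrtr_ge0].
have w0 := window_const_gt0.
exists (2 * C3 / window_const); first by rewrite divr_ge0 ?mulr_ge0// ltW.
move=> lam delta s a M alpha m l1 d0 d1 ld lg us sw aM al0 alM.
have l0 : 0 < lam by exact: lt_le_trans l1.
have ld0 : 0 < lam * delta by exact: mulr_gt0.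
pose g := Num.sqrt (lam * delta).
have g0 : 0 < g by rewrite sqrtr_gt0.
have g2 : g ^+ 2 = lam * delta by rewrite sqr_sqrtr// ltW.
have g1 : 1 <= g by rewrite /g -sqrtr1 ler_wsqrtr.
pose t : R := Num.sqrt (2 ^+ m).
have m0 : 0 < 2 ^+ m :> R by exact: exprn_gt0.
have t0 : 0 < t by rewrite sqrtr_gt0.
have t1 : 1 <= t.
  have : Num.sqrt 1 <= Num.sqrt (2 ^+ m) :> R by apply: ler_wsqrtr; apply: exprn_ege1; lra.
  by rewrite sqrtr1.
(* A number of steps so large that the discretization of time is invisible. *)
pose r0 := (Num.truncn (lam ^+ 6)).+1.
have rl : lam ^+ 6 <= r0%:R by exact: ltW (truncnS_gt _).
pose J := (r0 * 2 ^ m)%N.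
have rJ : (r0 <= J)%N by rewrite leq_pmulr// expn_gt0.
have J0 : 0 < J%:R :> R by rewrite ltr0n; exact: leq_trans rJ.
have JE : J%:R = r0%:R * 2 ^+ m :> R by rewrite natrM natrX.
have ll : 1 <= 12 * (lam * delta) by lra.
have ll0 : 0 < 12 * (lam * delta) by rewrite mulr_gt0.
(* The total span is a small multiple of [1 / (lam * delta)], which keeps the
   multiplier bounded below on the window. *)
pose h := (12 * (lam * delta) * J%:R)^-1.
have h0 : 0 < h by rewrite invr_gt0 mulr_gt0.
have Jh : J%:R * h = (12 * g ^+ 2)^-1 by rewrite g2 /h; field; rewrite !gt_eqF.
have hJ : h * J%:R = (12 * g ^+ 2)^-1 by rewrite mulrC.
have Jh1 : J%:R * h <= 1 by rewrite Jh g2 invf_le1.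
have hl : h * lam ^+ 6 <= 1.
  apply: le_trans Jh1; rewrite mulrC ler_wpM2r ?(ltW h0)//; apply: le_trans rl _.
  by rewrite ler_nat.
pose N0 := \max_(k <- s) \max_(i < n.+3) `|k ord0 i|%N.
have [Ns [sN aN HN]] := HC0 lam h r0 m N0 l1 h0 hl isT Jh1.
pose s' := [seq row_of n.+3 k | k <- box Ns].
have us' : uniq s'.
  rewrite map_inj_in_uniq ?uniq_box// => k k' kB kB' e.
  rewrite -[k](@row_ofK n.+3) ?(size_box kB)// -[k'](@row_ofK n.+3) ?(size_box kB')//.
  by rewrite e.
have ss' : {subset s <= s'}.
  move=> k ks; apply/mapP; exists (seq_of k); last by rewrite seq_ofK.
  apply: mem_box; first by rewrite size_seq_of sN.
  have aN' : all2 (fun k0 N => (`|k0|%N <= N)%N) (seq_of k) Ns.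
    have gen (js : seq int) (Ms : seq nat) : size js = size Ms -> all (leq N0) Ms ->
        all (fun k0 => `|k0|%N <= N0)%N js -> all2 (fun k0 N => (`|k0|%N <= N)%N) js Ms.
      elim: js Ms => [|k0 js IH] [|M0 Ms] //= [sk] /andP[M0N MsN] /andP[k0N ksN].
      by rewrite (leq_trans k0N M0N) IH.
    apply: gen => //; first by rewrite size_seq_of sN.
    apply/allP => k0 /mapP[i _ ->]; rewrite /N0.
    apply: leq_trans (leq_bigmax_seq _ ks isT).
    exact: (leq_bigmax (F := fun i => `|k ord0 i|%N)).
  exact: aN'.
pose q k := Q (map_mx intr k).
have q0 k : 0 <= q k by rewrite /q QD qform_ge0.
pose u k := high_times lam h J r0 (q k).
pose w k := low_times lam h J r0 (q k).
have uw k : complex.Re (u k) + w k = heat lam (q k) *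
    (normc (\sum_(0 <= j < J) cis (j%:R * (pi * h * (lam ^+ 2 - q k)))) ^+ 2 / J%:R ^+ 2).
  exact: low_high_times.
have Ck : C3 * (g ^+ n.+3 * t ^+ n.+1) >= 0.
  by apply: mulr_ge0 => //; apply: mulr_ge0; rewrite exprn_ge0// ltW.
have heat1 x : 0 <= heat lam x by exact: expR_ge0.
have me (k : 'rV[int]_n.+3) : cmeasurable (@torus_char R n.+3 k) by exact: cmeasurable_torus_char.
have e1 (k : 'rV[int]_n.+3) x : normc (@torus_char R n.+3 k x) <= 1 by rewrite normc_torus_char.
have B0 : 0 <= 2 / 2 ^+ m :> R by rewrite divr_ge0// ltW.
have os : orthonormal_on (torus_measure R n.+3) (@torus_char R n.+3) s'.
  exact: orthonormal_torus_char.
apply: (level_set_le me e1 us us' ss' os al0 w0 Ck B0 aM (u := u) (w := w)).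
- move=> k ks /=; rewrite uw; have [q4 q3] := sqrt_window (q0 k) l1 d0 d1 (sw k ks).
  have th1 : J%:R * `|pi * h * (lam ^+ 2 - q k)| <= 1.
    rewrite 2!normrM (gtr0_norm (pi_gt0 R)) (gtr0_norm h0).
    have -> : J%:R * (pi * h * `|lam ^+ 2 - q k|) = pi * (h * J%:R * `|lam ^+ 2 - q k|) by ring.
    have hJ0 : 0 <= h * J%:R by rewrite mulr_ge0// ltW.
    have e := ler_wpM2l hJ0 q3; rewrite -/(q k) in e.
    have e4 : h * J%:R * (3 * (lam * delta)) = 1 / 4 by rewrite hJ g2; field; rewrite !gt_eqF.
    rewrite e4 in e; have p4 : pi <= 4 :> R by have := @pihalf_lt2 R; lra.
    have pp := pi_ge0 R.
    by have := ler_wpM2l pp e; move: (pi * _) => y; lra.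
  have fl := fejer_lower th1.
  rewrite /window_const; apply: ler_pM => //.
    rewrite /heat ler_expR lerN2 -mulrA [4 * _]mulrC ler_wpM2l ?pi_ge0//.
    by rewrite ler_pdivrMl ?exprn_gt0// mulrC.
  by rewrite ler_pdivlMr ?exprn_gt0// mulrC.
- move=> k _; rewrite uw mulr_ge0// divr_ge0 ?sqr_ge0//.
- move=> k _; apply: le_trans (low_times_le lam h (q0 k) _ rJ) _ => //.
  by rewrite JE le_eqVlt; apply/orP; left; apply/eqP; field; rewrite !gt_eqF// ltr0n.
- move=> x y; have szx : size [seq p.1 - p.2 | p <- zip y x] = n.+3.
    by rewrite size_map size_zip !size_tuple minnn.
  have -> : \sum_(i <- s') u i * (torus_char i y * (torus_char i x)^*%C) =
     2%:C * \sum_(k <- box Ns) \sum_(r0 <= r < J) weight lam h J r *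
       (chirp (lam ^+ 2)^-1 (r%:R * h) (qform D k) * cis (2 * pi * dot [seq p.1 - p.2 | p <- zip y x] k)).
    rewrite big_map mulr_sumr big_seq [RHS]big_seq; apply: eq_bigr => k kB.
    rewrite torus_char_dot row_ofK ?(size_box kB)//.
    rewrite /u /high_times /q QD row_ofK ?(size_box kB)// -mulrA mulr_suml; congr (_ * _).
    by apply: eq_bigr => r _; rewrite mulrA.
  rewrite normcM normcR ger0_norm//; apply: le_trans (ler_wpM2l _ (HN _ szx)) _ => //.
  rewrite -/J hJ.
  have p12 : 0 <= 12 * g ^+ 2 by rewrite mulr_ge0 ?sqr_ge0.
  have s12 : Num.sqrt (12 * g ^+ 2) = Num.sqrt 12 * g.
    have h12 : 0 <= 12 :> R by [].
    by rewrite (sqrtrM _ h12) sqrtr_sqr gtr0_norm.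
  have -> : Num.sqrt (J%:R * h) = (Num.sqrt 12 * g)^-1 by rewrite Jh (sqrtrV p12) s12.
  have -> : Num.sqrt (r0%:R * h) = (Num.sqrt 12 * g * t)^-1.
    have -> : r0%:R * h = (12 * g ^+ 2 * 2 ^+ m)^-1.
      by rewrite invfM -Jh JE; field; rewrite gt_eqF.
    by rewrite (sqrtrV (mulr_ge0 p12 (ltW m0))) (sqrtrM _ p12) s12.
  exact: kernel_size_le.
- rewrite [leLHS](_ : _ = M * (2 * C3 / window_const) * (g ^+ n.+3 * t ^+ n.+1) * window_const).
    by rewrite mulrC ler_wpM2l ?(ltW w0).
  by field; rewrite gt_eqF.
Qed.
End level_sets.

Opaque chirp.

(** * The weak-type inequality *)

Section weak_type_inequality.
Variable R : realType.

Lemma exists_last (P : nat -> bool) N : P 0%N -> ~~ P N -> exists2 m, P m & ~~ P m.+1.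
Proof.
move=> H0; elim: N => [|N IH] HN; first by rewrite H0 in HN.
by have [PN|/IH//] := boolP (P N); exists N.
Qed.

(** The largest [m] admissible in [level_set_dyadic] gives the best estimate.
    When there is none, [alpha] is so small that Chebyshev's inequality is
    enough. *)
Lemma weak_type_bound n (Q : 'rV[R]_n.+3 -> R) (M : R) : quadratic_form Q -> positive_definite Q ->
  0 <= M -> exists2 C : R, 0 <= C &
  forall (lam delta : R) (s : seq 'rV[int]_n.+3) (a : 'rV[int]_n.+3 -> R[i]) (alpha : R),
    1 <= lam -> 0 < delta -> delta <= 1 -> 1 <= lam * delta ->
    lam ^+ n.+2 <= Num.sqrt (lam * delta) ^+ (2 * n + 5) -> uniq s ->
    {in s, forall k, `|Num.sqrt (Q (map_mx intr k)) - lam| <= delta} ->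
    \sum_(k <- s) normc (a k) ^+ 2 <= M -> 0 < alpha ->
  (alpha ^+ 2) ^+ n.+3 * fine (torus_measure R n.+3
    [set x | alpha < normc (\sum_(k <- s) a k * torus_char k x)]) ^+ n.+1 <=
  C * (lam * delta) ^+ n.+3.
Proof.
move=> Qf Qp M0; have [C1 C10 HC1] := level_set_dyadic Qf Qp.
have w0 := window_const_gt0 R.
(* The constant is made positive, so that large [m] are inadmissible. *)
pose E := (M + 1) * (C1 + 1).
have E1 : 1 <= E by rewrite -[leLHS]mulr1; apply: ler_pM => //; lra.
have E0 : 0 <= E by exact: le_trans E1.
have ME : M * C1 <= E by have := mulr_ge0 M0 C10; rewrite /E mulrDl !mulrDr; lra.
pose K := 4 * M / window_const R.
have K0 : 0 <= K by apply: divr_ge0; [exact: mulr_ge0|exact: ltW].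
exists (E ^+ 2 * ((2 * K) ^+ n.+1 + (2 * M) ^+ n.+1)).
  by apply: mulr_ge0; [exact: sqr_ge0|rewrite addr_ge0// exprn_ge0// mulr_ge0].
move=> lam delta s a alpha l1 d0 d1 ld lg us sw aM al0.
set mu := fine _; have mu0 : 0 <= mu by exact: fine_ge0.
have ld0 : 0 <= lam * delta by exact: le_trans ld.
pose g := Num.sqrt (lam * delta).
have g2 : g ^+ 2 = lam * delta by rewrite sqr_sqrtr.
have g1 : 1 <= g by rewrite /g -sqrtr1 ler_wsqrtr.
have g0 : 0 <= g by exact: sqrtr_ge0.
have gn : 1 <= g ^+ n.+3 by exact: exprn_ege1.
have -> : (alpha ^+ 2) ^+ n.+3 * mu ^+ n.+1 = (alpha ^+ 2) ^+ 2 * (alpha ^+ 2 * mu) ^+ n.+1.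
  have -> : (alpha ^+ 2 * mu) ^+ n.+1 = (alpha ^+ 2) ^+ n.+1 * mu ^+ n.+1 by rewrite exprMn.
  by rewrite mulrA; congr (_ * _); rewrite -exprD.
have am0 : 0 <= alpha ^+ 2 * mu by rewrite mulr_ge0 ?sqr_ge0.
have sqE (x y : R) : 0 <= x -> x <= y -> x ^+ 2 <= y ^+ 2.
  by move=> x0 xy; rewrite lerXn2r ?nnegrE// (le_trans x0).
have powE (x y : R) : 0 <= x -> x <= y -> x ^+ n.+1 <= y ^+ n.+1.
  by move=> x0 xy; rewrite lerXn2r ?nnegrE// (le_trans x0).
have a20 : 0 <= alpha ^+ 2 by exact: sqr_ge0.
rewrite -g2.
have gp : 0 <= (g ^+ 2) ^+ n.+3 by rewrite exprn_ge0// sqr_ge0.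
have t1 m : 1 <= Num.sqrt (2 ^+ m) :> R.
  have : Num.sqrt 1 <= Num.sqrt (2 ^+ m) :> R by apply: ler_wsqrtr; apply: exprn_ege1; lra.
  by rewrite sqrtr1.
have t2 m : Num.sqrt (2 ^+ m) ^+ 2 = 2 ^+ m :> R by rewrite sqr_sqrtr// exprn_ge0.
pose P m := E * (g ^+ n.+3 * Num.sqrt (2 ^+ m) ^+ n.+1) <= alpha ^+ 2.
have small m : ~~ P m -> (alpha ^+ 2) ^+ 2 <= E ^+ 2 * ((g ^+ 2) ^+ n.+3 * (2 ^+ m) ^+ n.+1).
  rewrite -ltNge => /ltW h; apply: le_trans (sqE _ _ a20 h) _.
  have pw (e u v : R) i j : (e * (u ^+ i * v ^+ j)) ^+ 2 = e ^+ 2 * ((u ^+ 2) ^+ i * (v ^+ 2) ^+ j).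
    by rewrite exprMn; congr (_ * _); rewrite exprMn; congr (_ * _); exact: exprAC.
  by rewrite pw t2 lexx.
rewrite mulrDr mulrDl.
have [P0|P0] := boolP (P 0%N); last first.
  have cheb : alpha ^+ 2 * mu <= 2 * M.
    have me (k : 'rV[int]_n.+3) : cmeasurable (@torus_char R n.+3 k) by exact: cmeasurable_torus_char.
    have e1 (k : 'rV[int]_n.+3) x : normc (@torus_char R n.+3 k x) <= 1 by rewrite normc_torus_char.
    have os : orthonormal_on (torus_measure R n.+3) (@torus_char R n.+3) s.
      exact: orthonormal_torus_char.
    (* With the trivial multiplier, duality is Chebyshev's inequality. *)
    have := level_set_le me e1 us us (fun x h => h) os al0 (@ltr01 R) (lexx 0) (@ler01 R) aM
      (u := fun=> 0) (w := fun=> 1).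
    rewrite mulr1 divr1; apply.
    - by move=> k _; rewrite /= add0r.
    - by move=> k _; rewrite /= add0r ler01.
    - by move=> k _.
    - by move=> x y; rewrite big1 ?normc0// => i _; rewrite mul0r.
    - by rewrite mulr0 mul1r.
  apply: ler_wpDl; first by apply: mulr_ge0 => //; apply: mulr_ge0; rewrite ?sqr_ge0// exprn_ge0// mulr_ge0.
  apply: le_trans (ler_pM _ _ (small _ P0) (powE _ _ am0 cheb)) _; rewrite ?sqr_ge0 ?exprn_ge0//.
  by rewrite expr0 expr1n mulr1 mulrAC.
have [N HN] : exists N, ~~ P N.
  pose N := (Num.truncn ((alpha ^+ 2) ^+ 2)).+1; exists N; rewrite -ltNge.
  have aN : (alpha ^+ 2) ^+ 2 < 2 ^+ N.
    apply: lt_le_trans (truncnS_gt _) _; rewrite -natrX ler_nat.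
    by apply: ltnW; exact: ltn_expl.
  have at2 : alpha ^+ 2 < Num.sqrt (2 ^+ N).
    by rewrite -(@ltr_pXn2r _ 2)// ?nnegrE ?sqrtr_ge0// t2.
  apply: lt_le_trans at2 _; have tN := t1 N; move: (Num.sqrt _) tN => t tN.
  have tn : t <= t ^+ n.+1 by rewrite exprS ler_peMr ?exprn_ege1// (le_trans ler01).
  apply: le_trans tn _; rewrite mulrA ler_peMl ?exprn_ge0 ?(le_trans ler01 tN)//.
  by rewrite -[leLHS]mulr1; apply: ler_pM.
have [m Pm Pm1] := exists_last P0 HN.
have h1 : alpha ^+ 2 * mu <= K / 2 ^+ m.
  have h := HC1 lam delta s a M alpha m l1 d0 d1 ld lg us sw aM al0.
  apply: le_trans (h _) _; last by rewrite /K le_eqVlt; apply/orP; left; apply/eqP; ring.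
  apply: (le_trans _ Pm); apply: ler_wpM2r ME.
  by apply: mulr_ge0; rewrite exprn_ge0// sqrtr_ge0.
apply: ler_wpDr; first by apply: mulr_ge0 => //; apply: mulr_ge0; rewrite ?sqr_ge0// exprn_ge0// mulr_ge0.
apply: le_trans (ler_pM _ _ (small _ Pm1) (powE _ _ am0 h1)) _; rewrite ?sqr_ge0 ?exprn_ge0//.
have m0 : 2 ^+ m != 0 :> R by rewrite expf_neq0.
have -> : (2 * K) ^+ n.+1 = (2 ^+ m.+1) ^+ n.+1 * (K / 2 ^+ m) ^+ n.+1.
  by rewrite -exprMn; congr (_ ^+ _); rewrite exprS; field.
by rewrite le_eqVlt; apply/orP; left; apply/eqP; ring.
Qed.

End weak_type_inequality.

(** * From level sets to the norm *)

Section layer_cake.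
Context d (T : measurableType d) (R : realType) (P : probability T R).

(** Heights are grouped into [L] geometric shells. Each shell contributes at most
    [B], so a weak-type bound costs only a factor [L]. *)
Lemma layer_cake_le (F : T -> R) (p B : R) (L : nat) : measurable_fun setT F ->
  (forall x, 0 <= F x) -> 0 <= p -> (forall x, F x <= expR L%:R) ->
  (forall j, expR j.+1%:R `^ p * fine (P [set x | expR j%:R < F x]) <= B) ->
  P.-integrable setT (fun x => (F x `^ p)%:E) /\ \int[P]_x (F x `^ p) <= 1 + L%:R * B.
Proof.
move=> mF F0 p0 FL FB.
pose E j := [set x | expR j%:R < F x].
have mE j : measurable (E j).
  have := emeasurable_fun_infty_o; move=> _.
  have -> : E j = setT `&` F @^-1` `]expR j%:R, +oo[%classic.
    by apply/seteqP; split => x; rewrite /E /= in_itv /= andbT => // -[].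
  exact: mF.
pose G L x := \1_[set: T] x + \sum_(0 <= j < L) expR j.+1%:R `^ p * \1_(E j) x : R.
have iE A : measurable A -> P.-integrable setT (fun x => (\1_A x : R)%:E).
  by move=> mA; exact: integrable_indic.
have IE A : measurable A -> \int[P]_x (\1_A x : R) = fine (P A).
  by move=> mA; rewrite /Rintegral integral_indic// setIT.
have GI N : P.-integrable setT (fun x => (G N x)%:E) /\ \int[P]_x G N x <= 1 + N%:R * B.
  elim: N => [|N [i1 h1]].
    have -> : G 0%N = fun x => \1_[set: T] x by apply/funext => x; rewrite /G big_geq// addr0.
    by split; [exact: iE|rewrite IE// probability_setT mul0r addr0].
  have -> : G N.+1 = fun x => G N x + expR N.+1%:R `^ p * \1_(E N) x.
    by apply/funext => x; rewrite /G big_nat_recr//= addrA.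
  have iN : P.-integrable setT (fun x => (expR N.+1%:R `^ p * \1_(E N) x)%:E).
    by apply: integrableZ; exact: iE.
  split.
    by under eq_fun do rewrite EFinD; exact: integrableD.
  rewrite RintegralD// RintegralZl//; last exact: iE.
  rewrite (IE _ (mE N)); apply: le_trans (lerD h1 (FB N)) _.
  by rewrite -[N.+1%:R]natr1 mulrDl mul1r addrA.
have FG N x : F x <= expR N%:R -> F x `^ p <= G N x.
  have c0 j : 0 <= expR j.+1%:R `^ p * \1_(E j) x :> R.
    by apply: mulr_ge0; [exact: powR_ge0|rewrite indicE; exact: ler0n].
  elim: N => [|N IH] h.
    rewrite /G big_geq// addr0 indicE in_setT; apply: (@le_trans _ _ (1 `^ p)); last by rewrite powR1.
    by apply: ge0_ler_powR => //; rewrite ?nnegrE//; apply: le_trans h _; rewrite expR0.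
  have GS : G N.+1 x = G N x + expR N.+1%:R `^ p * \1_(E N) x by rewrite /G big_nat_recr//= addrA.
  rewrite GS; have [FN|FN] := leP (F x) (expR N%:R).
    by apply: le_trans (IH FN) _; rewrite lerDl.
  have -> : \1_(E N) x = 1 :> R by rewrite indicE mem_set.
  rewrite mulr1; apply: ler_wpDl.
    by rewrite /G addr_ge0 ?indicE// sumr_ge0.
  by apply: ge0_ler_powR => //; rewrite ?nnegrE// expR_ge0.
have iF : P.-integrable setT (fun x => (F x `^ p)%:E).
  apply: (bounded_integrable (M := expR L%:R `^ p)).
    apply: (measurableT_comp (f := fun y : R => y `^ p)) => //; exact: measurable_powRr.
  move=> x; rewrite ger0_norm ?powR_ge0//; apply: ge0_ler_powR => //; rewrite ?nnegrE ?expR_ge0//.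
split => //; have [i1 h1] := GI L; apply: le_trans h1.
by apply: le_Rintegral => // x _; exact: FG.
Qed.

End layer_cake.

(** * Exponents and logarithms *)

Section exponents_and_logarithms.
Variable R : realType.

Lemma pstarE n : pstar R n.+3 = 2 * n.+3%:R / n.+1%:R.
Proof.
rewrite /pstar; congr (_ / _).
by rewrite -[n.+3]addn2 natrD addrK.
Qed.

(** The weak-type inequality in integer powers, rewritten with the exponent
    [pstar]. *)
Lemma weak_powR n (C G alpha mu : R) : 0 <= C -> 1 <= G -> 0 < alpha -> 0 <= mu ->
  (alpha ^+ 2) ^+ n.+3 * mu ^+ n.+1 <= C * G ^+ n.+3 ->
  alpha `^ (pstar R n.+3) * mu <= (1 + C) * G `^ (n.+3%:R / n.+1%:R).
Proof.
move=> C0 G1 al0 mu0 h; rewrite pstarE.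
have G0 : 0 <= G by exact: le_trans G1.
have n1 : n.+1%:R != 0 :> R by rewrite pnatr_eq0.
rewrite -(@ler_pXn2r _ n.+1)// ?nnegrE; first last.
- by rewrite mulr_ge0 ?powR_ge0// addr_ge0.
- by rewrite mulr_ge0 ?powR_ge0.
rewrite !exprMn -!powR_mulrn ?powR_ge0 ?addr_ge0// -!powRrM !mulfVK//.
rewrite -natrM !powR_mulrn ?addr_ge0 ?(ltW al0)// exprM; apply: le_trans h _.
apply: ler_wpM2r; first exact: exprn_ge0.
rewrite exprS; apply: (@le_trans _ _ (1 + C)); first by rewrite lerDr.
by rewrite ler_peMr ?addr_ge0// exprn_ege1// lerDl.
Qed.

(** The number of heights between [1] and the trivial bound for the supremum is
    logarithmic in [lam]. *)
Lemma log_levels (K eps : R) (N : nat) : 1 <= K -> 0 < eps -> exists2 C : R, 1 <= C &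
  forall lam : R, 1 <= lam -> exists L : nat,
    K * lam ^+ N <= expR L%:R /\ 1 + L%:R <= C * lam `^ eps.
Proof.
move=> K1 e0; have K0 : 0 < K by exact: lt_le_trans K1.
have lnK0 : 0 <= ln K by exact: ln_ge0.
exists (2 + ln K + N%:R / eps).
  by have : 0 <= N%:R / eps by [rewrite divr_ge0// ltW]; lra.
move=> lam l1; have l0 : 0 < lam by exact: lt_le_trans l1.
have lnl : 0 <= ln lam by exact: ln_ge0.
pose x := ln K + N%:R * ln lam; have x0 : 0 <= x by rewrite addr_ge0// mulr_ge0.
exists (Num.truncn x).+1; split.
  have -> : K * lam ^+ N = expR x.
    rewrite /x expRD lnK ?posrE//; congr (_ * _).
    by rewrite mulr_natl -lnXn// lnK// posrE exprn_gt0.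
  by rewrite ler_expR; exact: ltW (truncnS_gt _).
have tx : (Num.truncn x)%:R <= x by have /andP[] := truncn_itv x0.
have le1 : 1 + eps * ln lam <= lam `^ eps.
  by rewrite /powR gt_eqF//; exact: expR_ge1Dx.
have y1 : 1 <= lam `^ eps by apply: le_trans le1; rewrite lerDl mulr_ge0// ltW.
have lnle : N%:R * ln lam <= N%:R / eps * lam `^ eps.
  rewrite -mulrA ler_wpM2l// mulrC ler_pdivlMr// mulrC; lra.
have hK := ler_wpM2l lnK0 y1.
have fin (t z c y k : R) : z <= c * y -> t <= k + z -> k * 1 <= k * y -> 1 <= y ->
  1 + (t + 1) <= (2 + k + c) * y by move=> *; lra.
by rewrite -natr1; exact: (fin _ _ _ _ _ lnle tx hK y1).
Qed.

(** The total is at least one, so taking a root of the constant is harmless. *)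
Lemma root_bound (p X G : R) : 1 <= p -> 1 <= X -> 0 <= G ->
  (X * G `^ (p / 2)) `^ p^-1 <= X * G `^ (2^-1).
Proof.
move=> p1 X1 G0; have p0 : 0 < p by exact: lt_le_trans p1.
have X0 : 0 <= X by exact: le_trans X1.
rewrite powRM ?powR_ge0// -powRrM.
have -> : p / 2 * p^-1 = 2^-1 by field; rewrite gt_eqF.
apply: ler_wpM2r; first exact: powR_ge0.
rewrite -[leRHS](powRr1 X0); apply: ler_powR => //.
by rewrite invf_le1.
Qed.

Lemma main_exponent n (lam delta : R) : 1 <= lam -> 0 < delta ->
  lam `^ (sigma n.+3 (pstar R n.+3) / 2) * delta `^ (1 / 2) = (lam * delta) `^ (2^-1).
Proof.
move=> l1 d0; have l0 : 0 <= lam by exact: le_trans l1.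
have -> : sigma n.+3 (pstar R n.+3) / 2 = 2^-1 :> R.
  rewrite /sigma pstarE -[n.+3]addn2 -addn1 !natrD; have := ler0n R n.
  by move: (n%:R) => x x0; field; rewrite !gt_eqF//; lra.
by rewrite mul1r powRM// ltW.
Qed.

(** The hypothesis on [delta] in the form [lam ^ (d - 1) <= (lam delta) ^ (d - 1 / 2)]. *)
Lemma delta_range n (lam delta : R) : 1 < lam -> 0 < delta -> delta < 1 ->
  lam `^ (- (1 / (2 * n.+3%:R - 1))) <= delta ->
  1 <= lam * delta /\ lam ^+ n.+2 <= Num.sqrt (lam * delta) ^+ (2 * n + 5).
Proof.
move=> l1 d0 d1 h; have l0 : 0 < lam by exact: lt_trans l1.
have key : 1 <= lam * delta ^+ (2 * n + 5).
  have e5 : 2 * n.+3%:R - 1 = (2 * n + 5)%:R :> R.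
    by rewrite natrD natrM -[n.+3]addn3 natrD; ring.
  have n5 : (2 * n + 5)%:R != 0 :> R by rewrite pnatr_eq0; lia.
  have := lerXn2r (2 * n + 5) (powR_ge0 _ _ : _ \is Num.nneg) (ltW d0 : delta \is Num.nneg) h.
  have -> : (lam `^ (- (1 / (2 * n.+3%:R - 1)))) ^+ (2 * n + 5) = lam^-1.
    rewrite -powR_mulrn ?powR_ge0// -powRrM e5 mulNr mul1r mulVf//.
    by rewrite powR_inv1// ltW.
  move=> h2; apply: le_trans (ler_wpM2l (ltW l0) h2).
  by rewrite mulfV// gt_eqF.
have ld : 1 <= lam * delta.
  apply: le_trans key _; rewrite ler_wpM2l ?(ltW l0)//.
  have -> : delta ^+ (2 * n + 5) = delta * delta ^+ (2 * n + 4).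
    by rewrite -exprS; congr (_ ^+ _); lia.
  by rewrite ler_piMr ?(ltW d0)// exprn_ile1// ltW.
split => //; have ld0 : 0 <= lam * delta by exact: le_trans ld.
rewrite -(@ler_pXn2r _ 2)// ?nnegrE ?exprn_ge0 ?sqrtr_ge0 ?(ltW l0)//.
rewrite [leRHS]exprAC sqr_sqrtr// [(lam * delta) ^+ _]exprMn.
have -> : (lam ^+ n.+2) ^+ 2 = lam ^+ (n.+2 * 2) by rewrite exprM.
have -> : lam ^+ (2 * n + 5) = lam ^+ (n.+2 * 2) * lam by rewrite -exprSr; congr (_ ^+ _); lia.
by rewrite -mulrA ler_peMr// exprn_ge0// ltW.
Qed.

End exponents_and_logarithms.

(** * Lattice points in the window *)

Section counting.
Variable R : realType.

Lemma size_zr N : size (zr N) = (2 * N + 1)%N.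
Proof. by elim: N => //= N ->; lia. Qed.

Lemma size_cube d N : size (box (nseq d N)) = ((2 * N + 1) ^ d)%N.
Proof. by elim: d => // d IH; rewrite /= size_allpairs size_zr IH expnS. Qed.

Lemma mem_box_const (ks : seq int) d N : size ks = d -> all (fun x => `|x| <= N)%N ks ->
  ks \in box (nseq d N).
Proof.
move=> sk kN; apply: mem_box; first by rewrite size_nseq.
by elim: ks d sk kN => [|x ks IH] [|d] //= [sk] /andP[-> kN]; apply: IH.
Qed.

(** A crude polynomial bound suffices, because only its logarithm enters. *)
Lemma window_card d (Q : 'rV[R]_d -> R) : quadratic_form Q -> positive_definite Q ->
  exists2 K : R, 0 <= K & forall (lam : R) (s : seq 'rV[int]_d), 1 <= lam -> uniq s ->
    {in s, forall k, Q (map_mx intr k) <= 4 * lam ^+ 2} -> (size s)%:R <= K * lam ^+ d.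
Proof.
move=> Qf Qp; have [c c0 cQ] := posdef_lower_bound Qf Qp.
have sc : 0 < Num.sqrt c by rewrite sqrtr_gt0.
pose b := 2 / Num.sqrt c; have b0 : 0 <= b by rewrite divr_ge0// ltW.
exists ((2 * b + 1) ^+ d); first by rewrite exprn_ge0// addr_ge0// mulr_ge0.
move=> lam s l1 us sQ; have l0 : 0 <= lam by exact: le_trans l1.
have bl0 : 0 <= b * lam by exact: mulr_ge0.
pose N := Num.truncn (b * lam).
have Nb : N%:R <= b * lam by have /andP[] := truncn_itv bl0.
have sub : {subset [seq seq_of k | k <- s] <= box (nseq d N)}.
  move=> _ /mapP[k ks ->]; apply: mem_box_const; first exact: size_seq_of.
  have kN i : (`|k ord0 i| <= N)%N.
    rewrite -ltnS -(ltr_nat R); apply: le_lt_trans (truncnS_gt _).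
    have h1 : `|(k ord0 i)%:~R : R| <= `|map_mx intr k : 'rV[R]_d|.
      by rewrite [leRHS]mx_normrE; apply: (le_trans _ (le_bigmax _ _ (ord0, i))); rewrite mxE.
    have -> : (`|k ord0 i|%N)%:R = `|(k ord0 i)%:~R| :> R by rewrite -intr_norm -abszE.
    apply: le_trans h1 _.
    have h2 := le_trans (cQ (map_mx intr k)) (sQ k ks).
    rewrite -(ler_pM2l sc) -(@ler_pXn2r _ 2)// ?nnegrE ?mulr_ge0 ?(ltW sc)//.
    have -> : (Num.sqrt c * (b * lam)) ^+ 2 = 4 * lam ^+ 2 by rewrite /b; field; rewrite gt_eqF.
    by rewrite exprMn sqr_sqrtr// ltW.
  by apply/allP => _ /mapP[i _ ->]; exact: kN.
have us' : uniq [seq seq_of k | k <- s].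
  by rewrite map_inj_uniq//; exact: can_inj (@seq_ofK d).
have := uniq_leq_size us' sub; rewrite size_map size_cube => h.
apply: (@le_trans _ _ ((2 * N + 1) ^ d)%:R); first by rewrite ler_nat.
rewrite natrX -exprMn; apply: lerXn2r; rewrite ?nnegrE//.
  by rewrite mulr_ge0// addr_ge0// mulr_ge0.
by rewrite natrD natrM mulrDl mul1r; lra.
Qed.

End counting.

(** * The spectral projector *)

Section projector_bounds.
Variables (R : realType) (d : nat).
Local Notation P := (torus_measure R d).

Lemma torus_char_opp (k : 'rV[int]_d) (x : d.-tuple R) :
  torus_char (- k) x = (torus_char k x)^*%C.
Proof.
rewrite !torus_char_cis cisJ; congr cis; rewrite -mulrN; congr (_ * _).
by rewrite -sumrN; apply: eq_bigr => i _; rewrite mxE mulrNz mulNr.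
Qed.

(** On a probability space the square-integrable functions are integrable, so
    Fourier coefficients and Bessel's inequality are available. *)
Lemma torus_L2_unit (f : d.-tuple R -> R[i]) : torus_fun f -> (torus_Lnorm 2 f <= 1)%E ->
  [/\ cintegrable P f, P.-integrable setT (fun x => (normc (f x) ^+ 2)%:E) &
    \int[P]_x (normc (f x) ^+ 2) <= 1].
Proof.
move=> [_ f1 f2]; have mf : cmeasurable f by [].
have mn := measurable_normc mf.
rewrite /torus_Lnorm unlock => h.
pose I : \bar R := (\int[P]_x (normc (f x) ^+ 2)%:E)%E.
have I0 : (0 <= I)%E by apply: integral_ge0 => x _; rewrite lee_fin sqr_ge0.
have IE : (\int[P]_x (`|([eta EFin] \o (@normc R \o f)) x| `^ 2))%E = I.
  apply: eq_integral => x _; transitivity ((`|normc (f x)| `^ 2)%:E).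
    by rewrite -poweR_EFin.
  by rewrite ger0_norm ?normc_ge0// powR_mulrn ?normc_ge0.
rewrite IE in h.
have I1 : (I <= 1)%E.
  have -> : I = ((I `^ 2^-1) `^ 2)%E by rewrite -poweRrM mulVf ?poweRe1.
  have e1 : (1%:E `^ 2 = 1 :> \bar R)%E by rewrite poweR_EFin powR1.
  rewrite -[leRHS]e1; apply: gt0_ler_poweR => //; rewrite in_itv /= ?leey ?andbT ?poweR_ge0//.
have i2 : P.-integrable setT (fun x => (normc (f x) ^+ 2)%:E).
  apply/integrableP; split.
    by apply/measurable_EFinP; exact: measurable_funX.
  under eq_integral do rewrite gee0_abs ?lee_fin ?sqr_ge0//.
  exact: le_lt_trans I1 (ltry _).
split => //.
  apply: cintegrableP => //.
  have i1 : P.-integrable setT (fun=> (1 : R)%:E).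
    apply: (bounded_integrable (M := 1)) => // x; by rewrite normr1.
  apply: (le_integrable measurableT _ _ (integrableD measurableT i1 i2)).
    by apply/measurable_EFinP.
  move=> x _ /=; rewrite lee_fin !ger0_norm ?normc_ge0 ?addr_ge0 ?sqr_ge0//.
  by have := sqr_ge0 (normc (f x) - 1); have := normc_ge0 (f x); nra.
rewrite /Rintegral -lee_fin fineK//; exact: integrable_fin_num.
Qed.

Lemma spectral_projectorE (Q : 'rV[R]_d -> R) (chi : R -> R) (lam delta : R) :
  quadratic_form Q -> positive_definite Q -> cutoff chi -> 0 < delta ->
  exists s : seq 'rV[int]_d, [/\ uniq s,
    {in s, forall k, `|Num.sqrt (Q (map_mx intr k)) - lam| <= delta} &
    forall f x, spectral_projector chi Q lam delta f x =
      \sum_(k <- s) (spectral_symbol chi Q lam delta k)%:C * fourier_coef f k * torus_char k x].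
Proof.
move=> Qf Qp hchi d0; have fin := finite_spectral_window lam Qf Qp hchi d0.
have [_ _ chi0 _] := hchi.
set S := [set k | _] in fin.
exists (finmap.enum_fset (fset_set S)); split; first exact: finmap.fset_uniq.
  move=> k ks; have E := in_fset_set fin k.
  have : k \in S by rewrite -E; exact: ks.
  rewrite inE /S /= => sk.
  rewrite leNgt; apply/negP => h; move/eqP: sk; apply; apply: chi0.
  by rewrite normrM normfV (gtr0_norm d0) ltr_pdivlMr// mul1r.
move=> f x; rewrite /spectral_projector -(fsbig_widen S)//; first exact: fsbig_finite.
move=> k [_ /= Sk]; have -> : spectral_symbol chi Q lam delta k = 0.
  by apply/eqP; apply: contrapT => h; apply: Sk; rewrite /S /=; apply/negP.
by rewrite !mul0r.
Qed.

End projector_bounds.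

Theorem corollary1p3 (R : realType) (d : nat) (hd : (3 <= d)%N)
    (Q : 'rV[R]_d -> R) (hQ : quadratic_form Q) (hQpos : positive_definite Q)
    (chi : R -> R) (hchi : cutoff chi) (eps : R) (heps : 0 < eps) :
  exists C : R, forall lambda delta : R,
    1 < lambda -> 0 < delta -> delta < 1 ->
    lambda `^ (- (1 / (2 * d%:R - 1))) <= delta ->
    (torus_opnorm 2 (pstar R d) (spectral_projector chi Q lambda delta) <=
      (C * lambda `^ eps *
        ((lambda * delta) `^ ((d%:R - 1) / 2 * (1 / 2 - 1 / pstar R d)) +
         lambda `^ (sigma d (pstar R d) / 2) * delta `^ (1 / 2)))%:E)%E.
Proof.
case: d hd Q hQ hQpos => [|[|[|n]]] // _ Q hQ hQpos.
have [chi_ge0 [Mc chiM] _ _] := hchi.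
have Mc0 : 0 <= Mc by exact: le_trans (chi_ge0 0) (chiM 0).
pose M := Mc ^+ 2; have M0 : 0 <= M by exact: sqr_ge0.
have [C1 C10 weak] := weak_type_bound hQ hQpos M0.
have [K K0 card] := window_card hQ hQpos.
have Kh1 : 1 <= K + M + 1 by lra.
have [C2 C21 logs] := log_levels n.+3 Kh1 heps.
pose p := pstar R n.+3.
have n10 : 0 < n.+1%:R :> R by rewrite ltr0n.
have p1 : 1 <= p.
  rewrite /p pstarE ler_pdivlMr// mul1r -natrM ler_nat; lia.
have p0 : 0 < p by exact: lt_le_trans p1.
have p2 : n.+3%:R / n.+1%:R = p / 2 by rewrite /p pstarE; field; rewrite gt_eqF.
pose ep := expR 1 `^ p : R.
have ep1 : 1 <= ep.
  rewrite -(powRr0 (expR (1 : R))) /ep; apply: ler_powR; last exact: ltW.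
  by rewrite -expR0 ler_expR.
have cap : 1 <= ep * (1 + C1) by rewrite -[leLHS]mulr1; apply: ler_pM => //; lra.
exists (C2 * (ep * (1 + C1))) => lam delta l1 d0 d1 hdelta.
have l1' := ltW l1; have [ld lg] := delta_range l1 d0 d1 hdelta.
have l0 : 0 < lam by exact: lt_trans l1.
set G := lam * delta in ld lg *; have G0 : 0 <= G by exact: le_trans ld.
have [s [us sw sE]] := spectral_projectorE lam hQ hQpos hchi d0.
have Q0 x : 0 <= Q x.
  have [c c0 cQ] := posdef_lower_bound hQ hQpos.
  by apply: le_trans (cQ x); rewrite mulr_ge0 ?sqr_ge0// ltW.
have s4 : {in s, forall k, Q (map_mx intr k) <= 4 * lam ^+ 2}.
  by move=> k /sw; move=> h; have [] := sqrt_window (Q0 _) l1' d0 (ltW d1) h.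
have [L [KL LC]] := logs lam l1'.
apply: ge_ereal_sup => _ [f [ftor f2] <-].
have [fi fi2 fle] := torus_L2_unit ftor f2.
pose a k : R[i] := (spectral_symbol chi Q lam delta k)%:C * fourier_coef f k.
have me (k : 'rV[int]_n.+3) : cmeasurable (@torus_char R n.+3 k) by exact: cmeasurable_torus_char.
have e1 (k : 'rV[int]_n.+3) x : normc (@torus_char R n.+3 k x) <= 1 by rewrite normc_torus_char.
have os : orthonormal_on (torus_measure R n.+3) (@torus_char R n.+3) s.
  exact: orthonormal_torus_char.
have aM : \sum_(k <- s) normc (a k) ^+ 2 <= M.
  have bes := le_trans (bessel me e1 us os fi fi2) fle.
  apply: (@le_trans _ _ (\sum_(k <- s) M * normc (fourier_coef f k) ^+ 2)).
    apply: ler_sum => k _; rewrite /a normcM normcR exprMn ler_wpM2r ?sqr_ge0//.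
    rewrite lerXn2r ?nnegrE// ger0_norm ?chi_ge0//; exact: chiM.
  rewrite -mulr_sumr -[leRHS]mulr1 ler_wpM2l//; apply: le_trans bes.
  rewrite le_eqVlt; apply/orP; left; apply/eqP; apply: eq_bigr => k _; congr (normc _ ^+ 2).
  by apply: eq_cint => x; rewrite torus_char_opp.
pose F x := normc (\sum_(k <- s) a k * torus_char k x).
have mF : measurable_fun setT F.
  apply: measurable_normc; apply: cmeasurable_sum => k.
  by apply: cmeasurableM => //; exact: cmeasurable_cst.
have F0 x : 0 <= F x by exact: normc_ge0.
have FL x : F x <= expR L%:R.
  apply: le_trans KL; apply: le_trans (normc_sum _ _ _) _.
  apply: (@le_trans _ _ (\sum_(k <- s) (1 + normc (a k) ^+ 2))).
    apply: ler_sum => k _; rewrite normcM normc_torus_char mulr1.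
    by have := sqr_ge0 (normc (a k) - 1); have := normc_ge0 (a k); nra.
  rewrite big_split /= big_const_seq count_predT iter_addr_0.
  have h1 := card lam s l1' us s4.
  have h2 : 1 <= lam ^+ n.+3 by exact: exprn_ege1.
  have h3 := ler_wpM2l M0 h2; rewrite mulr1 in h3.
  by move: aM h1 h2 h3; move: (lam ^+ _) (\sum_(k <- s) _) => y z; lra.
pose B := ep * ((1 + C1) * G `^ (p / 2)).
have Gp : 1 <= G `^ (p / 2).
  apply: (@le_trans _ _ (G `^ 0)); first by rewrite powRr0.
  by apply: ler_powR => //; rewrite divr_ge0// ltW.
have B1 : 1 <= B.
  by rewrite /B mulrA -[leLHS]mulr1; apply: ler_pM.
have FB j : expR j.+1%:R `^ p * fine (torus_measure R n.+3 [set x | expR j%:R < F x]) <= B.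
  have mu0 : 0 <= fine (torus_measure R n.+3 [set x | expR j%:R < F x]) by exact: fine_ge0.
  have := weak_powR C10 ld (expR_gt0 j%:R) mu0
    (weak lam delta s a (expR j%:R) l1' d0 (ltW d1) ld lg us sw aM (expR_gt0 _)).
  rewrite p2 -/p => h.
  have -> : expR j.+1%:R `^ p = ep * expR j%:R `^ p.
    by rewrite -natr1 addrC expRD powRM ?expR_ge0.
  by rewrite -mulrA /B ler_wpM2l// (le_trans ler01).
have [iF hF] := layer_cake_le mF F0 (ltW p0) FL FB.
pose X := (1 + L%:R) * (ep * (1 + C1)).
have X1 : 1 <= X.
  by rewrite /X -[leLHS]mulr1; apply: ler_pM => //; rewrite lerDl.
have IX : \int[torus_measure R n.+3]_x (F x `^ p) <= X * G `^ (p / 2).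
  apply: le_trans hF _; have -> : X * G `^ (p / 2) = B + L%:R * B by rewrite /X /B; ring.
  by rewrite lerD2r.
rewrite /torus_Lnorm unlock.
have -> : (\int[torus_measure R n.+3]_x
    (`|([eta EFin] \o (@normc R \o spectral_projector chi Q lam delta f)) x| `^ p))%E =
    (\int[torus_measure R n.+3]_x (F x `^ p))%:E.
  rewrite /Rintegral fineK; last exact: integrable_fin_num.
  apply: eq_integral => x _.
  transitivity ((`|normc (spectral_projector chi Q lam delta f x)| `^ p)%:E).
    by rewrite -poweR_EFin.
  by rewrite ger0_norm ?normc_ge0// sE.
rewrite poweR_EFin lee_fin.
have I0 : 0 <= \int[torus_measure R n.+3]_x (F x `^ p).
  by apply: Rintegral_ge0 => x _; exact: powR_ge0.
apply: (@le_trans _ _ (X * G `^ (2^-1))).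
  apply: le_trans (root_bound p1 X1 G0); apply: ge0_ler_powR => //; rewrite ?nnegrE//.
    by rewrite invr_ge0 ltW.
  by rewrite mulr_ge0 ?powR_ge0// (le_trans ler01).
rewrite main_exponent// -/G.
have c0 : 0 <= ep * (1 + C1) by exact: le_trans cap.
have XC : X <= C2 * (ep * (1 + C1)) * lam `^ eps.
  by rewrite /X mulrAC ler_wpM2r.
apply: le_trans (ler_wpM2r (powR_ge0 _ _) XC) _.
apply: ler_wpM2l.
  apply: mulr_ge0; last exact: powR_ge0.
  by apply: mulr_ge0 => //; exact: le_trans ler01 C21.
by rewrite lerDr powR_ge0.
Qed.
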